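(* Let $\delta\in\{\mathsf{none},\mathsf{down},\mathsf{up},\mathsf{updown}\}^n$. The cubical realization $\mathcal{C}_\delta$ is an embedding of the $\delta$-permutreehedron $\mathbb{PT}(\delta)$. In particular, the maximal cells of $\mathcal{C}_\delta$ are in bijection with the facets of the $\delta$-permutreehedron.
   Context: $[n]=\{1,\dots,n\}$. A permutree on $n$ vertices is a directed (unrooted, planar) tree $T$ with vertex set $\{v_1,\dots,v_n\}$, edges oriented from child to parent, such that each vertex $v_i$ has exactly one or two parents and exactly one or two children, and: if $v_i$ has two parents then every vertex $v_j$ in its left ancestor subtree $LA_i$ has $j<i$ and every $v_k$ in its right ancestor subtree $RA_i$ has $k>i$; if $v_i$ has two children then every $v_j$ in its left descendant subtree $LD_i$ has $j<i$ and every $v_k$ in its right descendant subtree $RD_i$ has $k>i$ (ancestor/descendant subtrees are the components of $T\setminus v_i$ containing the respective parents/children; if $v_i$ has one child, $D_i$ denotes its unique descendant subtree). The decoration $\delta(T)_i$ is $\mathsf{none}$, $\mathsf{down}$, $\mathsf{up}$, $\mathsf{updown}$ according as $v_i$ has (one parent, one child), (one parent, two children), (two parents, one child), (two parents, two children); $\mathcal{PT}_n(\delta)$ is the set of permutrees with decoration $\delta$ (convention $\delta_1=\delta_n=\mathsf{none}$). We write $i\to j$ if $v_i$ is a descendant of $v_j$. The edge cut of an edge $i\to j$ is the ordered partition $(I\,\|\,[n]\setminus I)$ where $I$ is the set of indices of vertices whose undirected path to $v_i$ avoids $v_j$. The rotation order (Pilaud–Pons) is the transitive closure of increasing edge rotations: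 for an edge $i\to j$ with $i<j$, the $ij$-edge rotation replaces it by an edge $j\to i$ (rearranging the adjacent subtrees) while preserving all other edge cuts; $T\lessdot T'$ denotes a cover. The cubic set of $T$ is $C(T)=\{(i,j): i<j,\ v_j\in D_i\text{ if }\delta_i\in\{\mathsf{none},\mathsf{up}\};\ v_j\in RD_i\text{ if }\delta_i\in\{\mathsf{down},\mathsf{updown}\}\}$, $C(T)_i=\{j:(i,j)\in C(T)\}$, and the cubic vector is $\vec{c}(T)=(|C(T)_1|,\dots,|C(T)_{n-1}|)$. The cubical realization $\mathcal{C}_\delta$ is the convex hull of all cubic vectors of $\delta$-permutrees (which lies in the box $[0,n-1]\times[0,n-2]\times\cdots\times[0,1]$), together with an edge between $\vec{c}(T)$ and $\vec{c}(T')$ whenever $T\lessdot T'$. The $\delta$-permutreehedron $\mathbb{PT}(\delta)$ is the polytope $\{\mathbf{x}\in\mathbb{R}^n:\sum_{i\in[n]}x_i=\binom{n+1}{2}\}\cap\bigcap_{I\in\mathcal{I}}\{\mathbf{x}:\sum_{i\in I}x_i\ge\binom{|I|+1}{2}\}$, where $\mathcal{I}$ is the set of proper subsets $I\subsetneq[n]$ such that some $\delta$-permutree has an edge with edge cut $(I\,\|\,[n]\setminus I)$; its facets are in bijection with $\mathcal{I}$ and its 1-skeleton is the Hasse diagram of the rotation lattice of $\delta$-permutrees. *)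

(* Defs.v *)
From HB Require Import structures.
From mathcomp Require Import all_boot all_order all_algebra.
From mathcomp Require Import all_classical all_reals all_analysis.

Set Implicit Arguments.
Unset Strict Implicit.
Unset Printing Implicit Defensive.

Import Order.TTheory GRing.Theory Num.Theory.

Local Open Scope ring_scope.

(* The vertices v_1, ..., v_n are indexed by 'I_n, hence shifted by one. *)

Inductive decoration : Type := none | down | up | updown.

Definition two_parents (d : decoration) : bool :=
  match d with up | updown => true | _ => false end.

Definition two_children (d : decoration) : bool :=
  match d with down | updown => true | _ => false end.

Section Trees.
Variable n : nat.
Implicit Types (T : {set 'I_n * 'I_n}) (delta : 'I_n -> decoration).

(* A directed graph T is its set of arcs; (i, j) \in T is the edge i -> j
   from the child v_i to the parent v_j. *)
Definition adjacent T : rel 'I_n :=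
  fun x y => ((x, y) \in T) || ((y, x) \in T).

Definition is_tree T : bool :=
  [forall x, forall y, connect (adjacent T) x y] && (#|T| == n.-1).

Definition parents T (i : 'I_n) : {set 'I_n} := [set j | (i, j) \in T].
Definition children T (i : 'I_n) : {set 'I_n} := [set j | (j, i) \in T].

(* The connected component of v_u in T \ v_i (meaningful for u != i). *)
Definition component T (i u : 'I_n) : {set 'I_n} :=
  [set w | connect (fun x y => [&& adjacent T x y, x != i & y != i]) u w].

(* N consists of at most one left and at most one right neighbour of v_i, with
   all labels of the left (right) subtree smaller (larger) than i. These
   conditions determine the side of a neighbour from its label, so that the
   planar structure need not be recorded. *)
Definition left_right T (i : 'I_n) (N : {set 'I_n}) : bool :=
  [&& (#|[set j in N | (j < i)%N]| <= 1)%N,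
      (#|[set j in N | (i < j)%N]| <= 1)%N
    & [forall j in N, forall k in component T i j, (j < i)%N == (k < i)%N]].

(* "Exactly one or two parents (children)" counts the slots around v_i, which
   are prescribed by the decoration; a slot not filled by another vertex ends
   in an unlabelled leaf, which is left implicit. *)
Definition is_permutree delta T : bool :=
  is_tree T &&
  [forall i,
    (if two_parents (delta i) then left_right T i (parents T i)
     else (#|parents T i| <= 1)%N) &&
    (if two_children (delta i) then left_right T i (children T i)
     else (#|children T i| <= 1)%N)].

Definition edge_cut T (e : 'I_n * 'I_n) : {set 'I_n} := component T e.2 e.1.

(* An edge cut (I || [n] \ I) is represented by its first block I. *)
Definition edge_cuts T : {set {set 'I_n}} := [set edge_cut T e | e in T].

Definition rotation delta : rel {set 'I_n * 'I_n} :=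
  fun T T' => [&& is_permutree delta T, is_permutree delta T' &
    [exists i : 'I_n, exists j : 'I_n,
      [&& (i < j)%N, (i, j) \in T, (j, i) \in T' &
          edge_cuts T :\ edge_cut T (i, j) ==
          edge_cuts T' :\ edge_cut T' (j, i)]]].

Definition rotation_lt delta : rel {set 'I_n * 'I_n} :=
  fun T T' => (T != T') && connect (rotation delta) T T'.

Definition rotation_cover delta : rel {set 'I_n * 'I_n} :=
  fun T T' => rotation_lt delta T T' &&
    ~~ [exists S, rotation_lt delta T S && rotation_lt delta S T'].

Definition descendants T (i : 'I_n) : {set 'I_n} :=
  \bigcup_(j in children T i) component T i j.

Definition right_descendants T (i : 'I_n) : {set 'I_n} :=
  \bigcup_(j in children T i | (i < j)%N) component T i j.

Definition cubic_set delta T : {set 'I_n * 'I_n} :=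
  [set p : 'I_n * 'I_n | (p.1 < p.2)%N &&
    (p.2 \in if two_children (delta p.1) then right_descendants T p.1
             else descendants T p.1)].

Definition cut_sets delta : {set {set 'I_n}} :=
  [set I : {set 'I_n} | (I \proper [set: 'I_n]) &&
           [exists T, is_permutree delta T && (I \in edge_cuts T)]].

End Trees.

Local Open Scope classical_set_scope.

Section Polytopes.
Variables (R : realType) (m : nat).
Implicit Types (A P F : set 'rV[R]_m).

Definition conv_hull A : set 'rV[R]_m := smallest (@convex_set R 'rV[R]_m) A.

(* The nonempty faces of P, including P itself. *)
Definition faces P : set (set 'rV[R]_m) :=
  [set F | F !=set0 /\ exists (a : 'rV[R]_m) (b : R),
     (forall x, P x -> \sum_i a 0 i * x 0 i <= b) /\
     F = P `&` [set x | \sum_i a 0 i * x 0 i = b]].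

Definition vertices P : set 'rV[R]_m := [set u | faces P [set u]].

Definition is_edge P (u v : 'rV[R]_m) : Prop :=
  u <> v /\ faces P (conv_hull [set u; v]).

Definition maximal_proper (K : set (set 'rV[R]_m)) (top : set 'rV[R]_m) :
    set (set 'rV[R]_m) :=
  [set Q | [/\ K Q, Q <> top &
    forall Q', K Q' -> Q' <> top -> Q `<=` Q' -> Q' = Q]].

Definition facets P : set (set 'rV[R]_m) := maximal_proper (faces P) P.

Definition relint A : set 'rV[R]_m :=
  [set x | A x /\
    forall y, A y -> exists2 e : R, 0 < e & A (x + e *: (x - y))].

End Polytopes.

Section Realization.
Variables (R : realType) (n : nat) (delta : 'I_n -> decoration).
Implicit Types (T S : {set 'I_n * 'I_n}) (F G : set 'rV[R]_n).

Definition permutrees : set {set 'I_n * 'I_n} := [set T | is_permutree delta T].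

Definition permutreehedron : set 'rV[R]_n :=
  [set x | \sum_i x 0 i = 'C(n.+1, 2)%:R /\
     forall I, I \in cut_sets delta ->
       'C(#|I|.+1, 2)%:R <= \sum_(i in I) x 0 i].

Definition cubic_vector T : 'rV[R]_n.-1 :=
  \row_(i < n.-1)
    #|[set j | (widen_ord (leq_pred n) i, j) \in cubic_set delta T]%SET|%:R.

Definition cubical_hull : set 'rV[R]_n.-1 :=
  conv_hull (cubic_vector @` permutrees).

Definition cubical_edge (c c' : 'rV[R]_n.-1) : Prop :=
  exists T T', [/\ c = cubic_vector T, c' = cubic_vector T' &
    rotation_cover delta T T' \/ rotation_cover delta T' T].

(* A cell keeps a set X of edge cuts of a permutree fixed and lets the other
   edges be rotated. Keeping all n-1 cuts gives a vertex, all but one an edge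
   of the cubical realization, and none the whole hull. *)
Definition cubical_cells : set (set 'rV[R]_n.-1) :=
  [set Q | exists T (X : {set {set 'I_n}}),
    [/\ is_permutree delta T, X \subset edge_cuts T &
      Q = conv_hull (cubic_vector @`
            [set S | is_permutree delta S /\ X \subset edge_cuts S])]].

Definition maximal_cells : set (set 'rV[R]_n.-1) :=
  maximal_proper cubical_cells cubical_hull.

Definition face_image (v : {set 'I_n * 'I_n} -> 'rV[R]_n) F :
    set 'rV[R]_n.-1 :=
  conv_hull (cubic_vector @` [set T | is_permutree delta T /\ F (v T)]).

(* The cubical realization embeds the polytope through v(T) |-> c(T): the
   1-skeleton is preserved, the faces correspond to the cells with the same
   inclusions, and the relative interiors of the cells decompose the hull, each
   cell being the disjoint union of the relative interiors of its subcells. *)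
Record cubical_embedding (v : {set 'I_n * 'I_n} -> 'rV[R]_n) : Prop := {
  embedding_vertices : set_bij (permutrees) (vertices permutreehedron) v;
  embedding_inj : set_inj (permutrees) cubic_vector;
  embedding_edges : forall T T', is_permutree delta T -> is_permutree delta T' ->
    is_edge permutreehedron (v T) (v T') <->
    cubical_edge (cubic_vector T) (cubic_vector T');
  embedding_hull : face_image v permutreehedron = cubical_hull;
  embedding_cells : set_bij (faces permutreehedron) cubical_cells (face_image v);
  embedding_mono : forall F G, faces permutreehedron F ->
    faces permutreehedron G -> face_image v F `<=` face_image v G <-> F `<=` G;
  embedding_covers : forall G x, faces permutreehedron G -> face_image v G x ->
    exists F, [/\ faces permutreehedron F, F `<=` G & relint (face_image v F) x];
  embedding_disjoint : forall F G x, faces permutreehedron F ->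
    faces permutreehedron G -> relint (face_image v F) x ->
    relint (face_image v G) x -> F = G
}.

End Realization.

(* Main.v *)
(** A real weight [a] on the labels has a chain of lower sets. A lower set [A] has
    walls, namely the labels with two parents inside [A] and the labels with two
    children outside [A], which split it into regions; the regions of all lower
    sets are the cuts of [a]. The cuts of an injective weight are the edge cuts
    of a unique permutree, and every permutree arises in this way. The cuts of an
    arbitrary weight are a set of cuts that a permutree may keep, and all such
    sets arise, so weights up to equality of cuts index the faces on both sides.

    On the side of the polytope, a supermodular function that counts runs of
    labels yields for each injective weight a point of the permutreehedron that
    is tight exactly on the cuts of the weight; Abel summation along the chain of
    lower sets shows that the face maximizing [a] consists of the points tight on
    the cuts of [a].

    On the cubical side, the [i]-th cubic coordinate is read off from the labels
    to the right of [i], and it lies between two bounds determined by [a] for all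
    permutrees that keep the cuts of [a]; every choice of lower and upper bounds
    is realized, so the cell of [a] is a box. Inserting the labels from right to
    left into the chain of lower sets shows that each point of the hull is in the
    relative interior of exactly one of these boxes. *)

Require Import Defs.
From mathcomp Require Import all_boot all_order all_algebra.
From mathcomp Require Import zify ring lra.

Set Implicit Arguments.
Unset Strict Implicit.
Unset Printing Implicit Defensive.

Import Order.TTheory GRing.Theory Num.Theory.

(** * Regions and cuts *)

Section Regions.
Variable n : nat.
Implicit Types (i j k s t b x y : 'I_n) (A B I K : {set 'I_n}) (U D : 'I_n -> bool).

(** A cut need not be a lower set: walls hide labels from one another, and a weight constrains only
    pairs that see each other. Controlling visibility is therefore the main burden. Reversing arcs
    complements cuts, exchanges [U] and [D] and negates weights, so most arguments treat one class
    of walls and are transported to the other.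

    The greedy point of the binomial ['C(#|J|.+1, 2)] is a vertex of the permutahedron and need not
    be tight on the cuts. A function is needed that has these values on admissible sets but may be
    smaller elsewhere. Its increments see [A] only through regions, which grow with [A]; this is
    supermodularity. Integrality makes every slack at least 1, so a unit step along an arc stays in
    the polytope and gives the edge directions.

    On the cubical side only cardinalities are available. They suffice because the competing right
    sets are nested, so equal size means equality. Ties of a weight are the degrees of freedom of a
    face; breaking them independently at each label gives the corners of its box. *)

Definition nearer (g s t : nat) : bool := (g <= s < t) || (t < s < g).

Definition btw (i t j : nat) : bool := (i < t < j) || (j < t < i).

Lemma btw_trl (i t s j : nat) : btw i t j -> btw t s j -> btw i s j.
Proof. rewrite /btw; lia. Qed.

Lemma btw_trr (i t s j : nat) : btw i t j -> btw i s t -> btw i s j.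
Proof. rewrite /btw; lia. Qed.

Lemma btwC (i t j : nat) : btw i t j = btw j t i.
Proof. by rewrite /btw orbC. Qed.

Definition wall U D A t : bool := if t \in A then U t else D t.

(* A number [g] stands for the gap to the left of the label [g]. On either side of
   this gap, the first wall fixes the membership of all labels behind it: they
   are in the region if the wall is in [A], and outside otherwise. *)
Definition region U D A (g : nat) : {set 'I_n} :=
  locked [set k : 'I_n | [exists t in A, ((t == k) || (nearer g t k && U t)) &&
                           [forall s : 'I_n, nearer g s t ==> (D s ==> (s \in A))]]].

Lemma regionP U D A (g : nat) k :
  reflect (exists t, [/\ t \in A, t = k \/ nearer g t k /\ U t &
                         forall s, nearer g s t -> D s -> s \in A])
          (k \in region U D A g).
Proof.
rewrite /region -lock inE.
apply: (iffP existsP) => [[t /and3P[tA h /forallP f]]|[t [tA h f]]].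
  exists t; split=> //.
    by case/orP: h => [/eqP|/andP[]]; [left|right].
  by move=> s h1 h2; have := f s; rewrite h1 h2.
exists t; rewrite tA /=; apply/andP; split.
  by case: h => [->|[-> ->]]; rewrite ?eqxx ?orbT.
by apply/forallP => s; apply/implyP => h1; apply/implyP => h2; apply: f.
Qed.

(** Membership in [A] occurs only positively in [region]; the definition by a witness instead of by
    the first wall makes this visible. The supermodularity of the potential rests on it. *)
Lemma regionS U D A B g : A \subset B -> region U D A g \subset region U D B g.
Proof.
move=> /subsetP sAB; apply/subsetP => k /regionP[t [tA h f]].
by apply/regionP; exists t; split; [exact: sAB| |move=> s h1 h2; apply/sAB/f].
Qed.

Lemma wallC U D A t : wall D U (~: A) t = wall U D A t.
Proof. by rewrite /wall inE; case: (t \in A). Qed.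

Lemma region_in U D A g k :
  (forall s, nearer g s k -> ~~ wall U D A s) ->
  (k \in region U D A g) = (k \in A).
Proof.
move=> h; apply/regionP/idP => [[t [tA [<-|[ntk Ut]] f]]|kA] //.
  by have := h t ntk; rewrite /wall tA Ut.
exists k; split=> //; first by left.
by move=> s /h; rewrite /wall; case: ifP => // _ /negP.
Qed.

Lemma region_wall U D A g t k :
  wall U D A t -> (forall s, nearer g s t -> ~~ wall U D A s) -> nearer g t k ->
  (k \in region U D A g) = (t \in A).
Proof.
move=> wt h ntk; apply/regionP/idP => [[t' [t'A ht' f]]|tA].
  apply/negPn/negP => tA; move: wt; rewrite /wall (negbTE tA) => Dt.
  have ht : nearer g t t' \/ t = t' \/ nearer g t' t.
    by case: ht' => [->|[H _]]; [left|case: (ltngtP t t') => e; first [by right; left; apply: val_inj|move: ntk H e; rewrite /nearer; lia]].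
  case: ht => [ht|[e|ht]].
  - by rewrite (f t ht Dt) in tA.
  - by rewrite e t'A in tA.
  - have [e|[_ Ut']] := ht'; first by move: ht ntk; rewrite e /nearer; lia.
    by have := h t' ht; rewrite /wall t'A Ut'.
exists t; split=> //.
  by right; split=> //; move: wt; rewrite /wall tA.
by move=> s /h; rewrite /wall; case: ifP => // _ /negP.
Qed.

Lemma nearest (P : pred 'I_n) g k :
  (forall s, nearer g s k -> ~~ P s) \/
  exists t, [/\ P t, nearer g t k & forall s, nearer g s t -> ~~ P s].
Proof.
have [|h] := boolP [exists s : 'I_n, nearer g s k && P s]; last first.
  left=> s hs; apply/negP => Ps; case/negP: h; apply/existsP; exists s.
  by rewrite hs.
case/existsP => s0 hs0; right.
pose Q := [pred s : 'I_n | nearer g s k && P s].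
have Q0 : Q s0 by [].
case: (arg_minnP (fun s : 'I_n => if g <= s then s - g else g - s) Q0).
move=> t /andP[ht Pt] hmin; exists t; split=> // s hs; apply/negP => Ps.
have hsk : nearer g s k by move: hs ht; rewrite /nearer; lia.
have := hmin s; rewrite /Q /= hsk Ps => /(_ isT).
by move: hs; rewrite /nearer; clear; case: ifP; case: ifP; lia.
Qed.

(** The walls of [A] for [U], [D] are those of its complement for [D], [U], so the same first wall
    decides and its verdict is reversed. This duality halves many later proofs. *)
Lemma region_dual U D A g : ~: region U D A g = region D U (~: A) g.
Proof.
apply/setP => k; rewrite inE.
have [h|[t [wt ntk h]]] := nearest (wall U D A) g k.
  rewrite (region_in h) (@region_in D U) ?inE // => s /h.
  by rewrite wallC.
rewrite (region_wall wt h ntk) (@region_wall D U _ _ t) ?inE ?wallC //.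
by move=> s /h; rewrite wallC.
Qed.

(** Moving the gap across [t] only changes the side on which [t] lies, which matters only if [t]
    blocks something. Hence regions change only at walls. *)
Lemma region_shift U D A t : ~~ wall U D A t -> region U D A t = region U D A t.+1.
Proof.
move=> wt; apply/setP => k.
have [ktE|kt] := eqVneq k t.
  rewrite ktE !region_in // => s; rewrite /nearer; lia.
have hn s : s != t -> nearer t s k = nearer t.+1 s k.
  move=> st; have : (s : nat) != t by []. 
  have : (k : nat) != t by [].
  rewrite /nearer; lia.
have hn' s r : s != t -> r != t -> nearer t s r = nearer t.+1 s r.
  move=> st rt; have : (s : nat) != t by []. 
  have : (r : nat) != t by [].
  rewrite /nearer; lia.
have [h|[s [ws nsk h]]] := nearest (wall U D A) t k.
  rewrite (region_in h) region_in // => s hs.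
  have [->//|st] := eqVneq s t.
  by apply: h; rewrite hn'.
have st : s != t by apply: contra wt => /eqP <-.
rewrite (region_wall ws h nsk) (@region_wall U D _ _ s) -?hn' //.
move=> r hr; have [->//|rt] := eqVneq r t.
by apply: h; rewrite hn'.
Qed.

Lemma region_const U D A g h : g <= h <= n ->
  (forall s, g <= s < h -> ~~ wall U D A s) -> region U D A g = region U D A h.
Proof.
elim: h => [|h IH] /andP[gh hn] w; first by have -> : g = 0 by lia.
have [->//|ne] := eqVneq g h.+1.
rewrite IH; [|lia|by move=> s hs; apply: w; lia].
by apply: (@region_shift U D A (Ordinal hn)); apply: w => /=; lia.
Qed.

Definition vis U D I i j : bool := [forall t : 'I_n, btw i t j ==> ~~ wall U D I t].

Lemma visP U D I i j :
  reflect (forall t, btw i t j -> ~~ wall U D I t) (vis U D I i j).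
Proof.
by apply: (iffP forallP) => h t; [move/implyP: (h t)|apply/implyP/h].
Qed.

Lemma vis_dual U D I i j : vis D U (~: I) i j = vis U D I i j.
Proof. by apply: eq_forallb => t; rewrite wallC. Qed.

Lemma visC U D I i j : vis U D I i j = vis U D I j i.
Proof. by apply: eq_forallb => t; rewrite /btw orbC. Qed.

(** The left-right condition of a permutree read on a single cut: the labels of the class opposite
    to a wall lie all on one side of it. *)
Definition adm U D I : bool :=
  [forall b : 'I_n, forall x : 'I_n, forall y : 'I_n,
     (x < b < y) ==> (wall U D I b ==>
     (((x \in I) == (b \in I)) || ((y \in I) == (b \in I))))].

Lemma admP U D I :
  reflect (forall b x y, btw x b y -> wall U D I b ->
             (x \in I) = (b \in I) \/ (y \in I) = (b \in I)) (adm U D I).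
Proof.
apply: (iffP forallP) => [h b x y|h b].
  have H (x' y' : 'I_n) : x' < b < y' -> wall U D I b ->
      (x' \in I) = (b \in I) \/ (y' \in I) = (b \in I).
    move: (h b) => /forallP/(_ x')/forallP/(_ y')/implyP hh h1 h2.
    by move/implyP: (hh h1) => /(_ h2)/orP[]/eqP ->; [left|right].
  by move=> /orP[/H//|/H hh /hh []]; [right|left].
apply/forallP => x; apply/forallP => y; apply/implyP => h1; apply/implyP => h2.
by have [||->|->] := h b x y; rewrite ?eqxx ?orbT // /btw h1.
Qed.

Lemma adm_dual U D I : adm D U (~: I) = adm U D I.
Proof.
apply: eq_forallb => b; apply: eq_forallb => x; apply: eq_forallb => y.
by rewrite wallC !inE !(inj_eq negb_inj).
Qed.

Lemma region_beyond U D A g b k : b \in region U D A g -> U b -> nearer g b k ->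
  k \in region U D A g.
Proof.
move=> /regionP[t [tA h f]] Ub nbk; apply/regionP; exists t; split=> //.
right; case: h => [->|[h ->]] //; split=> //.
by move: h nbk; rewrite /nearer; clear; lia.
Qed.

Lemma region_adm U D A g : adm U D (region U D A g).
Proof.
apply/admP => b x y hb.
have hxy : nearer g b x \/ nearer g b y by move: hb; rewrite /btw /nearer; lia.
rewrite /wall; case: ifPn => bI wb.
  by case: hxy => /(region_beyond bI wb) ->; [left|right].
have bI' : b \in region D U (~: A) g by rewrite -region_dual in_setC.
by case: hxy => /(region_beyond bI' wb); rewrite -region_dual in_setC => /negbTE ->;
  [left|right].
Qed.

(** Only labels that see the other class are compared with [A]; those hidden behind walls may
    disagree. *)
Definition agree U D I A : Prop :=
  forall i j, i \in I -> j \notin I -> vis U D I i j -> i \in A /\ j \notin A.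

Lemma agree_dual U D I A : agree U D I A -> agree D U (~: I) (~: A).
Proof.
move=> h i j; rewrite !inE negbK => iI jI; rewrite vis_dual visC => v.
by have [-> ->] := h j i jI iI v.
Qed.

Lemma region_agree U D A g : agree U D (region U D A g) A.
Proof.
have H U' D' A' i j : i \in region U' D' A' g -> j \notin region U' D' A' g ->
    vis U' D' (region U' D' A' g) i j -> i \in A'.
  move=> /regionP[t [tA h f]] jI v.
  have [<-//|[h' Ut]] := h.
  case/negP: jI; have tI : t \in region U' D' A' g.
    by apply/regionP; exists t; split=> //; left.
  have [tj|tj] := eqVneq j t; first by rewrite tj.
  apply/regionP; exists t; split=> //; right; split=> //.
  have : ~~ btw i t j by apply/negP => /(visP _ _ _ _ _ v); rewrite /wall tI Ut.
  have : (j : nat) != t by []. 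
  by move: h'; rewrite /nearer /btw; lia.
move=> i j iI jI v; split; first exact: H iI jI v.
have := @H D U (~: A) j i; rewrite -region_dual !in_setC negbK visC vis_dual => /(_ jI iI v).
by [].
Qed.

(** Up to the first wall of [I] seen from the gap, [I] agrees with [A]; behind that wall
    admissibility forces the class of the wall. [H] gives one inclusion, its dual the other. *)
Lemma region_unique U D A I i j g : adm U D I -> agree U D I A ->
  i \in I -> j \notin I -> vis U D I i j -> minn i j < g <= maxn i j ->
  region U D A g = I.
Proof.
have H U' D' A' I' i' j' : adm U' D' I' -> agree U' D' I' A' ->
    i' \in I' -> j' \notin I' -> vis U' D' I' i' j' ->
    minn i' j' < g <= maxn i' j' -> I' \subset region U' D' A' g.
  move=> /admP ad ag iI jI v hg; apply/subsetP => k kI.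
  (* [s] sees [j']: there is no wall from the gap to [s] by assumption, and none between [i'] and
     [j'], which enclose the gap. *)
  have core s : s \in I' -> (forall r : 'I_n, nearer g r s -> ~~ wall U' D' I' r) -> s \in A'.
    move=> sI h; apply: (proj1 (ag s j' sI jI _)).
    apply/visP => r hr; have [rij|rij] := boolP (btw i' r j').
      by move/visP: v; apply.
    have [rI|/eqP rI] := eqVneq r i'.
      case: (ltngtP s i') => e; first by apply: h; move: hr hg; rewrite rI /btw /nearer; lia.
        by apply: h; move: hr hg; rewrite rI /btw /nearer; lia.
      by move: hr; rewrite /btw rI; lia.
    by apply: h; move: hr rij hg rI; rewrite /btw /nearer => ? ? ? /eqP; rewrite -(inj_eq val_inj) /=; lia.
  have coreD : forall s, (forall r : 'I_n, nearer g r s -> ~~ wall U' D' I' r) ->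
     forall q : 'I_n, nearer g q s -> D' q -> q \in A'.
    move=> s h r hr Dr; apply: core; last first.
      by move=> q hq; apply: h; move: hq hr; rewrite /nearer; lia.
    by have := h r hr; rewrite /wall; case: ifP => // _ /negP.
  have [h|[t [wt ntk h]]] := nearest (wall U' D' I') g k.
    by apply/regionP; exists k; split; [exact: core|left|exact: coreD].
  have tI : t \in I'.
    have ti : btw i' t k \/ t = i' \/ btw i' t j'.
      case: (ltngtP t i') => e; last by right; left; apply: val_inj.
        by move: ntk hg e; rewrite /btw /nearer; lia.
      by move: ntk hg e; rewrite /btw /nearer; lia.
    case: ti => [ti|[->//|ti]].
      by have [e|e] := ad _ _ _ ti wt; [rewrite -e|rewrite -e].
    by move/visP: v => /(_ t ti); rewrite wt.
  have Ut : U' t by move: wt; rewrite /wall tI.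
  apply/regionP; exists t; split; [exact: core|by right|exact: coreD].
move=> ad ag iI jI v hg; apply/eqP; rewrite eqEsubset (H U D A I i j) // andbT.
rewrite -setCS region_dual; apply: (H D U (~: A) (~: I) j i).
- by rewrite adm_dual.
- exact: agree_dual.
- by rewrite inE.
- by rewrite inE negbK.
- by rewrite vis_dual visC.
- by rewrite minnC maxnC.
Qed.

(** A wall in between replaces the endpoint of its own class. A member that is a wall satisfies [U]
    and a nonmember [D]; this is recorded since later proofs use a moved endpoint as a wall of
    another set. *)
Lemma seg_vis U D I i j : i \in I -> j \notin I -> exists i' j',
  [/\ i' \in I, j' \notin I, vis U D I i' j',
      i' = i \/ btw i i' j /\ U i' & j' = j \/ btw i j' j /\ D j'].
Proof.
(* With truncated subtraction this sum is the distance of the two labels; the same expression serves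
   as a distance below. *)
have [m hm] := ubnP ((i - j) + (j - i)); elim: m => // m IH in i j hm *.
move=> iI jI; have [v|] := boolP (vis U D I i j).
  by exists i, j; split=> //; left.
rewrite negb_forall => /existsP[t]; rewrite negb_imply negbK => /andP[ht].
rewrite /wall; case: ifPn => tI wt.
  have hm' : (t - j) + (j - t) < m by move: ht hm; rewrite /btw; clear; lia.
  have [i' [j' [h1 h2 h3 h4 h5]]] := IH t j hm' tI jI.
  exists i', j'; split=> //.
    by right; case: h4 => [->|[h4 ->]] //; split=> //; apply: btw_trl ht h4.
  by case: h5 => [->|[h5 h6]]; [left|right; split=> //; apply: btw_trl ht h5].
have hm' : (i - t) + (t - i) < m by move: ht hm; rewrite /btw; clear; lia.
have [i' [j' [h1 h2 h3 h4 h5]]] := IH i t hm' iI tI.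
exists i', j'; split=> //.
  by case: h4 => [->|[h4 h6]]; [left|right; split=> //; apply: btw_trr ht h4].
by right; case: h5 => [->|[h5 ->]] //; split=> //; apply: btw_trr ht h5.
Qed.

Lemma nontrivial_vis U D I : I != set0 -> I != setT -> exists i j,
  [/\ i \in I, j \notin I & vis U D I i j].
Proof.
case/set0Pn => i iI; rewrite -subTset => /subsetPn[j _ jI].
by have [i' [j' [? ? ? _ _]]] := seg_vis U D iI jI; exists i', j'.
Qed.

End Regions.

(** * Cuts of a weight and their arcs *)

Section WeightCuts.
Variables (R : realDomainType) (n : nat).
Implicit Types (i j k s t b x y u w : 'I_n) (A B I K : {set 'I_n}).
Implicit Types (U D : 'I_n -> bool) (a : 'I_n -> R).

Definition lower a A : Prop := forall i j, j \in A -> (a i <= a j)%R -> i \in A.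

Definition cuts U D a : {set {set 'I_n}} :=
  [set I : {set 'I_n} | [&& I != set0, I != setT, adm U D I &
    [forall i : 'I_n, forall j : 'I_n, (i \in I) ==> ((j \notin I) ==>
       (vis U D I i j ==> (a i < a j)%R))]]].

Lemma in_cuts U D a I : reflect
  [/\ I != set0, I != setT, adm U D I &
    forall i j, i \in I -> j \notin I -> vis U D I i j -> (a i < a j)%R]
  (I \in cuts U D a).
Proof.
rewrite inE; apply: (iffP and4P) => -[h1 h2 h3 h4]; split=> //.
  move=> i j iI jI v; move: h4 => /forallP/(_ i)/forallP/(_ j).
  by rewrite iI jI v.
apply/forallP => i; apply/forallP => j.
by apply/implyP => iI; apply/implyP => jI; apply/implyP => v; apply: h4.
Qed.

Lemma cuts_dual U D a I : (~: I \in cuts D U (fun i => - a i)%R) = (I \in cuts U D a).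
Proof.
have E J : (~: J == set0) = (J == setT) by rewrite -setCT (inj_eq (can_inj setCK)).
have E' J : (~: J == setT) = (J == set0) by rewrite -setC0 (inj_eq (can_inj setCK)).
apply/in_cuts/in_cuts; rewrite adm_dual E E' => -[h1 h2 h3 h]; split=> // i j.
  by move=> iI jI v; have := h j i; rewrite !in_setC negbK vis_dual visC ltrN2; apply.
by rewrite !in_setC negbK vis_dual visC ltrN2 => jI iI; apply: h.
Qed.

Lemma lower_lt a (c : R) : lower a [set k | (a k < c)%R].
Proof. by move=> i j; rewrite !inE => jc ij; apply: le_lt_trans jc. Qed.

Lemma lower_le a (c : R) : lower a [set k | (a k <= c)%R].
Proof. by move=> i j; rewrite !inE => jc ij; apply: le_trans jc. Qed.

Lemma lower_ltP a A i j : lower a A -> i \in A -> j \notin A -> (a i < a j)%R.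
Proof. by move=> h iA jA; rewrite ltNge; apply: contra jA => /(h _ _ iA). Qed.

Lemma region_cuts U D a A g : lower a A ->
  region U D A g != set0 -> region U D A g != setT -> region U D A g \in cuts U D a.
Proof.
move=> lA h0 hT; apply/in_cuts; split=> //; first exact: region_adm.
by move=> i j iI jI /(region_agree iI jI)[iA jA]; apply: lower_ltP lA iA jA.
Qed.

(** The visible crossing pairs form a complete bipartite graph: a wall blocking [x] from [y'] would
    have labels of the class opposite to its own on both sides. So the two ends of an arc can be
    optimized separately. *)
Lemma vis_cross U D I x y x' y' : adm U D I ->
  x \in I -> y \notin I -> vis U D I x y ->
  x' \in I -> y' \notin I -> vis U D I x' y' -> vis U D I x y'.
Proof.
move=> /admP ad xI yI /visP vxy xI' yI' /visP vxy'; apply/visP => t ht.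
apply/negP => wt; have nt1 : ~~ btw x t y.
  by apply/negP => /vxy; rewrite wt.
have nt2 : ~~ btw x' t y'.
  by apply/negP => /vxy'; rewrite wt.
have [tI|tI] := boolP (t \in I).
  have ty : (t : nat) != y by apply: contraNneq yI => /val_inj <-.
  have hb : btw y t y' by move: ht nt1 ty; rewrite /btw; lia.
  by case: (ad _ _ _ hb wt); rewrite tI ?(negbTE yI) ?(negbTE yI').
have tx : (t : nat) != x' by apply: contraNneq tI => /val_inj ->.
have hb : btw x t x' by move: ht nt2 tx; rewrite /btw; lia.
by case: (ad _ _ _ hb wt); rewrite (negbTE tI) ?xI ?xI'.
Qed.

(** [A] is the lower set generated by the members of [I] that see a nonmember. A visible nonmember
    stays outside it because, by [vis_cross], it is heavier than each generator. *)
Lemma cuts_region U D a I : I \in cuts U D a -> exists A g,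
  [/\ lower a A, agree U D I A, g < n & I = region U D A g].
Proof.
move=> /in_cuts[h0 hT ad h].
have [i [j [iI jI v]]] := nontrivial_vis U D h0 hT.
pose A := [set k : 'I_n | [exists x : 'I_n, exists y : 'I_n,
  [&& x \in I, y \notin I, vis U D I x y & (a k <= a x)%R]]].
have lA : lower a A.
  move=> k l; rewrite !inE => /existsP[x /existsP[y /and4P[h1 h2 h3 h4]]] kl.
  by apply/existsP; exists x; apply/existsP; exists y; rewrite h1 h2 h3 (le_trans kl).
have ag : agree U D I A.
  move=> x y xI yI vxy; split.
    by rewrite inE; apply/existsP; exists x; apply/existsP; exists y; rewrite xI yI vxy /=.
  apply/negP; rewrite inE => /existsP[x' /existsP[y' /and4P[h1 h2 h3 h4]]].
  have := h x' y h1 yI (vis_cross ad h1 h2 h3 xI yI vxy).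
  by rewrite ltNge h4.
exists A, (maxn i j); split=> //; first by rewrite gtn_max !ltn_ord.
symmetry; apply: (region_unique ad ag iI jI v).
rewrite leqnn andbT; have : (i : nat) != j by apply: contraNneq jI => /val_inj <-.
by lia.
Qed.

Lemma cuts_refine U D a (b : 'I_n -> R) : (forall i j, (a i < a j)%R -> (b i < b j)%R) ->
  cuts U D a \subset cuts U D b.
Proof.
move=> h; apply/subsetP => I /in_cuts[h0 hT ad hI]; apply/in_cuts; split=> //.
by move=> i j iI jI v; apply/h/hI.
Qed.

(* [u -> w] is the arc with cut [K]: [u] is the last member and [w] the first
   nonmember of [K] that see each other past the walls. *)
Definition ends U D a K u w : bool :=
  [&& u \in K, w \notin K, vis U D K u w &
   [forall i : 'I_n, forall j : 'I_n, (i \in K) ==> ((j \notin K) ==>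
       (vis U D K i j ==> (a i <= a u)%R && (a w <= a j)%R))]].

Lemma endsP U D a K u w : reflect
  [/\ u \in K, w \notin K, vis U D K u w &
    forall i j, i \in K -> j \notin K -> vis U D K i j ->
      (a i <= a u)%R /\ (a w <= a j)%R]
  (ends U D a K u w).
Proof.
apply: (iffP and4P) => -[h1 h2 h3 h4]; split=> //.
  move=> i j iI jI v; move: h4 => /forallP/(_ i)/forallP/(_ j).
  by rewrite iI jI v /= => /andP.
apply/forallP => i; apply/forallP => j.
apply/implyP => iI; apply/implyP => jI; apply/implyP => v.
by apply/andP; apply: h4.
Qed.

Lemma ends_dual U D a K u w :
  ends D U (fun i => - a i)%R (~: K) w u = ends U D a K u w.
Proof.
apply/endsP/endsP; rewrite !in_setC negbK vis_dual visC => -[h1 h2 h3 h]; split=> //.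
  move=> i j iI jI v; have [] := h j i; rewrite ?in_setC ?negbK ?vis_dual 1?visC //.
  by rewrite !lerN2.
move=> i j; rewrite !in_setC negbK vis_dual visC => iI jI v.
by have [] := h j i jI iI v; rewrite !lerN2.
Qed.

Lemma cut_ends U D a K : K \in cuts U D a -> exists u w, ends U D a K u w.
Proof.
move=> /in_cuts[h0 hT ad h].
have [i [j [iI jI v]]] := nontrivial_vis U D h0 hT.
pose P := [pred x : 'I_n | (x \in K) && [exists y : 'I_n, (y \notin K) && vis U D K x y]].
pose Q := [pred y : 'I_n | (y \notin K) && [exists x : 'I_n, (x \in K) && vis U D K x y]].
have P0 : P i by rewrite /P /= iI; apply/existsP; exists j; rewrite jI.
have Q0 : Q j by rewrite /Q /= jI; apply/existsP; exists i; rewrite iI.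
case: (@arg_maxP _ R _ i P a P0) => u /andP[uK /existsP[y /andP[yK vy]]] umax.
case: (@arg_minP _ R _ j Q a Q0) => w /andP[wK /existsP[x /andP[xK vx]]] wmin.
exists u, w; apply/endsP; split=> //; first exact: vis_cross yK vy xK wK vx.
move=> i' j' iI' jI' v'; split.
  by apply: umax; rewrite /P /= iI'; apply/existsP; exists j'; rewrite jI'.
by apply: wmin; rewrite /Q /= jI'; apply/existsP; exists i'; rewrite iI'.
Qed.

Lemma ends_inj U D a K u w u' w' : injective a ->
  ends U D a K u w -> ends U D a K u' w' -> u = u' /\ w = w'.
Proof.
move=> ia /endsP[uK wK v h] /endsP[uK' wK' v' h'].
have [h1 h2] := h _ _ uK' wK' v'; have [h1' h2'] := h' _ _ uK wK v.
by split; apply/ia/le_anti/andP.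
Qed.

Lemma ends_lt U D a K u w : K \in cuts U D a -> ends U D a K u w -> (a u < a w)%R.
Proof. by move=> /in_cuts[_ _ _ h] /endsP[uK wK v _]; apply: h. Qed.

Lemma ends_agree U D a K u w A :
  ends U D a K u w -> lower a A -> u \in A -> w \notin A -> agree U D K A.
Proof.
move=> /endsP[uK wK v h] lA uA wA i j iK jK vij; have [h1 h2] := h i j iK jK vij.
split; first exact: lA uA h1.
by apply: contra wA => jA; apply: lA jA h2.
Qed.

(** The lower set only has to separate [u] from [w]. One lower set and one gap can thus serve two
    cuts, which is how cuts are proved equal. *)
Lemma ends_region U D a K u w A i j (g : nat) :
  K \in cuts U D a -> ends U D a K u w ->
  lower a A -> u \in A -> w \notin A ->
  i \in K -> j \notin K -> vis U D K i j ->
  minn i j < g <= maxn i j -> region U D A g = K.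
Proof.
move=> /in_cuts[_ _ ad _] e lA uA wA; apply: region_unique => //.
exact: ends_agree e lA uA wA.
Qed.

Lemma minmax_lt i j : i != j -> minn i j < maxn i j.
Proof. by rewrite -(inj_eq val_inj) /=; lia. Qed.

(** This says that the arcs are bridges. A visible pair for [K] found between [u'] and [w'] must be
    [u'], [w'] itself, and then both cuts are regions of the same lower set at the same gap. *)
Lemma crossing_ends U D a K K' u' w' :
  K \in cuts U D a -> K' \in cuts U D a -> ends U D a K' u' w' ->
  (u' \in K) != (w' \in K) -> K = K'.
Proof.
move=> hK hK' e' ne; have [u [w e]] := cut_ends hK.
have /in_cuts[_ _ ad h] := hK; have /in_cuts[_ _ ad' h'] := hK'.
have ltuw := ends_lt hK e; have ltuw' := ends_lt hK' e'.
have /endsP[uK' wK' v' hh'] := e'; have /endsP[uK wK v hh] := e.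
have [i [j [iK jK uw]]] : exists i j, [/\ i \in K, j \notin K &
    (i = u' /\ j = w') \/ (i = w' /\ j = u')].
  case: (boolP (u' \in K)) ne; case: (boolP (w' \in K)) => // h1 h2 _.
    by exists u', w'; split=> //; left.
  by exists w', u'; split=> //; right.
have bE t : btw i t j -> btw u' t w' by case: uw => -[-> ->] //; rewrite /btw orbC.
have [i' [j' [iK' jK' vv hi hj]]] := seg_vis U D iK jK.
have lij := h _ _ iK' jK' vv.
have inner t : btw u' t w' -> (t \in K' -> (a t <= a u')%R) /\ (t \notin K' -> (a w' <= a t)%R).
  move=> ht; split=> tK; [have [] := hh' t w' tK wK'|have [] := hh' u' t uK' tK] => //.
  - by apply/visP => s hs; move/visP: v'; apply; exact: btw_trl ht hs.
  - by apply/visP => s hs; move/visP: v'; apply; exact: btw_trr ht hs.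
(* A moved [i'] satisfies [U], so it is outside [K']: otherwise it would be a wall of [K'] between
   [u'] and [w']. Hence it is at least as heavy as [w']; dually for [j']. *)
have Hi : i' = i \/ (a w' <= a i')%R.
  case: hi => [->|[hi Ui]]; [by left|right].
  apply: (proj2 (inner _ (bE _ hi))); apply/negP => iK''.
  by have /visP/(_ _ (bE _ hi)) := v'; rewrite /wall iK'' Ui.
have Hj : j' = j \/ (a j' <= a u')%R.
  case: hj => [->|[hj Dj]]; [by left|right].
  apply: (proj1 (inner _ (bE _ hj))); apply/negPn/negP => jK''.
  by have /visP/(_ _ (bE _ hj)) := v'; rewrite /wall (negbTE jK'') Dj.
have [ajw aui] : (a j <= a w')%R /\ (a u' <= a i)%R.
  by case: uw => -[-> ->]; rewrite ?lexx ?(ltW ltuw').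
(* Moving either endpoint contradicts that [i'] is lighter than [j']. *)
have [iE jE] : i' = i /\ j' = j.
  case: Hi => [iE|Hi]; case: Hj => [jE|Hj] //; exfalso.
  - by move: lij; rewrite iE => /(fun l => le_lt_trans aui (lt_le_trans l Hj)); rewrite ltxx.
  - by move: lij; rewrite jE => /(fun l => le_lt_trans Hi (lt_le_trans l ajw)); rewrite ltxx.
  - by move: (lt_trans (le_lt_trans Hi (lt_le_trans lij Hj)) ltuw'); rewrite ltxx.
case: uw => -[iE' jE']; last first.
  by move: lij; rewrite iE jE iE' jE' => /(lt_trans ltuw'); rewrite ltxx.
move: vv iK jK; rewrite iE jE iE' jE' => vv u'K w'K.
have [h1 h2] := hh _ _ u'K w'K vv.
pose A := [set k | (a k <= a u)%R].
have lA : lower a A by exact: lower_le.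
have uA : u \in A by rewrite inE.
have wA : w \notin A by rewrite inE -ltNge.
have u'A : u' \in A by rewrite inE.
have w'A : w' \notin A by rewrite inE -ltNge (lt_le_trans ltuw).
have uw' : minn u' w' < maxn u' w'.
  by apply: minmax_lt; apply: contraNneq wK' => <-.
rewrite -(ends_region (g := maxn u' w') hK e lA uA wA u'K w'K vv) ?uw' ?leqnn //.
by rewrite (ends_region (g := maxn u' w') hK' e' lA u'A w'A uK' wK' v') ?uw' ?leqnn.
Qed.

Lemma ends_step U D a K u w i : injective a -> K \in cuts U D a ->
  ends U D a K u w -> i \in K -> vis U D K i w -> i != u ->
  (a i < a u)%R /\ forall t, btw i t u -> ~~ wall U D [set k | (a k < a u)%R] t.
Proof.
move=> ia /in_cuts[_ _ /admP ad hK] /endsP[uK wK /visP vu h] iK vi iu.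
have [liu _] := h i w iK wK vi; move/visP: vi => vi.
split; first by rewrite lt_neqAle liu (inj_eq ia) iu.
have nw t : btw i t u -> ~~ wall U D K t.
  move=> ht; have [tw|tw] := eqVneq (t : nat) w.
    have tw' : t = w by apply: val_inj.
    rewrite tw'; have hw : btw i w u by rewrite -tw.
    apply/negP => /(ad _ _ _ hw).
    by rewrite iK uK (negbTE wK) => -[].
  have [/vi//|/vu//] : btw i t w \/ btw u t w.
  by move: ht tw; rewrite /btw; clear; lia.
move=> t ht; have := nw t ht; rewrite {1}/wall.
case: ifP => tK nwt.
  have vt : vis U D K t w.
    apply/visP => s hs; have [/vi//|/vu//] : btw i s w \/ btw u s w.
    by move: ht hs; rewrite /btw; clear; lia.
  have [ltu _] := h t w tK wK vt.
  rewrite /wall inE lt_neqAle ltu (inj_eq ia) andbT.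
  suff -> : t != u by [].
  by apply: contraTneq ht => ->; rewrite /btw; clear; lia.
have vt : vis U D K u t.
  by apply/visP => s hs; apply: nw; apply: btw_trl ht _; rewrite btwC.
have [_ lwt] := h u t uK (negbT tK) vt.
have luw := hK u w uK wK (introT (visP _ _ _ _ _) vu).
by rewrite /wall inE ltNge (ltW (lt_le_trans luw lwt)).
Qed.

Lemma ends_step_dual U D a K u w j : injective a -> K \in cuts U D a ->
  ends U D a K u w -> j \notin K -> vis U D K u j -> j != w ->
  (a w < a j)%R /\ forall t, btw w t j -> ~~ wall U D [set k | (a k <= a w)%R] t.
Proof.
move=> ia; rewrite -cuts_dual -ends_dual -in_setC -vis_dual visC => hK he jK v jw.
have ia' : injective (fun i => - a i)%R by move=> x y /oppr_inj/ia.
have [h1 h2] := ends_step ia' hK he jK v jw.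
split; first by move: h1; rewrite ltrN2.
move=> t; rewrite btwC => /h2; rewrite -wallC; congr (~~ wall _ _ _ _).
by apply/setP => k; rewrite !inE ltrN2 ltNge negbK.
Qed.

(** Induction on the number of labels with weight from [a i] up to, but excluding, [a j]. The cut at
    a gap between [i] and [j] has an arc [u -> w] with weights in this range, and the pairs [i], [u]
    and [w], [j] span fewer labels. *)
Lemma arcs_connect U D a (e : rel 'I_n) : injective a -> symmetric e ->
  (forall K u w, K \in cuts U D a -> ends U D a K u w -> e u w) ->
  forall A i j, lower a A -> i \in A -> j \notin A ->
    (forall t, btw i t j -> ~~ wall U D A t) -> connect e i j.
Proof.
move=> ia se he A i j.
have [m hm] := ubnP #|[set k | (a i <= a k < a j)%R]|.
elim: m => // m IH in A i j hm * => lA iA jA nw.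
(* The gap to the left of the larger label lies between [i] and [j]; as no wall of [A] intervenes,
   the region agrees with [A] from [i] to [j]. *)
pose g := maxn i j.
have ij : (i : nat) != j by apply: contraNneq jA => /val_inj <-.
have iK : i \in region U D A g.
  rewrite region_in // => s hs; apply: nw.
  by move: hs ij; rewrite /nearer /btw /g; clear; lia.
have jK : j \notin region U D A g.
  rewrite region_in // => s hs; apply: nw.
  by move: hs ij; rewrite /nearer /btw /g; clear; lia.
set K := region U D A g in iK jK.
have mem t : btw i t j -> (t \in K) = (t \in A).
  move=> ht; rewrite /K region_in // => s hs; apply: nw.
  by move: ht hs; rewrite /nearer /btw /g; clear; lia.
have v : vis U D K i j by apply/visP => t ht; rewrite /wall mem //; apply: nw.
have hK : K \in cuts U D a.
  apply: region_cuts lA _ _; first by apply/set0Pn; exists i.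
  by rewrite -subTset; apply/subsetPn; exists j.
have /in_cuts[_ _ ad _] := hK.
have [u [w huw]] := cut_ends hK.
have /endsP[uK wK vuw h] := huw; have [liu lwj] := h i j iK jK v.
have ltuw := ends_lt hK huw.
have c1 : connect e i u.
  have [->|iu] := eqVneq i u; first exact: connect0.
  have viw := vis_cross ad iK jK v uK wK vuw.
  have [lt nw'] := ends_step ia hK huw iK viw iu.
  apply: (IH [set k | (a k < a u)%R]) => //; last 3 first.
  - exact: lower_lt.
  - by rewrite inE.
  - by rewrite inE ltxx.
  rewrite -ltnS; apply: leq_trans hm; apply: proper_card; apply/properP; split.
    apply/subsetP => k; rewrite !inE => /andP[-> ku] /=.
    exact: lt_le_trans ku (ltW (lt_le_trans ltuw lwj)).
  exists u; first by rewrite inE liu (lt_le_trans ltuw).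
  by rewrite inE ltxx andbF.
have c2 : connect e w j.
  have [->|wj] := eqVneq j w; first exact: connect0.
  have vuj := vis_cross ad uK wK vuw iK jK v.
  have [lt nw'] := ends_step_dual ia hK huw jK vuj wj.
  apply: (IH [set k | (a k <= a w)%R]) => //; last 3 first.
  - exact: lower_le.
  - by rewrite inE.
  - by rewrite inE -ltNge.
  rewrite -ltnS; apply: leq_trans hm; apply: proper_card; apply/properP; split.
    apply/subsetP => k; rewrite !inE => /andP[wk ->]; rewrite andbT.
    exact: ltW (le_lt_trans liu (lt_le_trans ltuw wk)).
  exists i; first by rewrite inE lexx (le_lt_trans liu (lt_le_trans ltuw lwj)).
  by rewrite inE leNgt (le_lt_trans liu ltuw).
by apply: connect_trans c1 (connect_trans (connect1 (he _ _ _ hK huw)) c2).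
Qed.

(** Consecutive labels have nothing in between, so [arcs_connect] applies to them without any
    condition on walls. *)
Lemma arcs_connected U D a (e : rel 'I_n) : injective a -> symmetric e ->
  (forall K u w, K \in cuts U D a -> ends U D a K u w -> e u w) ->
  forall i j, connect e i j.
Proof.
move=> ia se he; have sc := sym_connect_sym se.
have step i j : j = i.+1 :> nat -> connect e i j.
  move=> ji; have nb A t : btw i t j -> ~~ wall U D A t.
    by rewrite /btw ji; clear; lia.
  have nij : i != j by rewrite -(inj_eq val_inj) /= ji; clear; lia.
  have [lt|lt|/ia/eqP] := ltgtP (a i) (a j); last by rewrite (negbTE nij).
    apply: (arcs_connect ia se he (@lower_le a (a i))); rewrite ?inE //.
      by rewrite -ltNge.
    by move=> t; apply: nb.
  rewrite sc; apply: (arcs_connect ia se he (@lower_le a (a j))); rewrite ?inE //.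
    by rewrite -ltNge.
  by move=> t; rewrite btwC; apply: nb.
have up (m : nat) i j : j = i + m :> nat -> connect e i j.
  elim: m i j => [|m IH] i j ji.
    by have -> : i = j by apply: val_inj; rewrite /= ji addn0.
  have hi : i + m < n by apply: leq_ltn_trans (ltn_ord j); rewrite ji leq_add2l.
  by apply: connect_trans (IH i (Ordinal hi) erefl) (step _ _ _); rewrite /= ji addnS.
move=> i j; case: (leqP i j) => ij; first by apply: (up (j - i)); rewrite subnKC.
by rewrite sc; apply: (up (i - j)); rewrite subnKC // ltnW.
Qed.


End WeightCuts.

(** * Trees and permutrees *)

Section TreeCuts.
Variable n : nat.
Implicit Types (x y u w v r : 'I_n) (S K Z : {set 'I_n}) (T : {set 'I_n * 'I_n}).

Lemma connect_closed (e : rel 'I_n) Z x y :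
  (forall u w, e u w -> u \in Z -> w \in Z) -> connect e x y -> x \in Z -> y \in Z.
Proof.
move=> h /connectP[p ep ->]; elim: p x ep => //= z p IH x /andP[exz ep] xZ.
by apply: IH => //; apply: h exz xZ.
Qed.

Lemma adjacent_sym T : symmetric (adjacent T).
Proof. by move=> x y; rewrite /adjacent orbC. Qed.

Definition crosses S (e : 'I_n * 'I_n) : bool := (e.1 \in S) != (e.2 \in S).

Lemma crosses_in S x y : x \in S -> y \notin S -> crosses S (x, y).
Proof. by rewrite /crosses /= => -> /negbTE ->. Qed.

Lemma crosses_out S x y : x \in S -> y \notin S -> crosses S (y, x).
Proof. by rewrite /crosses /= => -> /negbTE ->. Qed.

Lemma crossing_arc T S x y : (forall u w, connect (adjacent T) u w) ->
  x \in S -> y \notin S -> exists e, (e \in T) && crosses S e.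
Proof.
move=> cT xS yS; apply/existsP; apply: contraNT yS => /existsPn h.
apply: connect_closed (cT x y) xS => u w /orP[] uw uS.
  by move: (h (u, w)); rewrite uw /crosses /= uS negbK => /eqP <-.
by move: (h (w, u)); rewrite uw /crosses /= uS negbK => /eqP ->.
Qed.

(** A vertex set is grown together with arcs inside it: as long as it is not everything,
    connectivity yields an arc that leaves it. *)
Lemma connected_arcs T : (forall u w, connect (adjacent T) u w) -> n.-1 <= #|T|.
Proof.
move=> cT; have [n0|n0] := posnP n.
  by have -> : n.-1 = 0 by rewrite n0.
suff H k : k < n -> exists S (F : {set 'I_n * 'I_n}),
    [/\ #|S| = k.+1, #|F| = k, F \subset T &
        forall e, e \in F -> e.1 \in S /\ e.2 \in S].
  have [|S [F [_ <- FT _]]] := H n.-1; first by rewrite prednK.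
  exact: subset_leq_card.
elim: k => [|k IH] kn.
  exists [set Ordinal n0], set0; rewrite cards1 cards0 sub0set; split=> // e.
  by rewrite inE.
have [S [F [cS cF FT hF]]] := IH (ltnW kn).
have /set0Pn[x xS] : S != set0 by rewrite -cards_eq0 cS.
have [y yS] : exists y, y \notin S.
  apply/existsP; rewrite -negb_forall; apply/negP => /forallP h.
  have : #|[set: 'I_n]| <= #|S| by apply/subset_leq_card/subsetP => z _.
  by rewrite cardsT card_ord cS leqNgt kn.
have [[u w] /andP[uwT]] := crossing_arc cT xS yS; rewrite /crosses /= => uw.
have eF : (u, w) \notin F by apply/negP => /hF[/= uS wS]; rewrite uS wS in uw.
pose z := if u \in S then w else u.
have zS : z \notin S by rewrite /z; case: ifPn uw => // uS; case: (w \in S).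
exists (z |: S), ((u, w) |: F); split.
- by rewrite cardsU1 zS cS.
- by rewrite cardsU1 eF cF.
- by rewrite subUset sub1set uwT.
- move=> e; rewrite !inE => /orP[/eqP ->/=|/hF[-> ->]]; last by rewrite !orbT.
  rewrite /z; case: (boolP (u \in S)) uw => uS; case: (boolP (w \in S)) => wS //= _;
  by rewrite eqxx ?orbT.
Qed.

(** Each arc is charged to its endpoint on the side of [K e] away from a root [r]. If two arcs
    shared this endpoint, the union of their far sides would be closed under adjacency and yet miss
    [r]. *)
Lemma bridged_arcs T (K : 'I_n * 'I_n -> {set 'I_n}) :
  (forall u w, connect (adjacent T) u w) ->
  (forall e, e \in T -> crosses (K e) e) ->
  (forall e f, e \in T -> f \in T -> crosses (K e) f -> f = e) ->
  #|T| <= n.-1.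
Proof.
move=> cT h1 h2; have [n0|n0] := posnP n.
  have -> : n.-1 = 0 by rewrite n0.
  rewrite leqn0 cards_eq0; apply/eqP/setP => -[u w].
  by have := ltn_ord u; rewrite {2}n0.
pose r := Ordinal n0.
pose S e := if r \in K e then ~: K e else K e.
have rS e : r \notin S e by rewrite /S; case: ifP => // rK; rewrite ?inE ?rK.
have cS e f : crosses (S e) f = crosses (K e) f.
  by rewrite /S; case: ifP => // _; rewrite /crosses !inE (inj_eq negb_inj).
pose far (e : 'I_n * 'I_n) := if e.1 \in S e then e.1 else e.2.
have farS e : e \in T -> far e \in S e.
  move=> /h1; rewrite -cS /crosses /far; case: ifP => // _.
  by case: (e.2 \in S e).
have far_in e p q : e \in T -> e = (p, q) \/ e = (q, p) -> p \in S e -> q \notin S e -> p = far e.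
  by move=> _ [] -> ; rewrite /far /= => pS qS; rewrite ?pS // (negbTE qS).
have far_inj : {in T &, injective far}.
  move=> e f eT fT ef; apply/eqP; apply: contraT => nef.
  pose Z := S e :|: S f.
  have rZ : r \in Z.
    apply: (connect_closed _ (cT (far e) r)); last by rewrite inE farS.
    move=> p q pq pZ; apply: contraT; rewrite inE negb_or => /andP[qe qf].
    have [x [xT xE]] : exists x : 'I_n * 'I_n, x \in T /\ (x = (p, q) \/ x = (q, p)).
      by case/orP: pq => H; [exists (p, q)|exists (q, p)]; split=> //; [left|right].
    have hx g : g \in T -> p \in S g -> q \notin S g -> x = g.
      move=> gT pg qg; apply: h2 => //; rewrite -cS /crosses.
      by case: xE => -> /=; rewrite pg (negbTE qg).
    have both : p \in S e /\ p \in S f.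
      move: pZ; rewrite inE => /orP[pe|pf].
        split=> //; have xe := hx e eT pe qe.
        have -> : p = far e by apply: far_in eT _ pe qe; rewrite -xe.
        by rewrite ef farS.
      split=> //; have xf := hx f fT pf qf.
      have -> : p = far f by apply: far_in fT _ pf qf; rewrite -xf.
      by rewrite -ef farS.
    by case/eqP: nef; rewrite -(hx e eT) ?(hx f fT) //; case: both.
  by move: rZ; rewrite inE (negbTE (rS e)) (negbTE (rS f)).
rewrite -(card_in_imset far_inj).
have -> : n.-1 = #|[set~ r]| by rewrite cardsC1 card_ord.
apply: subset_leq_card; apply/subsetP => _ /imsetP[e eT ->]; rewrite !inE.
by apply: contraNneq (rS e) => <-; apply: farS.
Qed.

Lemma component_cut T S u w : (forall x y, connect (adjacent T) x y) ->
  u \in S -> w \notin S ->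
  (forall x y, adjacent T x y -> x \in S -> y \notin S -> x = u /\ y = w) ->
  component T w u = S.
Proof.
move=> cT uS wS h; apply/eqP; rewrite eqEsubset; apply/andP; split.
  apply/subsetP => x; rewrite inE => /connect_closed; apply=> // p q.
  move=> /and3P[pq _ qw] pS; apply: contraT => qS.
  by have [_ qE] := h p q pq pS qS; rewrite qE eqxx in qw.
apply/subsetP => x xS; apply: contraT => xC.
have : u \in S :\: component T w u.
  apply: connect_closed (cT x u) _; last by rewrite inE xC.
  move=> p q pq; rewrite !in_setD => /andP[pC pS].
  have pw : p != w by apply: contraNneq wS => <-.
  have [qS|qS] := boolP (q \in S); last first.
    have [pu _] := h p q pq pS qS.
    by case/negP: pC; rewrite pu inE connect0.
  rewrite andbT; apply: contra pC; rewrite !inE => /connect_trans; apply.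
  apply: connect1; rewrite adjacent_sym pq pw andbT.
  by apply: contraNneq wS => <-.
by rewrite !inE connect0.
Qed.

(** Deleting the arc must disconnect its ends, since too few arcs remain for a connected graph.
    Hence no other arc crosses the component. *)
Lemma tree_cutP T u w : is_tree T -> (u, w) \in T ->
  [/\ u \in edge_cut T (u, w), w \notin edge_cut T (u, w),
      component T u w = ~: edge_cut T (u, w) &
      forall e, e \in T -> crosses (edge_cut T (u, w)) e -> e = (u, w)].
Proof.
move=> /andP[/forallP cT /eqP nT] uwT.
have {}cT x y : connect (adjacent T) x y by have /forallP := cT x; apply.
pose T' := T :\ (u, w).
pose K := [set x | connect (adjacent T') u x].
have sT' := sym_connect_sym (@adjacent_sym T').
have nuw : ~~ connect (adjacent T') u w.
  apply/negP => cuw.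
  have : n.-1 <= #|T'|.
    apply: connected_arcs => x y.
    have : y \in [set y | connect (adjacent T') x y].
      apply: connect_closed (cT x y) _; last by rewrite inE.
      move=> p q pq; rewrite !inE => /connect_trans; apply.
      have [e1|e1] := eqVneq (p, q) (u, w); first by case: e1 => -> ->.
      have [e2|e2] := eqVneq (q, p) (u, w).
        by case: e2 => -> ->; rewrite sT'.
      by apply: connect1; rewrite /adjacent !inE e1 e2.
    by rewrite inE.
  by rewrite -nT (cardsD1 (u, w) T) uwT ltnn.
have uK : u \in K by rewrite inE.
have wK : w \notin K by rewrite inE.
have hK e : e \in T -> crosses K e -> e = (u, w).
  case: e => p q pq; apply: contraTeq => ne; rewrite /crosses /= !inE negbK.
  have apq : connect (adjacent T') p q by apply: connect1; rewrite /adjacent !inE ne pq.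
  apply/eqP; apply/idP/idP => h; apply: connect_trans h _ => //.
  by rewrite sT'.
have hS p q : adjacent T p q -> p \in K -> q \notin K -> p = u /\ q = w.
  move=> /orP[] pq pK qK.
    have cr : crosses K (p, q) by rewrite /crosses /= pK (negbTE qK).
    by case: (hK _ pq cr) => -> ->.
  have cr : crosses K (q, p) by rewrite /crosses /= pK (negbTE qK).
  by case: (hK _ pq cr) => _ pw; rewrite -pw pK in wK.
have KE : edge_cut T (u, w) = K by apply: component_cut.
rewrite KE; split=> //.
apply: component_cut => //; rewrite ?in_setC ?negbK //.
move=> p q pq; rewrite !in_setC negbK => pK qK.
by have [] := hS q p; rewrite 1?adjacent_sym.
Qed.

Lemma tree_arc_neq T u w : is_tree T -> (u, w) \in T -> (u : nat) != w.
Proof.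
move=> tT uw; have [] := tree_cutP tT uw; move: (edge_cut _ _) => K uK wK _ _.
by apply: contraNneq wK => /val_inj <-.
Qed.

Lemma tree_connected T : is_tree T -> forall x y, connect (adjacent T) x y.
Proof. by move=> /andP[/forallP cT _] x y; have /forallP := cT x; apply. Qed.

Lemma edge_cut_inj T : is_tree T -> {in T &, injective (edge_cut T)}.
Proof.
move=> tT [u w] [u' w'] uw uw' e; have [h1 h2 _ _] := tree_cutP tT uw.
have [_ _ _ h] := tree_cutP tT uw'.
by apply: h => //; rewrite -e /crosses h1 (negbTE h2).
Qed.

Lemma card_edge_cuts T : is_tree T -> #|edge_cuts T| = n.-1.
Proof.
by move=> tT; rewrite card_in_imset; [case/andP: tT => _ /eqP|exact: edge_cut_inj].
Qed.

Lemma neighbour_towards T u w : (forall x y, connect (adjacent T) x y) -> u != w ->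
  exists x, adjacent T u x /\ w \in component T u x.
Proof.
move=> cT uw.
pose Z := [set y | connect (fun x y => [&& adjacent T x y, x != u & y != u]) w y].
have [/existsP[x /andP[xZ ux]]|/existsPn h] := boolP [exists x, (x \in Z) && adjacent T u x].
  exists x; split=> //; move: xZ; rewrite !inE sym_connect_sym // => p q.
  by rewrite adjacent_sym; congr (_ && _); rewrite andbC.
have : u \in Z.
  apply: connect_closed (cT w u) _; last by rewrite inE.
  move=> p q pq pZ.
  have pu : p != u.
    apply: contraTneq pZ => ->; rewrite inE; apply/negP => /connectP[s].
    case/lastP: s => [_ wu|s z]; first by rewrite wu eqxx in uw.
    rewrite rcons_path last_rcons => /andP[_ /and3P[_ _ zu]] uz.
    by rewrite uz eqxx in zu.
  have qu : q != u.
    apply: contraNneq (h p) => qu; rewrite -qu in pZ *.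
    by rewrite pZ adjacent_sym.
  move: pZ; rewrite !inE => /connect_trans; apply.
  by apply: connect1; rewrite pq pu qu.
rewrite inE => /connectP[s].
case/lastP: s => [_ wu|s z]; first by rewrite wu eqxx in uw.
rewrite rcons_path last_rcons => /andP[_ /and3P[_ _ zu]] uz.
by rewrite uz eqxx in zu.
Qed.

Lemma mem_edge_cuts T e : e \in T -> edge_cut T e \in edge_cuts T.
Proof. exact: imset_f. Qed.

(** Recovers the arcs from the edge cuts alone. The first edge from [u] towards [w] and the first
    from [w] towards [u] both separate [u] from [w]; if only one cut does, these edges coincide. *)
Lemma tree_arcE T u w : is_tree T ->
  reflect (exists K, [/\ K \in edge_cuts T, u \in K, w \notin K &
      forall K', K' \in edge_cuts T -> (u \in K') != (w \in K') -> K' = K])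
    ((u, w) \in T).
Proof.
move=> tT; apply: (iffP idP) => [uw|[K [KT uK wK h]]].
  have [h1 h2 _ h3] := tree_cutP tT uw.
  exists (edge_cut T (u, w)); split=> //; first exact: mem_edge_cuts.
  move=> _ /imsetP[[p q] pq ->] cr; have [_ _ _ h4] := tree_cutP tT pq.
  by rewrite (h4 (u, w)).
have cT := tree_connected tT.
have side x y z : adjacent T x y -> z \in component T x y ->
    exists e, [/\ e \in T & e = (x, y) /\ x \in edge_cut T e /\ z \notin edge_cut T e \/
        e = (y, x) /\ x \notin edge_cut T e /\ z \in edge_cut T e].
  move=> /orP[] xy zc.
    have [h1 h2 h3 h4] := tree_cutP tT xy; exists (x, y); split=> //; left.
    by split=> //; split=> //; rewrite h3 inE in zc.
  have [h1 h2 h3 h4] := tree_cutP tT xy; exists (y, x); split=> //; right.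
  by split.
have uw : u != w by apply: contraNneq wK => <-.
have [x [ux wx]] := neighbour_towards cT uw.
have [e [eT he]] := side u x w ux wx.
have wu : w != u by rewrite eq_sym.
have [y [wy uy]] := neighbour_towards cT wu.
have [f [fT hf]] := side w y u wy uy.
have eK : edge_cut T e = K.
  apply: h; first exact: mem_edge_cuts.
  by case: he => -[_ [h1 h2]]; rewrite ?h1 ?(negbTE h1) ?h2 ?(negbTE h2).
have fK : edge_cut T f = K.
  apply: h; first exact: mem_edge_cuts.
  by case: hf => -[_ [h1 h2]]; rewrite ?h1 ?(negbTE h1) ?h2 ?(negbTE h2).
have ef : e = f by apply: (edge_cut_inj tT) => //; rewrite eK.
rewrite eK in he; rewrite fK in hf.
case: he => -[eE [h1 h2]]; last by rewrite uK in h1.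
case: hf => -[fE [h3 h4]]; first by rewrite uK in h4.
by move: ef eT; rewrite eE fE => -[_ ->].
Qed.

Lemma edge_cuts_inj T T' : is_tree T -> is_tree T' -> edge_cuts T = edge_cuts T' -> T = T'.
Proof.
move=> tT tT' e; apply/setP => -[u w].
by apply/(tree_arcE _ _ tT)/(tree_arcE _ _ tT'); rewrite e.
Qed.

End TreeCuts.

(** * The permutree of an injective weight *)

Section WeightTree.
Variables (R : realDomainType) (n : nat) (delta : 'I_n -> decoration).
Implicit Types (i j k s t b x y u w : 'I_n) (A B I K : {set 'I_n}).

Definition ups i : bool := two_parents (delta i).
Definition downs i : bool := two_children (delta i).

Definition weight_tree (a : 'I_n -> R) : {set 'I_n * 'I_n} :=
  locked [set p | [exists K in cuts ups downs a, ends ups downs a K p.1 p.2]].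

Variable a : 'I_n -> R.
Hypothesis inj_a : injective a.

Local Notation T := (weight_tree a).
Local Notation cuta := (cuts ups downs a).
Local Notation enda := (ends ups downs a).

Lemma weight_treeP u w :
  reflect (exists K, K \in cuta /\ enda K u w) ((u, w) \in T).
Proof.
rewrite /weight_tree -lock inE.
apply: (iffP existsP) => [[K /andP[hK e]]|[K [hK e]]]; exists K => //.
by rewrite hK e.
Qed.

Lemma weight_tree_connected x y : connect (adjacent T) x y.
Proof.
apply: (@arcs_connected _ _ ups downs a _ inj_a (@adjacent_sym _ T)) => K u w hK e.
by apply/orP; left; apply/weight_treeP; exists K.
Qed.

(** [crossing_ends] is exactly the bridge condition of [bridged_arcs], which bounds the number of
    arcs from above. *)
Lemma weight_tree_tree : is_tree T.
Proof.
apply/andP; split.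
  by apply/forallP => x; apply/forallP => y; apply: weight_tree_connected.
pose K (e : 'I_n * 'I_n) := odflt set0 [pick K in cuta | enda K e.1 e.2].
have hK u w : (u, w) \in T -> K (u, w) \in cuta /\ enda (K (u, w)) u w.
  move=> /weight_treeP[L [hL e]]; rewrite /K; case: pickP => [M /andP[]//|/(_ L)].
  by rewrite hL e.
rewrite eqn_leq connected_arcs ?andbT; last exact: weight_tree_connected.
apply: (bridged_arcs (K := K) weight_tree_connected) => [[u w] /hK[_ /endsP[]]|].
  by rewrite /crosses /= => -> /negbTE ->.
move=> [u w] [u' w'] /hK[h1 h2] /hK[h3 h4] cr.
move: h2; rewrite (crossing_ends h1 h3 h4 cr) => h2.
by have [-> ->] := ends_inj inj_a h2 h4.
Qed.

Lemma weight_tree_cut K u w : K \in cuta -> enda K u w -> edge_cut T (u, w) = K.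
Proof.
move=> hK e; have /endsP[uK wK _ _] := e.
apply: (component_cut weight_tree_connected uK wK) => x y.
move=> /orP[] /weight_treeP[K' [hK' e']] xK yK.
  have E : K = K' by apply: (crossing_ends hK hK' e'); rewrite xK (negbTE yK).
  rewrite -E in e'; have [-> ->] := ends_inj inj_a e e'; by split.
have E : K = K' by apply: (crossing_ends hK hK' e'); rewrite xK (negbTE yK).
rewrite -E in e'; have [uy _] := ends_inj inj_a e e'.
by rewrite -uy uK in yK.
Qed.

Lemma weight_tree_cuts : edge_cuts T = cuta.
Proof.
apply/setP => K; apply/imsetP/idP => [[[u w] /weight_treeP[L [hL e]] ->]|hK].
  by rewrite (weight_tree_cut hL e).
have [u [w e]] := cut_ends hK; exists (u, w); last by rewrite (weight_tree_cut hK e).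
by apply/weight_treeP; exists K.
Qed.

Lemma weight_tree_arc u w : (u, w) \in T ->
  let K := edge_cut T (u, w) in K \in cuta /\ enda K u w.
Proof. by move=> /weight_treeP[K [hK e]] /=; rewrite (weight_tree_cut hK e). Qed.

(** The cut depends only on the side of [p], so there is at most one parent on each side; if [i] is
    no wall, both gaps next to [i] give the same region and there is one parent in all. *)
Lemma parent_region i p : (i, p) \in T ->
  edge_cut T (i, p) = region ups downs [set k | (a k <= a i)%R] (if p < i then i : nat else i.+1).
Proof.
move=> /weight_tree_arc /=; move: (edge_cut _ _) => K [hK e]; have /endsP[iK pK v _] := e.
have := ends_lt hK e => lt.
have ip : (i : nat) != p by apply: contraNneq pK => /val_inj <-.
symmetry; apply: (ends_region hK e (@lower_le _ _ a (a i)) _ _ iK pK v).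
- by rewrite inE.
- by rewrite inE -ltNge.
- by move: ip; case: ifP; clear; lia.
Qed.

Lemma child_region i c : (c, i) \in T ->
  edge_cut T (c, i) = region ups downs [set k | (a k < a i)%R] (if c < i then i : nat else i.+1).
Proof.
move=> /weight_tree_arc /=; move: (edge_cut _ _) => K [hK e]; have /endsP[cK iK v _] := e.
have := ends_lt hK e => lt.
have ip : (i : nat) != c by apply: contraNneq iK => /val_inj ->.
symmetry; apply: (ends_region hK e (@lower_lt _ _ a (a i)) _ _ cK iK v).
- by rewrite inE.
- by rewrite inE ltxx.
- by move: ip; case: ifP; clear; lia.
Qed.

Lemma parents_eq i p q : (i, p) \in T -> (i, q) \in T ->
  ((p < i) == (q < i)) || ~~ ups i -> p = q.
Proof.
move=> ip iq h.
have E : edge_cut T (i, p) = edge_cut T (i, q).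
  rewrite !parent_region //; case/orP: h => [/eqP -> //|ui].
  have sh : region ups downs [set k | (a k <= a i)%R] i =
            region ups downs [set k | (a k <= a i)%R] i.+1.
    by apply: region_shift; rewrite /wall inE lexx.
  by case: ifP; case: ifP.
by have [] := edge_cut_inj weight_tree_tree ip iq E.
Qed.

Lemma children_eq i p q : (p, i) \in T -> (q, i) \in T ->
  ((p < i) == (q < i)) || ~~ downs i -> p = q.
Proof.
move=> ip iq h.
have E : edge_cut T (p, i) = edge_cut T (q, i).
  rewrite !child_region //; case/orP: h => [/eqP -> //|ui].
  have sh : region ups downs [set k | (a k < a i)%R] i =
            region ups downs [set k | (a k < a i)%R] i.+1.
    by apply: region_shift; rewrite /wall inE ltxx.
  by case: ifP; case: ifP.
by have [] := edge_cut_inj weight_tree_tree ip iq E.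
Qed.

Lemma weight_tree_permutree : is_permutree delta T.
Proof.
apply/andP; split; first exact: weight_tree_tree.
have tT := weight_tree_tree.
apply/forallP => i; apply/andP; split; rewrite -/(ups i) -/(downs i).
  case: ifPn => ui.
    apply/and3P; split.
    - apply/card_le1_eqP => p q; rewrite !inE => /andP[ip pi] /andP[iq qi].
      by apply: (parents_eq iq ip); rewrite pi qi.
    - apply/card_le1_eqP => p q; rewrite !inE => /andP[ip pi] /andP[iq qi].
      by apply: (parents_eq iq ip); move: pi qi; clear; lia.
    - apply/forallP => p; apply/implyP; rewrite inE => ip.
      apply/forallP => k; apply/implyP.
      have [_ _ -> _] := tree_cutP tT ip; rewrite in_setC => kK.
      have [/in_cuts[_ _ /admP ad _] /endsP[iK pK _ _]] := weight_tree_arc ip.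
      have ki : (k : nat) != i.
        by apply/eqP => /val_inj e; move: kK; rewrite e iK.
      have pi := tree_arc_neq tT ip.
      have nb : ~~ btw p i k.
        apply/negP => /ad; rewrite /wall iK => /(_ ui).
        by rewrite (negbTE pK) (negbTE kK) => -[].
      by move: ki pi nb; rewrite /btw; clear; lia.
  apply/card_le1_eqP => p q; rewrite !inE => ip iq.
  by apply: (parents_eq iq ip); rewrite ui orbT.
case: ifPn => di.
  apply/and3P; split.
  - apply/card_le1_eqP => p q; rewrite !inE => /andP[ip pi] /andP[iq qi].
    by apply: (children_eq iq ip); rewrite pi qi.
  - apply/card_le1_eqP => p q; rewrite !inE => /andP[ip pi] /andP[iq qi].
    by apply: (children_eq iq ip); move: pi qi; clear; lia.
  - apply/forallP => p; apply/implyP; rewrite inE => ip.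
    apply/forallP => k; apply/implyP => kK.
    have {}kK : k \in edge_cut T (p, i) by [].
    have [/in_cuts[_ _ /admP ad _] /endsP[pK iK _ _]] := weight_tree_arc ip.
    have ki : (k : nat) != i.
      by apply/eqP => /val_inj e; move: kK; rewrite e (negbTE iK).
    have pi := tree_arc_neq tT ip.
    have nb : ~~ btw p i k.
      apply/negP => /ad; rewrite /wall (negbTE iK) => /(_ di).
      by rewrite pK kK => -[].
    by move: ki pi nb; rewrite /btw; clear; lia.
apply/card_le1_eqP => p q; rewrite !inE => ip iq.
by apply: (children_eq iq ip); rewrite di orbT.
Qed.

(** The region at the gap just right of [i] is the cut of the child arc of [i] leading to the labels
    counted by the cubic set. *)
Lemma weight_tree_cubic i j : ((i, j) \in cubic_set delta T) =
  (i < j) && (j \in region ups downs [set k | (a k < a i)%R] i.+1).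
Proof.
have tT := weight_tree_tree.
rewrite inE /=; case: (boolP (i < j)) => //= ij.
set A := [set k | (a k < a i)%R]; set Rg := region _ _ _ _.
have iA : i \notin A by rewrite inE ltxx.
have HE c : (c, i) \in T -> (~~ downs i) || (i < c) -> component T i c = Rg.
  move=> ci h; have -> : component T i c = edge_cut T (c, i) by [].
  rewrite child_region // -/A; case: ifP => // lt.
  rewrite ltnNge (ltnW lt) orbF in h.
  by rewrite (@region_shift _ _ _ _ i) // /wall (negbTE iA).
apply/idP/idP.
  rewrite -/(downs i); case: ifPn => di /bigcupP[c].
    by rewrite inE => /andP[ci ic]; rewrite HE // ic orbT.
  by rewrite inE => ci; rewrite HE // di.
move=> jR; have iR : i \notin Rg.
  by rewrite /Rg region_in // => s; rewrite /nearer; clear; lia.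
have lA : lower a A by apply: lower_lt.
have hR : Rg \in cuta.
  apply: region_cuts lA _ _; first by apply/set0Pn; exists j.
  by rewrite -subTset; apply/subsetPn; exists i.
have [u [w e]] := cut_ends hR; have /endsP[uR wR v h] := e.
(* No wall outside the region can lie between [i] and a member [j], as it would exclude [j]; so [i]
   is a visible nonmember. Any visible nonmember weighs at least [a i], hence [i] is the
   lightest. *)
have wE : w = i.
  have [i' [j' [iR' jR' vv _ hj]]] := seg_vis ups downs jR iR.
  have ji : j' = i.
    case: hj => [//|[hb dj]]; exfalso.
    have : j' \in region downs ups (~: A) i.+1 by rewrite -region_dual in_setC.
    have nj : nearer i.+1 j' j by move: hb ij; rewrite /nearer /btw; clear; lia.
    by move=> /region_beyond/(_ dj nj); rewrite -region_dual in_setC jR.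
  rewrite ji in vv jR'; have [_ wi] := h _ _ iR' jR' vv.
  have [_] := region_agree uR wR v; rewrite inE -leNgt => iw.
  by apply/inj_a/le_anti/andP.
rewrite wE in e v.
have ui : (u, i) \in T by apply/weight_treeP; exists Rg.
have cE : component T i u = Rg by apply: (weight_tree_cut hR e).
rewrite -/(downs i); case: ifPn => di; apply/bigcupP;
  exists u; rewrite ?cE //; rewrite inE ?ui //=.
have /in_cuts[_ _ /admP ad _] := hR.
have := tree_arc_neq tT ui; rewrite neq_ltn => /orP[lt|//]; exfalso.
have hb : btw u i j by rewrite /btw lt ij.
by case: (ad _ _ _ hb); rewrite ?/wall (negbTE iR) ?uR ?jR.
Qed.

End WeightTree.

(** * Reversal of all arcs *)

Section OppositeTree.
Variable n : nat.
Implicit Types (i j : 'I_n) (T : {set 'I_n * 'I_n}).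

Definition opp_decoration (d : decoration) : decoration :=
  match d with none => none | down => up | up => down | updown => updown end.

Definition opp_tree T : {set 'I_n * 'I_n} := [set e | (e.2, e.1) \in T].

Lemma opp_treeE T i j : ((i, j) \in opp_tree T) = ((j, i) \in T).
Proof. by rewrite inE. Qed.

Lemma adjacent_opp T i j : adjacent (opp_tree T) i j = adjacent T i j.
Proof. by rewrite /adjacent !opp_treeE orbC. Qed.

Lemma component_opp T i j : component (opp_tree T) i j = component T i j.
Proof.
apply/setP => k; rewrite !inE; apply: eq_connect => x y.
by rewrite adjacent_opp.
Qed.

Lemma parents_opp T i : parents (opp_tree T) i = children T i.
Proof. by apply/setP => j; rewrite !inE. Qed.

Lemma children_opp T i : children (opp_tree T) i = parents T i.
Proof. by apply/setP => j; rewrite !inE. Qed.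

Lemma left_right_opp T i N : left_right (opp_tree T) i N = left_right T i N.
Proof.
congr [&& _, _ & _]; apply: eq_forallb => j; congr (_ ==> _).
by apply: eq_forallb => k; rewrite component_opp.
Qed.

Lemma is_tree_opp T : is_tree T -> is_tree (opp_tree T).
Proof.
move=> /andP[/forallP cT /eqP nT]; apply/andP; split.
  apply/forallP => x; apply/forallP => y; have /forallP/(_ y) := cT x.
  by rewrite (eq_connect (adjacent_opp T)).
have sw : injective (fun e : 'I_n * 'I_n => (e.2, e.1)) by move=> [? ?] [? ?] [-> ->].
by rewrite -nT -(card_imset T sw); apply/eqP/eq_card => -[x y]; rewrite opp_treeE;
  apply/idP/imsetP => [h|[[p q] h [-> ->]]] //; exists (y, x).
Qed.

Lemma is_permutree_opp (delta : 'I_n -> decoration) T : is_permutree delta T ->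
  is_permutree (opp_decoration \o delta) (opp_tree T).
Proof.
move=> /andP[tT /forallP h]; apply/andP; split; first exact: is_tree_opp.
apply/forallP => i; move: (h i); rewrite /= parents_opp children_opp !left_right_opp.
by rewrite andbC; case: (delta i).
Qed.

Lemma edge_cut_opp T u w : is_tree T -> (u, w) \in T ->
  edge_cut (opp_tree T) (w, u) = ~: edge_cut T (u, w).
Proof.
by move=> tT uw; have [_ _ <- _] := tree_cutP tT uw; rewrite /edge_cut component_opp.
Qed.

End OppositeTree.

(** * Every permutree comes from its linear extensions *)

Section LinearExtension.
Variable n : nat.
Implicit Types (i j k s t b x y u w p q : 'I_n) (A B I K : {set 'I_n}).
Implicit Types (T : {set 'I_n * 'I_n}) (delta : 'I_n -> decoration).

Definition ancestor T : rel 'I_n := connect (fun x y => (x, y) \in T).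

Lemma ancestor_notin_cut T u w x y : is_tree T -> (u, w) \in T ->
  ancestor T x y -> x \notin edge_cut T (u, w) -> y \notin edge_cut T (u, w).
Proof.
move=> tT uw xy xK; have [uK wK _ h] := tree_cutP tT uw.
rewrite -in_setC; apply: connect_closed xy _; last by rewrite in_setC.
move=> p q pq; rewrite !in_setC => pK; apply: contra pK => qK.
apply: contraT => pK; have [pu _] : (p, q) = (u, w).
  by apply: h => //; first [exact: crosses_in|exact: crosses_out].
by rewrite pu uK in pK.
Qed.

Lemma arc_acyclic T u w : is_tree T -> (u, w) \in T -> ~~ ancestor T w u.
Proof.
move=> tT uw; have [uK wK _ h] := tree_cutP tT uw.
by apply/negP => wu; have := ancestor_notin_cut tT uw wu wK; rewrite uK.
Qed.

Lemma cut_nested T u w k p : is_tree T -> (u, w) \in T -> (k, p) \in T ->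
  ancestor T p u -> k \in edge_cut T (u, w) ->
  edge_cut T (k, p) \subset edge_cut T (u, w).
Proof.
move=> tT uw kp pu kK; have [uK wK _ h] := tree_cutP tT uw.
have [kL pL _ _] := tree_cutP tT kp.
have uL := ancestor_notin_cut tT kp pu pL.
apply/subsetP => x xL.
have : x \in edge_cut T (u, w) :&: edge_cut T (k, p).
  move: (xL); rewrite [in X in X -> _]inE => /connect_closed; apply; last by rewrite inE kK.
  move=> y z /and3P[yz yp zp]; rewrite !in_setI => /andP[yK yL].
  have zL : z \in edge_cut T (k, p).
    move: yL; rewrite !inE => /connect_trans; apply; apply: connect1.
    by rewrite yz yp zp.
  rewrite zL andbT; apply: contraT => zK.
  case/orP: yz => e.
    have [yu _] : (y, z) = (u, w) by apply: h => //; first [exact: crosses_in|exact: crosses_out].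
    by rewrite yu (negbTE uL) in yL.
  have [_ yw] : (z, y) = (u, w) by apply: h => //; first [exact: crosses_in|exact: crosses_out].
  by rewrite yw (negbTE wK) in yK.
by rewrite inE => /andP[].
Qed.

(** The first arc of a directed path from [b] to [u], or the arc [u -> w] itself, leads to
    everything outside the cut. *)
Lemma ancestor_side T u w b : is_tree T -> (u, w) \in T ->
  b \in edge_cut T (u, w) -> ancestor T b u ->
  exists p, [/\ (b, p) \in T, ~: edge_cut T (u, w) \subset component T b p &
               b = u /\ p = w \/ ancestor T p u].
Proof.
move=> tT uw bK /connectP[[|p s] /=].
  move=> _ ub; exists w; rewrite -ub; split=> //; last by left.
  by have [_ _ -> _] := tree_cutP tT uw.
move=> /andP[bp sp] us; exists p; have pu : ancestor T p u by apply/connectP; exists s.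
split=> //; last by right.
by have [_ _ -> _] := tree_cutP tT bp; rewrite setCS; apply: cut_nested.
Qed.

Lemma up_side delta T s p x : is_permutree delta T -> two_parents (delta s) ->
  (s, p) \in T -> x \in component T s p -> (p < s) = (x < s).
Proof.
move=> /andP[tT /forallP/(_ s)/andP[]]; case: (two_parents _) => // /and3P[_ _ h] _ _.
move=> sp xp; move/forallP: h => /(_ p)/implyP; rewrite inE => /(_ sp)/forallP/(_ x).
by move=> /implyP/(_ xp)/eqP.
Qed.

Lemma up_parents delta T s p q : is_permutree delta T ->
  (s, p) \in T -> (s, q) \in T -> p != q ->
  two_parents (delta s) /\ ((p < s) != (q < s)).
Proof.
move=> /andP[tT /forallP/(_ s)/andP[h _]] sp sq pq.
have nts y : (s, y) \in T -> (s : nat) != y.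
  exact: tree_arc_neq.
move: h; case: (two_parents _) => [/and3P[/card_le1_eqP h1 /card_le1_eqP h2 _]|]; last first.
  move=> /card_le1_eqP/(_ p q); rewrite !inE => /(_ sp sq) e.
  by rewrite e eqxx in pq.
split=> //; apply: contraNneq pq => e; apply/eqP.
have [lt|ge] := ltnP p s.
  by apply/esym/h1; rewrite !inE ?sp ?sq -?e.
have := nts _ sp; have := nts _ sq => ne1 ne2.
by apply/esym/h2; rewrite !inE ?sp ?sq /=; move: e ge ne1 ne2; clear; lia.
Qed.

(* On the way from [u] to a vertex of the cut, the first change of direction
   happens at a vertex with two parents, which separates labels. *)
Lemma cut_up delta T u w i : is_permutree delta T -> (u, w) \in T ->
  i \in edge_cut T (u, w) -> ancestor T i u \/
  exists s, [/\ s \in edge_cut T (u, w), two_parents (delta s) &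
    forall x, x \notin edge_cut T (u, w) -> btw i s x].
Proof.
move=> pT uw; have /andP[tT _] := pT; have [uK wK wE h] := tree_cutP tT uw.
set K := edge_cut T (u, w) in uK wK wE h *.
pose valley i := [exists s, exists p, exists q, [&& ancestor T s u, s \in K,
  (s, p) \in T, (s, q) \in T, p != q, ~: K \subset component T s p &
  i \in component T s q]].
pose Z := [set i in K | ancestor T i u || valley i].
move=> iK; have : i \in Z.
  move: (iK); rewrite /K [in X in X -> _]inE => /connect_closed; apply; last first.
    by rewrite inE uK /ancestor connect0.
  move=> k k' /and3P[kk' kw kw']; rewrite ![_ \in Z]inE => /andP[kK hk].
  have kK' : k' \in K.
    apply: contraT => kK'; case/orP: kk' => e.
      have [_ e'] : (k, k') = (u, w) by apply: h => //; rewrite /crosses /= kK (negbTE kK').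
      by rewrite e' eqxx in kw'.
    have [_ e'] : (k', k) = (u, w) by apply: h => //; rewrite /crosses /= kK (negbTE kK').
    by rewrite e' eqxx in kw.
  rewrite kK' /=; case/orP: hk => [ku|].
    case/orP: kk' => kk'; last first.
      by apply/orP; left; apply: connect_trans ku; apply: connect1.
    have [p [kp pc hp]] := ancestor_side tT uw kK ku.
    have [pk'|pk'] := eqVneq p k'.
      case: hp => [[_ e]|]; last by rewrite pk' => ->.
      by rewrite -pk' e eqxx in kw'.
    apply/orP; right; apply/existsP; exists k; apply/existsP; exists p.
    apply/existsP; exists k'; rewrite ku kK kp kk' pk' pc inE /=.
    exact: connect0.
  move=> /existsP[s /existsP[p /existsP[q /and5P[su sK sp sq /and3P[pq pc kc]]]]].
  have [<-|sk] := eqVneq s k'; first by rewrite su.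
  apply/orP; right; apply/existsP; exists s; apply/existsP; exists p.
  apply/existsP; exists q; rewrite su sK sp sq pq pc /=.
  have ks : k != s.
    have [h1 _ h2 _] := tree_cutP tT sq; apply: contraTneq kc => ->.
    by rewrite h2 in_setC negbK.
  move: kc; rewrite !inE => /connect_trans; apply; apply: connect1.
  by rewrite kk' ks eq_sym sk.
rewrite inE iK /= => /orP[|/existsP[s /existsP[p /existsP[q]]]]; first by left.
move=> /and5P[su sK sp sq /and3P[pq pc ic]]; right.
have [us pqs] := up_parents pT sp sq pq.
exists s; split=> // x xK.
have xc : x \in component T s p by apply: (subsetP pc); rewrite in_setC.
have e1 := up_side pT us sp xc; have e2 := up_side pT us sq ic.
have nx z y : (s, y) \in T -> z \in component T s y -> (z : nat) != s.
  move=> sy zc; have [h1 _ h2 _] := tree_cutP tT sy.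
  by apply/eqP => /val_inj e; move: zc; rewrite e h2 in_setC h1.
have := nx _ _ sp xc; have := nx _ _ sq ic.
by move: pqs e1 e2; rewrite /btw; clear; lia.
Qed.

Lemma ancestor_opp T x y : ancestor (opp_tree T) x y = ancestor T y x.
Proof.
have mono S z t : ancestor (opp_tree S) z t -> ancestor S t z.
  move=> /connectP[p]; elim: p z => [z _ ->|r p IH z]; first exact: connect0.
  rewrite /= opp_treeE => /andP[rz rp] /(IH _ rp)/connect_trans; apply.
  exact: connect1.
apply/idP/idP; first exact: mono.
have {1}-> : T = opp_tree (opp_tree T) by apply/setP => -[p q]; rewrite !opp_treeE.
exact: mono.
Qed.

Lemma cut_down delta T u w j : is_permutree delta T -> (u, w) \in T ->
  j \notin edge_cut T (u, w) -> ancestor T w j \/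
  exists s, [/\ s \notin edge_cut T (u, w), two_children (delta s) &
    forall x, x \in edge_cut T (u, w) -> btw j s x].
Proof.
move=> pT uw jK; have /andP[tT _] := pT.
have pT' := is_permutree_opp pT.
have wu : (w, u) \in opp_tree T by rewrite opp_treeE.
have E := edge_cut_opp tT uw.
have jK' : j \in edge_cut (opp_tree T) (w, u) by rewrite E in_setC.
have [|[s []]] := cut_up pT' wu jK'; rewrite ?ancestor_opp ?E; first by left.
rewrite in_setC => sK us h; right; exists s; split=> //.
  by move: us => /=; case: (delta s).
by move=> x xK; apply: h; rewrite in_setC negbK.
Qed.

Section PermutreeCuts.
Variables (R : realDomainType) (delta : 'I_n -> decoration).
Variables (T : {set 'I_n * 'I_n}) (pT : is_permutree delta T).

Definition linear_extension (a : 'I_n -> R) : Prop :=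
  injective a /\ forall u w, (u, w) \in T -> (a u < a w)%R.

Local Notation U := (ups delta).
Local Notation D := (downs delta).

Lemma edge_cut_adm u w : (u, w) \in T -> adm U D (edge_cut T (u, w)).
Proof.
(* [H] covers walls inside the cut; the others follow in the opposite tree. Either the whole
   complement of the cut lies in one ancestor subtree of [b], or a label [s] separates [b] from it;
   both put the complement on one side of [b]. *)
have H delta' T' u' w' b x y : is_permutree delta' T' -> (u', w') \in T' ->
    btw x b y -> b \in edge_cut T' (u', w') -> two_parents (delta' b) ->
    x \notin edge_cut T' (u', w') -> y \in edge_cut T' (u', w').
  move=> pT' uw hb bK ub xK; apply: contraT => yK; have /andP[tT' _] := pT'.
  have [bu|[s [sK us h]]] := cut_up pT' uw bK; last first.
    by have := h x xK; have := h y yK; move: hb; rewrite /btw; clear; lia.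
  have [p [bp pc _]] := ancestor_side tT' uw bK bu.
  have sx := up_side pT' ub bp (subsetP pc x _).
  have sy := up_side pT' ub bp (subsetP pc y _).
  have := sx; have := sy; rewrite !in_setC => /(_ yK) e1 /(_ xK).
  rewrite e1 => e2.
  have xb : (x : nat) != b by apply: contraNneq xK => /val_inj ->.
  have yb : (y : nat) != b by apply: contraNneq yK => /val_inj ->.
  by move: hb e2 xb yb; rewrite /btw; clear; lia.
move=> uw; apply/admP => b x y hb; rewrite /wall.
have /andP[tT _] := pT; case: ifPn => bK wb.
  have [xK|xK] := boolP (x \in edge_cut T (u, w)); first by left.
  by right; apply: H pT uw hb bK wb xK.
have wu : (w, u) \in opp_tree T by rewrite opp_treeE.
have E := edge_cut_opp tT uw.
have [xK|xK] := boolP (x \in edge_cut T (u, w)); last by left.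
right; have := H _ _ _ _ b x y (is_permutree_opp pT) wu hb.
rewrite E !in_setC negbK => h; apply/negbTE; apply: h => //.
by move: wb; rewrite /downs /=; case: (delta b).
Qed.

Lemma linear_extension_ancestor a x y :
  linear_extension a -> ancestor T x y -> (a x <= a y)%R.
Proof.
move=> [_ h] /connectP[p]; elim: p x => [x _ ->//|z p IH x /= /andP[xz zp] e].
exact: le_trans (ltW (h _ _ xz)) (IH _ zp e).
Qed.

(** A visible member is a descendant of [u] and a visible nonmember an ancestor of [w]: otherwise
    [cut_up] or [cut_down] provides a wall that hides them from each other. *)
Lemma linear_extension_edge_cuts a : linear_extension a ->
  edge_cuts T \subset cuts U D a.
Proof.
move=> la; apply/subsetP => _ /imsetP[[u w] uw ->]; have /andP[tT _] := pT.
have [uK wK _ _] := tree_cutP tT uw.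
apply/in_cuts; split; [by apply/set0Pn; exists u| |exact: edge_cut_adm|].
  by rewrite -subTset; apply/subsetPn; exists w.
move=> i j iK jK /visP v.
have [iu|[s [sK us h]]] := cut_up pT uw iK; last first.
  by have := v s (h j jK); rewrite /wall sK /ups us.
have [wj|[s [sK ds h]]] := cut_down pT uw jK; last first.
  by have := v s; rewrite btwC (h i iK) /wall (negbTE sK) /downs ds => /(_ isT).
have lt : (a u < a w)%R by apply: la.2.
apply: le_lt_trans (linear_extension_ancestor la iu) _.
exact: lt_le_trans lt (linear_extension_ancestor la wj).
Qed.

(** The other side is the set of edge cuts of a tree as well, so both have [n.-1] elements and one
    inclusion suffices. *)
Lemma linear_extension_cuts a : linear_extension a -> edge_cuts T = cuts U D a.
Proof.
move=> la; have /andP[tT _] := pT; apply/eqP.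
rewrite eqEcard linear_extension_edge_cuts //= -(weight_tree_cuts _ la.1).
by rewrite !card_edge_cuts //; exact: weight_tree_tree la.1.
Qed.

Lemma linear_extension_tree a : linear_extension a -> T = weight_tree delta a.
Proof.
move=> la; have /andP[tT _] := pT; apply: edge_cuts_inj => //.
  exact: weight_tree_tree la.1.
by rewrite (weight_tree_cuts _ la.1); exact: linear_extension_cuts.
Qed.

(** The number of descendants increases along arcs; the label, as the last digit in base [n], breaks
    ties. *)
Definition extension_weight (x : 'I_n) : R :=
  (#|[set z | ancestor T z x]| * n + x)%:R.

Lemma extension_weightP : linear_extension extension_weight.
Proof.
have /andP[tT _] := pT; split.
  move=> x y /eqP; rewrite eqr_nat => /eqP e; apply: val_inj.
  by have := congr1 (modn^~ n) e; rewrite !modnMDl !modn_small.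
move=> u w uw; rewrite ltr_nat.
apply: (@leq_trans (#|[set z | ancestor T z u]|.+1 * n)).
  by rewrite mulSn addnC ltn_add2r.
apply: leq_trans (leq_addr _ _); rewrite leq_mul2r; apply/orP; right.
apply: proper_card; apply/properP; split.
  apply/subsetP => z; rewrite !inE => /connect_trans; apply; exact: connect1.
by exists w; rewrite inE; [exact: connect0|exact: arc_acyclic].
Qed.

End PermutreeCuts.

End LinearExtension.

(** * The subdivision into boxes *)

Section RegionMore.
Variable n : nat.
Implicit Types (i j k s t b x y u w m : 'I_n) (A B I K : {set 'I_n}).
Implicit Types (U D : 'I_n -> bool).

Lemma region0 U D g : region U D set0 g = set0.
Proof. by apply/setP => k; rewrite in_set0; apply/regionP => -[t []]; rewrite inE. Qed.

Lemma regionT U D g : region U D setT g = setT.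
Proof. by apply: (can_inj setCK); rewrite region_dual !setCT region0. Qed.

Definition right_set U D A i : {set 'I_n} := [set k in region U D A i.+1 | i < k].

(** To the right of the gap [i.+1] only labels greater than [i] are consulted. This triangular
    dependence allows weights to be compared and built from the right. *)
Lemma right_setS U D A B i : (forall k, i < k -> k \in A -> k \in B) ->
  right_set U D A i \subset right_set U D B i.
Proof.
move=> h; apply/subsetP => k; rewrite !in_set => /andP[/regionP[t [tA ht f]] ik].
rewrite ik andbT; apply/regionP; exists t; split=> //.
  by apply: h => //; case: ht => [->//|[]]; rewrite /nearer; move: ik; clear; lia.
move=> s hs ds; apply: h; last exact: f.
by move: hs ht ik; rewrite /nearer => hs [e|[]]; [move: hs; rewrite e; clear; lia|clear -hs; lia].
Qed.

Lemma eq_right_set U D A B i : (forall k, i < k -> (k \in A) = (k \in B)) ->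
  right_set U D A i = right_set U D B i.
Proof.
by move=> h; apply/eqP; rewrite eqEsubset !right_setS // => k ik; rewrite h.
Qed.

Lemma right_set_dual U D A i k : i < k ->
  (k \in right_set D U (~: A) i) = (k \notin right_set U D A i).
Proof. by move=> ik; rewrite 2!in_set -region_dual in_setC ik !andbT. Qed.

End RegionMore.

(** * Bounds, corners and open boxes of a weight *)

Section Boxes.
Variables (R : realFieldType) (n : nat).
Implicit Types (i j k s t u w m : 'I_n) (A B I K : {set 'I_n}).
Implicit Types (U D : 'I_n -> bool) (a b c x : 'I_n -> R).

Definition lo_set U D a i := right_set U D [set k | (a k < a i)%R] i.
Definition hi_set U D a i := right_set U D [set k | (a k <= a i)%R] i.

Lemma lo_hi_set U D a i : lo_set U D a i \subset hi_set U D a i.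
Proof. by apply: right_setS => k _; rewrite !inE; apply: ltW. Qed.

Lemma lo_set_dual U D a i k : i < k ->
  (k \in lo_set D U (fun r => - a r)%R i) = (k \notin hi_set U D a i).
Proof.
move=> ik; rewrite -right_set_dual //; congr (k \in right_set _ _ _ _).
by apply/setP => j; rewrite !inE ltrN2 ltNge.
Qed.

(** The region defining [lo_set] is a cut of [a], hence of [b]. For the witness [t] with the least
    label there is no wall between [i] and [t], so all members up to [t] see the nonmember [i] and
    are lighter than [i] under [b] too; [t] remains a witness. *)
Lemma lo_set_cuts U D a b i : cuts U D a \subset cuts U D b ->
  lo_set U D a i \subset lo_set U D b i.
Proof.
move=> /subsetP cab; apply/subsetP => k; rewrite !in_set => /andP[kR ik].
rewrite ik andbT; set A := [set k | (a k < a i)%R] in kR.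
set Rg := region U D A i.+1 in kR.
have iR : i \notin Rg.
  rewrite /Rg region_in; first by rewrite inE ltxx.
  by move=> s; rewrite /nearer; clear; lia.
have /cab/in_cuts[_ _ _ hb] : Rg \in cuts U D a.
  apply: region_cuts (@lower_lt _ _ a (a i)) _ _; first by apply/set0Pn; exists k.
  by rewrite -subTset; apply/subsetPn; exists i.
pose W := [pred t : 'I_n | [&& t \in A, (t == k) || (nearer i.+1 t k && U t) &
  [forall s : 'I_n, nearer i.+1 s t ==> (D s ==> (s \in A))]]].
have WP t : reflect [/\ t \in A, t = k \/ nearer i.+1 t k /\ U t &
    forall s, nearer i.+1 s t -> D s -> s \in A] (W t).
  apply: (iffP and3P) => -[h1 h2 h3]; split=> //.
  - by case/orP: h2 => [/eqP|/andP[]]; [left|right].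
  - by move=> s hs ds; move/forallP/(_ s): h3; rewrite hs ds.
  - by case: h2 => [->|[-> ->]]; rewrite ?eqxx ?orbT.
  - by apply/forallP => s; apply/implyP => hs; apply/implyP => ds; apply: h3.
have /regionP[t0 /WP W0] := kR.
case: (@arg_minnP _ t0 W (fun t => nat_of_ord t) W0) => t /WP[tA ht f] tmin.
have it : i < t by case: ht => [->//|[]]; move: ik; rewrite /nearer; clear; lia.
have tk : t <= k by case: ht => [->//|[]]; move: ik; rewrite /nearer; clear; lia.
have inR s : s <= t -> i < s -> s \in A -> s \in Rg.
  move=> st is' sA; apply/regionP; exists s; split=> //; first by left.
  by move=> r hr; apply: f; move: hr is' st; rewrite /nearer; clear; lia.
have nw s : i < s -> s < t -> ~~ wall U D Rg s.
  move=> is' st; rewrite /wall; case: ifPn => sR; last first.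
    apply: contra sR => ds; apply: inR => //; first exact: ltnW.
    by apply: f => //; rewrite /nearer is' st.
  apply/negP => us; have /regionP[t' [tA' ht' f']] := sR.
  have ts' : t' <= s by case: ht' => [->//|[]]; move: is'; rewrite /nearer; clear; lia.
  have it' : i < t' by case: ht' => [->//|[]]; move: is'; rewrite /nearer; clear; lia.
  have : W t'.
    apply/WP; split=> //; right; split; last by case: ht' => [->|[]].
    by move: it' ts' st tk; rewrite /nearer; clear; lia.
  by move/tmin; rewrite leqNgt (leq_ltn_trans ts' st).
have lt s : i < s -> s <= t -> s \in Rg -> (b s < b i)%R.
  move=> is' st sR; apply: hb => //; apply/visP => r hr; apply: nw;
  by move: hr is' st; rewrite /btw; clear; lia.
apply/regionP; exists t; split=> //.
  by rewrite inE; apply: lt => //; apply: inR.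
move=> s hs ds; rewrite inE.
have is' : i < s by move: hs it; rewrite /nearer; clear; lia.
have st : s <= t by move: hs it; rewrite /nearer; clear; lia.
by apply: lt => //; apply: inR => //; apply: f.
Qed.

Lemma hi_set_cuts U D a b i : cuts U D a \subset cuts U D b ->
  hi_set U D b i \subset hi_set U D a i.
Proof.
move=> cab; apply/subsetP => k kb; have ik : i < k by move: kb; rewrite in_set => /andP[].
rewrite -[_ \in _]negbK -lo_set_dual //; apply: contraL kb => ka.
rewrite -lo_set_dual //; apply: (subsetP (lo_set_cuts _ _)) ka.
apply/subsetP => I; rewrite -[I]setCK (cuts_dual U D a) (cuts_dual U D b).
exact: (subsetP cab).
Qed.

Lemma injective_lo_hi U D a i : injective a -> lo_set U D a i = hi_set U D a i.
Proof.
move=> ia; apply: eq_right_set => k ik; rewrite !inE lt_neqAle (inj_eq ia).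
by rewrite -(inj_eq val_inj) /= gtn_eqF.
Qed.

(** Lexicographic order of rank and [w]: for [w] bounded by [n] in absolute value, two values differ
    by at most [2 * n], less than one step of the rank term. *)
Definition lex_weight a (w : 'I_n -> R) i : R :=
  ((2 * n).+1%:R * #|[set j | (a j < a i)%R]|%:R + w i)%R.

Lemma lex_weight_lt a (w : 'I_n -> R) : (forall i, `|w i| <= n%:R)%R ->
  forall i j, (a i < a j)%R -> (lex_weight a w i < lex_weight a w j)%R.
Proof.
move=> hw i j ij; rewrite /lex_weight.
have lt : #|[set k | (a k < a i)%R]| < #|[set k | (a k < a j)%R]|.
  apply: proper_card; apply/properP; split.
    by apply/subsetP => k; rewrite !inE => /lt_trans; apply.
  by exists i; rewrite !inE ?ltxx.
have := hw i; have := hw j; rewrite !ler_norml => /andP[h1 h2] /andP[h3 h4].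
move: lt; set p := #|_|; set q := #|_|; rewrite -(ler_nat R).
rewrite -[p.+1]addn1 natrD => pq.
have h5 : ((2 * n).+1%:R * (p%:R + 1) <= (2 * n).+1%:R * q%:R :> R)%R.
  by rewrite ler_wpM2l.
have h6 : ((2 * n).+1%:R = 2 * n%:R + 1 :> R)%R by rewrite -addn1 natrD natrM.
move: h5; rewrite h6 => h5; lra.
Qed.

Lemma lex_weight_eq a (w : 'I_n -> R) i j : a i = a j ->
  (lex_weight a w i < lex_weight a w j)%R = (w i < w j)%R.
Proof. by move=> e; rewrite /lex_weight e ltrD2l. Qed.

(** The absolute value decreases with the label, so for [i < k] the sign at [i] alone decides the
    order. Thus [e i] tells whether labels to the right tied with [i] fall below it, independently
    for each [i]. *)
Definition corner_weight (e : 'I_n -> bool) i : R :=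
  (if e i then (n - i)%N%:R else - (n - i)%N%:R)%R.

Lemma corner_weight_lt e i k : i < k ->
  (corner_weight e k < corner_weight e i)%R = e i.
Proof.
move=> ik; rewrite /corner_weight.
have lt : ((n - k)%:R < (n - i)%:R :> R)%R by rewrite ltr_nat ltn_sub2l // ltnW ?ltn_ord //; apply: ltn_trans ik (ltn_ord k).
have ge : (0 <= (n - k)%:R :> R)%R by [].
case: (e i); case: (e k); apply/idP/idP => // *; lra.
Qed.

Lemma corner_weight_bound e i : (`|corner_weight e i| <= n%:R)%R.
Proof.
by rewrite /corner_weight; case: (e i); rewrite ?normrN normr_nat ler_nat leq_subr.
Qed.

Definition corner a e := lex_weight a (corner_weight e).

Lemma corner_refines a e i j : (a i < a j)%R -> (corner a e i < corner a e j)%R.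
Proof. by apply: lex_weight_lt; apply: corner_weight_bound. Qed.

Lemma corner_lt a e i k : i < k -> (corner a e k < corner a e i)%R =
  (if e i then (a k <= a i)%R else (a k < a i)%R).
Proof.
move=> ik; case: (ltgtP (a k) (a i)) => h.
- by rewrite corner_refines // if_same.
- by rewrite ltNge ltW ?corner_refines // if_same.
- by rewrite /corner lex_weight_eq // corner_weight_lt //; case: (e i).
Qed.

Lemma corner_inj a e : injective (corner a e).
Proof.
have H i k : i < k -> corner a e i != corner a e k.
  move=> ik; have [h|h|h] := ltgtP (a i) (a k).
  - by rewrite lt_eqF ?corner_refines.
  - by rewrite gt_eqF ?corner_refines.
  have := corner_lt a e ik; rewrite h lexx ltxx.
  case: (e i) => lt; first by rewrite gt_eqF.
  apply/eqP; rewrite /corner /lex_weight h => /addrI.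
  rewrite /corner_weight.
  have lt' : ((n - k)%:R < (n - i)%:R :> R)%R by rewrite ltr_nat ltn_sub2l // ltnW ?ltn_ord //; apply: ltn_trans ik (ltn_ord k).
  have ge : (0 <= (n - k)%:R :> R)%R by [].
  by case: (e i); case: (e k) => *; lra.
move=> i k e'; have [/H|/H|/val_inj//] := ltngtP i k; by rewrite e' eqxx.
Qed.

Lemma corner_lo_set U D a e i :
  lo_set U D (corner a e) i = if e i then hi_set U D a i else lo_set U D a i.
Proof.
rewrite /lo_set /hi_set; case ei: (e i); apply: eq_right_set => k ik;
by rewrite !inE corner_lt // ei.
Qed.

(** The inclusion of cuts restricted to labels from [m] on, in a form fit for induction. At the gap
    [m] itself the gap is kept, so that right sets can be compared; at later gaps [b] may use
    another one. *)
Definition agree_from U D a b (m : nat) : Prop :=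
  (forall A, lower a A -> exists2 B, lower b B & forall k, m <= k ->
     (k \in region U D A m) = (k \in region U D B m)) /\
  (forall A g, lower a A -> m <= g <= n -> exists B (h : nat),
     [/\ lower b B, m <= h <= n & forall k, m <= k ->
         (k \in region U D A g) = (k \in region U D B h)]).

Lemma agree_from_n U D a b : agree_from U D a b n.
Proof.
have l0 : lower b set0 by move=> i j; rewrite inE.
split=> [A _|A g _ _]; [exists set0|exists set0, n] => //; last split=> //.
- by move=> k; rewrite leqNgt ltn_ord.
- by rewrite leqnn.
- by move=> k; rewrite leqNgt ltn_ord.
Qed.

Lemma agree_from_cuts U D a b : agree_from U D a b 0 -> cuts U D a \subset cuts U D b.
Proof.
move=> [_ h]; apply/subsetP => I hI; have [A [g [lA _ gn IE]]] := cuts_region hI.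
have /in_cuts[I0 IT _ _] := hI.
have [B [g' [lB _ E]]] := h A g lA (ltnW gn).
have E' : I = region U D B g' by apply/setP => k; rewrite IE; apply: E.
by rewrite E' in I0 IT *; apply: region_cuts.
Qed.

Lemma lower_mem_lt a A m : lower a A -> m \notin A -> A \subset [set k | (a k < a m)%R].
Proof. by move=> lA mA; apply/subsetP => k kA; rewrite inE (lower_ltP lA kA mA). Qed.

Lemma lower_mem_le a A m : lower a A -> m \in A -> [set k | (a k <= a m)%R] \subset A.
Proof. by move=> lA mA; apply/subsetP => k; rewrite inE; apply: lA mA. Qed.

Lemma right_set_lower U D a A m : lower a A ->
  right_set U D A m \subset lo_set U D a m \/ hi_set U D a m \subset right_set U D A m.
Proof.
move=> lA; have [mA|mA] := boolP (m \in A); [right|left]; apply: right_setS => k _.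
  exact: subsetP (lower_mem_le lA mA) k.
exact: subsetP (lower_mem_lt lA mA) k.
Qed.

(** The gap cannot be to the left of [t], since then the wall [t] would put [j] into the region; so
    [t] puts [m] into it. *)
Lemma beyond_left U D B (g : nat) m t j : t \in region U D B g -> U t ->
  m < t -> t < j -> m < g -> j \notin region U D B g -> m \in region U D B g.
Proof.
move=> tR ut mt tj mg jR; apply: (region_beyond tR ut).
have [gt|tg] := leqP g t; last by rewrite /nearer mt tg orbT.
by rewrite (region_beyond tR ut) // /nearer gt tj in jR.
Qed.

Lemma region_below_wall U D A (g : nat) m t : m < t -> t < g -> g <= n ->
  wall U D A t -> (forall s, t < s < g -> ~~ wall U D A s) ->
  (m \in region U D A g) = (t \in A).
Proof.
move=> mt tg gn wt h; apply: region_wall wt _ _; last by rewrite /nearer mt tg orbT.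
by move=> s hs; apply: h; move: hs tg; rewrite /nearer; clear; lia.
Qed.

(** If [B] has the wrong membership of [m], it is replaced by the set of labels lighter than [m], or
    at most as heavy. The right sets are nested, and the inequalities between cardinalities squeeze
    them to equality. *)
Lemma agree_step_mem U D a b m A : agree_from U D a b m.+1 ->
  #|lo_set U D a m| <= #|lo_set U D b m| -> #|hi_set U D b m| <= #|hi_set U D a m| ->
  lower a A -> exists B, [/\ lower b B, (m \in A) = (m \in B) &
    forall k, m < k -> (k \in region U D A m.+1) = (k \in region U D B m.+1)].
Proof.
move=> [S _] lo hi lA; have [B lB E] := S A lA.
have E' : right_set U D A m = right_set U D B m.
  by apply/setP => k; rewrite !inE; case: (boolP (m < k)) => // mk; rewrite ?andbT ?andbF ?E.
have fix_up C : lower b C -> right_set U D C m = right_set U D A m ->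
    forall k, m < k -> (k \in region U D A m.+1) = (k \in region U D C m.+1).
  by move=> lC e k mk; have := congr1 (fun S : {set _} => k \in S) e; rewrite !inE mk !andbT.
case: (boolP (m \in A)) => mA; case: (boolP (m \in B)) => mB.
- by exists B; split=> //; rewrite mB.
- exists [set k | (b k <= b m)%R]; split; [exact: lower_le|by rewrite inE lexx|].
  apply: fix_up; first exact: lower_le.
  apply/esym/eqP; rewrite E' eqEcard right_setS /=; last first.
    by move=> k _ /(subsetP (lower_mem_lt lB mB)); rewrite !inE; apply: ltW.
  apply: leq_trans hi _; rewrite -E'; apply/subset_leq_card/right_setS => k _.
  exact: subsetP (lower_mem_le lA mA) k.
- exists [set k | (b k < b m)%R]; split; [exact: lower_lt|by rewrite inE ltxx|].
  apply: fix_up; first exact: lower_lt.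
  apply/eqP; rewrite E' eqEcard right_setS /=; last first.
    by move=> k _; rewrite inE => /ltW kb; apply: lB mB kb.
  apply: leq_trans lo; rewrite -E'; apply/subset_leq_card/right_setS => k _.
  exact: subsetP (lower_mem_lt lA mA) k.
- by exists B; split=> //; rewrite (negbTE mB).
Qed.

Lemma mem_region_start U D A m : (m \in region U D A m.+1) = (m \in A).
Proof. by apply: region_in => s; rewrite /nearer; clear; lia. Qed.

Lemma agree_from_step U D a b m : agree_from U D a b m.+1 ->
  #|lo_set U D a m| <= #|lo_set U D b m| -> #|hi_set U D b m| <= #|hi_set U D a m| ->
  agree_from U D a b m.
Proof.
move=> S lo hi.
have l0 : lower b set0 by move=> i j; rewrite inE.
have lT : lower b setT by move=> i j _ _; rewrite inE.
have mid A : lower a A -> exists B, [/\ lower b B, (m \in A) = (m \in B) &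
    forall k, m <= k -> (k \in region U D A m.+1) = (k \in region U D B m.+1)].
  move=> lA; have [B [lB mAB E]] := agree_step_mem S lo hi lA.
  exists B; split=> // k; rewrite leq_eqVlt => /orP[/eqP/val_inj <-|]; last exact: E.
  by rewrite !mem_region_start.
have left A : lower a A -> exists2 B, lower b B & forall k, m <= k ->
     (k \in region U D A m) = (k \in region U D B m).
  (* A wall at [m] makes the region at the gap [m] all or nothing on the labels from [m] on. *)
  move=> lA; have [wA|wA] := boolP (wall U D A m).
    have E k : m <= k -> (k \in region U D A m) = (m \in A).
      rewrite leq_eqVlt => /orP[/eqP/val_inj <-|mk].
        by apply: region_in => s; rewrite /nearer; clear; lia.
      apply: region_wall wA _ _; last by rewrite /nearer leqnn mk.
      by move=> s; rewrite /nearer; clear; lia.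
    exists (if m \in A then setT else set0); first by case: ifP.
    by move=> k /E ->; case: ifP; rewrite ?regionT ?region0 inE.
  have [B [lB mAB E]] := mid A lA; exists B => //.
  have wB : ~~ wall U D B m by move: wA; rewrite /wall mAB.
  by rewrite (region_shift wA) (region_shift wB).
split=> // A g lA /andP[mg gn].
move: mg; rewrite leq_eqVlt => /orP[/eqP <-|mg].
  have [B lB E] := left A lA; exists B, m; split=> //.
  by rewrite leqnn ltnW.
(* Seen from [g] towards the left, the last wall [t] after [m] decides the membership of [m];
   without one, the gap may be moved to [m.+1]. *)
have [h|[t [wt tg h]]] : (forall s, m < s < g -> ~~ wall U D A s) \/
    exists t, [/\ wall U D A t, m < t < g & forall s, t < s < g -> ~~ wall U D A s].
- have [/existsP[s0 P0]|/existsPn h] := boolP [exists s : 'I_n, (m < s < g) && wall U D A s].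
    pose P := [pred s : 'I_n | (m < s < g) && wall U D A s].
    have P1 : P s0 by [].
    case: (arg_maxnP (fun s : 'I_n => nat_of_ord s) P1) => t /andP[tg wt] tmax.
    right; exists t; split=> // s /andP[ts sg]; apply/negP => ws.
    have : P s by rewrite /P /= ws (ltn_trans _ ts) ?sg //; case/andP: tg.
    by move/tmax; rewrite /= leqNgt ts.
  by left=> s hs; have := h s; rewrite hs.
- have [B [lB _ E]] := mid A lA; exists B, m.+1; split=> //.
    by rewrite leqnSn ltn_ord.
  by move=> k mk; rewrite -E // (@region_const _ _ _ _ m.+1 g) // mg gn.
have [mt tg'] := andP tg.
have [B [g' [lB /andP[mg' gn'] E]]] := (proj2 S) A g lA (introT andP (conj mg gn)).
have same k : m <= k -> k <= t -> (k \in region U D A g) = (t \in A).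
  move=> mk; rewrite leq_eqVlt => /orP[/eqP/val_inj ->|kt]; last exact: region_below_wall wt h.
  by apply: region_in => s hs; apply: h; move: hs tg'; rewrite /nearer; clear; lia.
(* If the region is constant to the right of [m], a trivial lower set works. Otherwise a label [j]
   beyond [t] of the opposite class forces the membership of [m] for [B] as well, by
   [beyond_left]. *)
have [/existsP[j /andP[mj jA]]|/existsPn full] :=
    boolP [exists j : 'I_n, (m < j) && ((j \in region U D A g) != (t \in A))]; last first.
  exists (if t \in A then setT else set0), g'.
  split; [by case: ifP|by rewrite gn' ltnW|move=> k mk].
  have -> : (k \in region U D A g) = (t \in A).
    move: mk; rewrite leq_eqVlt => /orP[/eqP/val_inj <-|mk]; first by apply: same => //; apply: ltnW.
    by have := full k; rewrite mk /= negbK => /eqP.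
  by case: ifP; rewrite ?regionT ?region0 inE.
exists B, g'; split=> //; first by rewrite gn' ltnW.
move=> k; rewrite leq_eqVlt => /orP[/eqP/val_inj <-|mk]; last exact: E.
rewrite same // ?(ltnW mt) //.
have tj : t < j.
  by rewrite ltnNge; apply: contraNN jA => jt; rewrite same // ltnW.
have tR := same t (ltnW mt) (leqnn _); rewrite E // in tR.
have jR : (j \in region U D B g') = ~~ (t \in A).
  by move: jA; rewrite E //; case: (_ \in _); case: (_ \in _).
have [tA|tA] := boolP (t \in A).
  suff -> : m \in region U D B g' by [].
  apply: (@beyond_left U D _ _ m t j); rewrite ?tR ?jR ?tA //.
  by move: wt; rewrite /wall tA.
suff /negbTE -> : m \notin region U D B g' by [].
rewrite -in_setC region_dual.
apply: (@beyond_left D U _ _ m t j); rewrite -?region_dual ?in_setC ?tR ?jR ?tA //.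
by move: wt; rewrite /wall (negbTE tA).
Qed.

Definition lo U D a i : R := (#|lo_set U D a i|%:R)%R.
Definition hi U D a i : R := (#|hi_set U D a i|%:R)%R.

Definition in_box U D a (x : 'I_n -> R) : Prop :=
  forall i, (lo U D a i <= x i <= hi U D a i)%R.

Definition in_open_box U D a (x : 'I_n -> R) : Prop :=
  forall i, lo U D a i = x i /\ hi U D a i = x i \/ (lo U D a i < x i < hi U D a i)%R.

(** At [m], the right sets of lower sets of [b] are right sets of lower sets of [a], and none of
    these lies strictly between [lo_set] and [hi_set] of [a]. *)
Lemma agree_from_gap U D a b m : agree_from U D b a m.+1 ->
  ((lo U D b m <= lo U D a m) \/ (hi U D a m <= lo U D b m))%R /\
  ((hi U D b m <= lo U D a m) \/ (hi U D a m <= hi U D b m))%R.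
Proof.
move=> [S _].
have H B : lower b B ->
    ((#|right_set U D B m|%:R <= lo U D a m) \/ (hi U D a m <= #|right_set U D B m|%:R))%R.
  move=> lB; have [A lA E] := S B lB.
  have -> : right_set U D B m = right_set U D A m.
    by apply/setP => k; rewrite !inE; case: (boolP (m < k)) => // mk; rewrite ?andbT ?andbF ?E.
  by case: (right_set_lower U D m lA) => h; [left|right]; rewrite ler_nat subset_leq_card.
by split; apply: H; [apply: lower_lt|apply: lower_le].
Qed.

Lemma gap_eq (la ra lb rb y : R) :
  (la = y /\ ra = y \/ la < y < ra)%R -> (lb = y /\ rb = y \/ lb < y < rb)%R ->
  (la <= lb \/ rb <= la)%R -> (ra <= lb \/ rb <= ra)%R ->
  (lb <= la \/ ra <= lb)%R -> (rb <= la \/ ra <= rb)%R -> la = lb /\ ra = rb.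
Proof.
move=> [[-> ->]|/andP[e1 e2]] [[-> ->]|/andP[e3 e4]] h1 h2 h3 h4 //.
- by case: h1 => h; lra.
- by case: h3 => h; lra.
- split; apply/le_anti/andP; split.
  + by case: h1 => // h; lra.
  + by case: h3 => // h; lra.
  + by case: h4 => // h; lra.
  + by case: h2 => // h; lra.
Qed.

Lemma open_box_step U D a b x m : in_open_box U D a x -> in_open_box U D b x ->
  agree_from U D a b m.+1 -> agree_from U D b a m.+1 ->
  lo U D a m = lo U D b m /\ hi U D a m = hi U D b m.
Proof.
move=> ha hb /agree_from_gap[h1 h2] /agree_from_gap[h3 h4].
exact: gap_eq (ha m) (hb m) h1 h2 h3 h4.
Qed.

(** From right to left, the agreement reached so far forces the bounds at the next label to
    coincide, and equal bounds extend the agreement. This yields both the disjointness of the open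
    boxes and the injectivity of cubic vectors. *)
Lemma open_box_inj U D a b x : in_open_box U D a x -> in_open_box U D b x ->
  cuts U D a = cuts U D b.
Proof.
move=> ha hb.
have H (d : nat) : d <= n -> agree_from U D a b (n - d) /\ agree_from U D b a (n - d).
  elim: d => [_|d IH dn]; first by rewrite subn0; split; apply: agree_from_n.
  have lt : n - d.+1 < n by rewrite ltn_subrL /=; apply: leq_trans dn.
  have e : n - d = (n - d.+1).+1 by rewrite subnSK.
  have := IH (ltnW dn); rewrite e => -[S1 S2].
  have [e1 e2] := open_box_step (m := Ordinal lt) ha hb S1 S2.
  move: e1 e2 => /eqP; rewrite eqr_nat => /eqP e1 /eqP; rewrite eqr_nat => /eqP e2.
  by split; apply: (agree_from_step (m := Ordinal lt)) => //; rewrite ?e1 ?e2.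
have [] := H n (leqnn _); rewrite subnn => /agree_from_cuts s1 /agree_from_cuts s2.
by apply/eqP; rewrite eqEsubset s1.
Qed.

Lemma separating_value c (W V : {set 'I_n}) :
  (forall i j, i \in W -> j \in V -> (c i < c j)%R) ->
  exists r, (forall i, i \in W -> (c i < r)%R) /\ (forall j, j \in V -> (r < c j)%R).
Proof.
move=> h; have [->|/set0Pn[i0 i0W]] := eqVneq W set0.
  have [->|/set0Pn[j0 j0V]] := eqVneq V set0.
    by exists 0%R; split=> i; rewrite inE.
  have [j jV jmin] := @arg_minP _ R _ j0 (mem V) c j0V.
  exists (c j - 1)%R; split=> i; first by rewrite inE.
  by move=> /jmin le; lra.
have [i iW imax] := @arg_maxP _ R _ i0 (mem W) c i0W.
have [->|/set0Pn[j0 j0V]] := eqVneq V set0.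
  exists (c i + 1)%R; split=> k; last by rewrite inE.
  by move=> /imax le; move: le; rewrite /= => le; lra.
have [j jV jmin] := @arg_minP _ R _ j0 (mem V) c j0V.
have lt := h i j iW jV.
exists ((c i + c j) / 2)%R; split=> k; first by move=> /imax; rewrite /= => le; lra.
by move=> /jmin; rewrite /= => le; lra.
Qed.

(** [W] is a largest initial segment of [c], between the labels lighter than [m] under [a] and those
    at most as heavy, whose right set has at most [y] elements. The value [r] is placed at the upper
    end of [W]. *)
Lemma insert_weight U D a c m (y : R) :
  (forall i j, m < i -> m < j -> (a i < a j)%R -> (c i < c j)%R) ->
  (lo U D a m <= y <= hi U D a m)%R ->
  exists r : R, let c' := fun k : 'I_n => if k == m then r else c k in
    [/\ forall k, m < k -> (a k < a m)%R -> (c k < r)%R,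
        forall k, m < k -> (a m < a k)%R -> (r < c k)%R &
        lo U D c' m = y /\ hi U D c' m = y \/ (lo U D c' m < y < hi U D c' m)%R].
Proof.
move=> ref /andP[loy yhi].
pose W0 := [set k : 'I_n | (m < k) && (a k < a m)%R].
pose W1 := [set k : 'I_n | (m < k) && (a k <= a m)%R].
pose P := [pred W : {set 'I_n} | [&& W0 \subset W, W \subset W1,
  [forall i : 'I_n, forall j : 'I_n, (m < i) ==> ((j \in W) ==> ((c i <= c j)%R ==> (i \in W)))] &
  (#|right_set U D W m|%:R <= y)%R]].
have rlo : right_set U D W0 m = lo_set U D a m.
  by apply: eq_right_set => k mk; rewrite !inE mk.
have rhi : right_set U D W1 m = hi_set U D a m.
  by apply: eq_right_set => k mk; rewrite !inE mk.
have gtc i j : m < i -> m < j -> (c i <= c j)%R -> (a i <= a j)%R.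
  by move=> mi mj cij; rewrite leNgt; apply/negP => /(ref _ _ mj mi); rewrite ltNge cij.
have P0 : P W0.
  rewrite /P /= subxx rlo loy andbT /=; apply/andP; split.
    by apply/subsetP => k; rewrite !inE => /andP[-> /ltW].
  apply/forallP => i; apply/forallP => j; apply/implyP => mi; apply/implyP.
  rewrite !inE => /andP[mj jm]; apply/implyP => cij; rewrite mi.
  exact: le_lt_trans (gtc _ _ mi mj cij) jm.
case: (arg_maxnP (fun W : {set 'I_n} => #|W|) P0) => W /and4P[s0 s1 lW ry] Wmax.
have lowW i j : m < i -> j \in W -> (c i <= c j)%R -> i \in W.
  move=> mi jW cij; move: lW => /forallP/(_ i)/forallP/(_ j).
  by rewrite mi jW cij.
have Wm k : k \in W -> m < k by move/(subsetP s1); rewrite inE => /andP[].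
have lS r : (forall k, m < k -> (c k < r)%R = (k \in W)) ->
    lo_set U D (fun k : 'I_n => if k == m then r else c k) m = right_set U D W m.
  move=> h; apply: eq_right_set => k mk; rewrite inE eqxx.
  by rewrite -(inj_eq val_inj) gtn_eqF // h.
have hS r (V : {set 'I_n}) : (forall k, m < k -> (c k <= r)%R = (k \in V)) ->
    hi_set U D (fun k : 'I_n => if k == m then r else c k) m = right_set U D V m.
  move=> h; apply: eq_right_set => k mk; rewrite inE eqxx.
  by rewrite -(inj_eq val_inj) gtn_eqF // h.
have inW0 k : m < k -> (a k < a m)%R -> k \in W.
  by move=> mk km; apply: (subsetP s0); rewrite inE mk.
have notW1 k : m < k -> (a m < a k)%R -> k \notin W.
  by move=> mk km; apply: contraL km => /(subsetP s1); rewrite inE -leNgt => /andP[].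
(* If [y] is attained, [r] is put strictly above [W] and strictly below the rest, so no tie arises
   and both bounds equal [y]. *)
have [yE|ne] := eqVneq (#|right_set U D W m|%:R)%R y.
  have [i j iW|r [h1 h2]] := @separating_value c W [set k : 'I_n | (m < k) && (k \notin W)].
    rewrite inE => /andP[mj jW]; rewrite ltNge; apply: contra jW.
    exact: lowW.
  exists r => /=; have below k : m < k -> (c k < r)%R = (k \in W).
    move=> mk; apply/idP/idP => [lt|/h1//]; apply: contraLR lt => kW.
    by rewrite -leNgt ltW // h2 // inE mk.
  have below' k : m < k -> (c k <= r)%R = (k \in W).
    move=> mk; apply/idP/idP => [lt|/h1/ltW//]; apply: contraLR lt => kW.
    by rewrite -ltNge h2 // inE mk.
  split.
  - by move=> k mk km; apply/h1/inW0.
  - by move=> k mk km; apply: h2; rewrite inE mk notW1.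
  - by left; rewrite /lo /hi (lS r) // (hS r W) // yE.
have lty : (#|right_set U D W m|%:R < y)%R by rewrite lt_neqAle ne.
have [v0 v0P] : exists v, (v \in W1) && (v \notin W).
  apply/existsP; apply: contraTT yhi => /existsPn h; rewrite -ltNge.
  apply: le_lt_trans lty; rewrite ler_nat -rhi; apply/subset_leq_card/right_setS.
  move=> k _ kW1; have := h k; rewrite kW1 /= negbK; exact.
have [v /andP[vW1 vW] vmin] := @arg_minP _ R _ v0 [pred v | (v \in W1) && (v \notin W)] c v0P.
have mv : m < v by move: vW1; rewrite inE => /andP[].
have avm : (a v <= a m)%R by move: vW1; rewrite inE => /andP[].
(* Tying [m] with the lightest label [v] of [W1] outside [W] leaves [W] for the lower bound and a
   larger segment for the upper one, which exceeds [y] by maximality of [W]. *)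
exists (c v); split.
- move=> k mk km; rewrite ltNge; apply/negP => cvk.
  by move: vW; rewrite (lowW v k) // inW0.
- move=> k mk km; apply: ref => //; exact: le_lt_trans km.
right; rewrite /lo /hi (lS (c v)); last first.
  move=> k mk; apply/idP/idP => [lt|kW]; last first.
    by rewrite ltNge; apply: contra vW; apply: lowW.
  apply: contraLR lt => kW; rewrite -leNgt.
  case: (boolP (k \in W1)) => kW1; first by apply: vmin; rewrite /= kW1.
  have : (a m < a k)%R by move: kW1; rewrite inE mk -ltNge.
  by move=> /(le_lt_trans avm)/(ref _ _ mv mk)/ltW.
rewrite lty /=; pose W' := [set k : 'I_n | (m < k) && (c k <= c v)%R].
rewrite (hS _ W'); last by move=> k mk; rewrite inE mk.
rewrite ltNge; apply/negP => ry'.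
have WW' : W \proper W'.
  apply/properP; split; last by exists v; rewrite // inE mv lexx.
  apply/subsetP => k kW; rewrite inE Wm //= ltW // ltNge.
  by apply: contra vW; apply: lowW.
have : P W'.
  rewrite /P /= ry' andbT; apply/and3P; split.
  - exact: subset_trans s0 (proper_sub WW').
  - apply/subsetP => k; rewrite !inE => /andP[mk kv]; rewrite mk /=.
    exact: le_trans (gtc _ _ mk mv kv) avm.
  - apply/forallP => i; apply/forallP => j; apply/implyP => mi; apply/implyP.
    rewrite !inE => /andP[mj jv]; apply/implyP => cij; rewrite mi.
    exact: le_trans cij jv.
by move/Wmax; rewrite /= leqNgt proper_card.
Qed.

(** The bounds at a label depend only on the weights from this label on, so inserting further labels
    on the left does not disturb coordinates already settled. *)
Lemma box_cover U D a x : in_box U D a x -> exists c : 'I_n -> R,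
  (forall i j, (a i < a j)%R -> (c i < c j)%R) /\ in_open_box U D c x.
Proof.
move=> hx.
have loE c c' m : (forall k, m <= k -> c k = c' k) -> lo U D c m = lo U D c' m.
  move=> h; rewrite /lo; suff -> : lo_set U D c m = lo_set U D c' m by [].
  by apply: eq_right_set => k mk; rewrite !inE !h // ltnW.
have hiE c c' m : (forall k, m <= k -> c k = c' k) -> hi U D c m = hi U D c' m.
  move=> h; rewrite /hi; suff -> : hi_set U D c m = hi_set U D c' m by [].
  by apply: eq_right_set => k mk; rewrite !inE !h // ltnW.
have H (d : nat) : d <= n -> exists c : 'I_n -> R,
    (forall i j, n - d <= i -> n - d <= j -> (a i < a j)%R -> (c i < c j)%R) /\
    forall i, n - d <= i -> lo U D c i = x i /\ hi U D c i = x i \/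
       (lo U D c i < x i < hi U D c i)%R.
  elim: d => [_|d IH dn].
    by exists a; split=> [i j _ _ //|i]; rewrite subn0 leqNgt ltn_ord.
  have lt : n - d.+1 < n by rewrite ltn_subrL /=; apply: leq_trans dn.
  have [c [ref op]] := IH (ltnW dn).
  pose m := Ordinal lt; have e : n - d = m.+1 by rewrite /= subnSK.
  rewrite e in ref op.
  have [r [h1 h2 h3]] := insert_weight ref (hx m).
  exists (fun k : 'I_n => if k == m then r else c k); split.
    move=> i j; rewrite leq_eqVlt => /orP[/eqP mi|mi]; rewrite leq_eqVlt => /orP[/eqP mj|mj].
    - by rewrite (_ : i = j) ?ltxx //; apply: val_inj; rewrite /= -mi -mj.
    - have -> : i = m by apply: val_inj.
      by rewrite eqxx -[j == m](inj_eq val_inj) gtn_eqF //; apply: h2.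
    - have -> : j = m by apply: val_inj.
      by rewrite eqxx -[i == m](inj_eq val_inj) gtn_eqF //; apply: h1.
    - rewrite -[i == m](inj_eq val_inj) -[j == m](inj_eq val_inj) !gtn_eqF //.
      exact: ref.
  move=> i; rewrite leq_eqVlt => /orP[/eqP mi|mi].
    by have -> : i = m by apply: val_inj.
  have E k : i <= k -> (if k == m then r else c k) = c k.
    move=> ik; rewrite -[k == m](inj_eq val_inj) gtn_eqF //.
    exact: leq_trans mi ik.
  by rewrite (loE _ c) // (hiE _ c) //; apply: op.
have [c [ref op]] := H n (leqnn _); rewrite subnn in ref op.
by exists c; split=> [i j|i]; [apply: ref|apply: op].
Qed.

End Boxes.

(** * The potential and the vertices of the polytope *)

Section Scan.
Variables (u d : nat -> bool).
Implicit Types (f : nat -> bool) (c e : bool) (l : seq nat).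

Definition scan_wall f (t : nat) : bool := if f t then u t else d t.

(* One minus the number of maximal runs of colour [false] in the sequence
   formed by [c], the colours of the walls in [l], and [e]. *)
Fixpoint runs f c l e : int :=
  match l with
  | [::] => Posz (c && e)
  | t :: l' => if scan_wall f t then (runs f (f t) l' e - Posz (f t && ~~ c))%R
               else runs f c l' e
  end.

Fixpoint next_colour f l e : bool :=
  match l with
  | [::] => e
  | t :: l' => if scan_wall f t then f t else next_colour f l' e
  end.

Definition last_colour f c l : bool :=
  foldl (fun c t => if scan_wall f t then f t else c) c l.

Lemma last_colour_rcons f c l t : last_colour f c (rcons l t) =
  if scan_wall f t then f t else last_colour f c l.
Proof. by rewrite /last_colour -cats1 foldl_cat. Qed.

Lemma runs_colour f l e :
  runs f true l e = (runs f false l e + Posz (next_colour f l e))%R.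
Proof.
elim: l => [|t l IH] /=; first by rewrite add0r.
case: ifP => // _; case: (f t); rewrite ?IH /=; lia.
Qed.

Lemma eq_runs f f' c l e : {in l, f =1 f'} -> runs f c l e = runs f' c l e.
Proof.
elim: l c => //= t l IH c h; have ht : f t = f' t by apply: h; rewrite inE eqxx.
have hl : {in l, f =1 f'} by move=> x xl; apply: h; rewrite inE xl orbT.
by rewrite /scan_wall ht !IH.
Qed.

Lemma eq_next_colour f f' l e : {in l, f =1 f'} -> next_colour f l e = next_colour f' l e.
Proof.
elim: l => //= t l IH h; have ht : f t = f' t by apply: h; rewrite inE eqxx.
have hl : {in l, f =1 f'} by move=> x xl; apply: h; rewrite inE xl orbT.
by rewrite /scan_wall ht IH.
Qed.

(** The effect of adding [s] between neighbouring colours [l] and [r]: a run consisting of the outer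
    wall [s] alone vanishes, or the new inner wall [s] splits a run. The value increases with [l]
    and with [r]. *)
Definition jump (us ds l r : bool) : int :=
  (Posz (ds && l && r) - Posz (us && ~~ l && ~~ r))%R.

Lemma runs_jump f f' c l1 s l2 e : {in l1, f =1 f'} -> {in l2, f =1 f'} ->
  f s = false -> f' s ->
  (runs f' c (l1 ++ s :: l2) e - runs f c (l1 ++ s :: l2) e)%R =
  jump (u s) (d s) (last_colour f c l1) (next_colour f l2 e).
Proof.
move=> h1 h2 fs fs'; elim: l1 c h1 => [|t l1 IH] c h1 /=.
  rewrite /scan_wall fs fs' !(eq_runs _ _ h2).
  rewrite (eq_next_colour e h2) /jump; have := runs_colour f' l2 e.
  case: (u s) (d s) c (next_colour f' l2 e) => [] [] [] [] /=; lia.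
have ht : f t = f' t by apply: h1; rewrite inE eqxx.
have hl : {in l1, f =1 f'} by move=> x xl; apply: h1; rewrite inE xl orbT.
have -> : scan_wall f' t = scan_wall f t by rewrite /scan_wall ht.
rewrite -/(last_colour f (if scan_wall f t then f t else c) l1) -ht; case: ifP => _; last exact: IH.
by rewrite -IH //; lia.
Qed.

Lemma runs_end f c l : (runs f c l true - runs f c l false)%R = Posz (last_colour f c l).
Proof.
elim: l c => [|t l IH] c; first by case: c.
by rewrite /last_colour /=; case: ifP => _; rewrite -IH //; lia.
Qed.

(** A run of colour [false], once begun, extends to the end, so there is at most one, and there is
    one exactly if [e] is [false]. *)
Lemma runs_true f l e :
  (forall l1 t l2, l = l1 ++ t :: l2 -> ~~ f t -> d t ->
     all (fun x => ~~ f x) l2 /\ ~~ e) -> runs f true l e = Posz (e).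
Proof.
have R0 l' : all (fun x => ~~ f x) l' -> runs f false l' false = 0%R.
  elim: l' => //= x l' IH /andP[fx al]; rewrite /scan_wall (negbTE fx) /=.
  by case: ifP; rewrite IH // subr0.
elim: l => //= t l IH h.
have hl : runs f true l e = Posz (e).
  by apply: IH => l1 t' l2 E; apply: (h (t :: l1)); rewrite E.
rewrite /scan_wall; case: (boolP (f t)) => ft /=; first by rewrite subr0 hl if_same.
case: ifP => // dt; rewrite subr0.
by have [al /negbTE ->] := h [::] t l erefl ft dt; apply: R0.
Qed.

Lemma runs_false f l e :
  (forall l1 t l2, l = l1 ++ t :: l2 -> f t -> u t -> all f l2 /\ e) ->
  runs f false l e = 0%R.
Proof.
have R1 l' : all f l' -> runs f true l' true = 1%R.
  elim: l' => //= x l' IH /andP[fx al]; rewrite /scan_wall fx /=.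
  by case: ifP; rewrite IH // subr0.
elim: l => //= t l IH h.
have hl : runs f false l e = 0%R.
  by apply: IH => l1 t' l2 E; apply: (h (t :: l1)); rewrite E.
rewrite /scan_wall; case: (boolP (f t)) => ft /=; last by rewrite subr0 hl if_same.
case: ifP => // ut; have [al e1] := h [::] t l erefl ft ut.
by rewrite e1 R1.
Qed.

End Scan.

(** * A supermodular function with binomial values on admissible sets *)

Section Potential.
Variables (n : nat) (U D : 'I_n -> bool).
Implicit Types (i j k s t p q : 'I_n) (A B I J : {set 'I_n}).

(** Extension by [false] to all naturals, so that intervals of labels can be scanned as [iota]
    lists. *)
Definition nat_pred_of (P : 'I_n -> bool) (m : nat) : bool :=
  [exists i : 'I_n, (i == m :> nat) && P i].

Lemma nat_pred_ofE P i : nat_pred_of P i = P i.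
Proof.
apply/existsP/idP => [[j /andP[/eqP/val_inj ->]]//|Pi]; exists i; by rewrite eqxx.
Qed.

Local Notation mem_nat A := (nat_pred_of (fun i => i \in A)).
Local Notation wallN := (scan_wall (nat_pred_of U) (nat_pred_of D)).

Lemma scan_wallE A t : wallN (mem_nat A) t = wall U D A t.
Proof. by rewrite /scan_wall !nat_pred_ofE. Qed.

Lemma next_colourE A q (g : nat) : g <= q ->
  next_colour (nat_pred_of U) (nat_pred_of D) (mem_nat A) (iota g (q - g)) (q \in A) =
  (q \in region U D A g).
Proof.
move=> gq; have [m e] : {m | q - g = m} by exists (q - g).
rewrite e; elim: m g gq e => [|m IH] g gq e.
  have -> : g = q by lia.
  by rewrite region_in // => s; rewrite /nearer; clear; lia.
have gn : g < n by apply: leq_ltn_trans gq (ltn_ord q).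
have [t tE] : {t : 'I_n | g = t} by exists (Ordinal gn).
rewrite tE in gq e *; rewrite /= scan_wallE nat_pred_ofE; case: ifP => wt.
  rewrite (region_wall wt) //; first by move=> s; rewrite /nearer; clear; lia.
  by rewrite /nearer; lia.
by rewrite (@region_shift _ _ _ _ t) ?wt // IH //; lia.
Qed.

Lemma last_colourE A p (g : nat) : p < g -> g <= n ->
  last_colour (nat_pred_of U) (nat_pred_of D) (mem_nat A) (p \in A) (iota p.+1 (g - p.+1)) =
  (p \in region U D A g).
Proof.
move=> pg gn; have [m e] : {m | g - p.+1 = m} by exists (g - p.+1).
rewrite e; elim: m g pg gn e => [|m IH] g pg gn e.
  have -> : g = p.+1 by lia.
  by rewrite region_in // => s; rewrite /nearer; clear; lia.
case: g pg gn e => // g pg gn e.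
have pg' : p < g by lia.
have [t tE] : {t : 'I_n | g = t} by exists (Ordinal gn).
rewrite -[m.+1]addn1 iotaD cats1 last_colour_rcons (IH g); try lia.
rewrite (_ : p.+1 + m = t) ?tE; last by lia.
rewrite scan_wallE nat_pred_ofE; case: ifP => wt.
  rewrite (region_wall wt) //; first by move=> s; rewrite /nearer /=; clear; lia.
  by rewrite /nearer /=; lia.
by rewrite -(@region_shift _ _ _ _ t) ?wt.
Qed.

(** Without walls between [p] and [q] this is the indicator that both are in [A], and these
    indicators add up to ['C(#|A|.+1, 2)]. Walls can only lower it, and do not do so on admissible
    sets. *)
Definition pot A p q : int :=
  if p == q then Posz (p \in A)
  else runs (nat_pred_of U) (nat_pred_of D) (mem_nat A) (p \in A)
         (iota p.+1 (q - p.+1)) (q \in A).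

(* The increment of [pot] when [s] is added. *)
Definition pot_step A p q s : int :=
  if (s < p) || (q < s) then 0%R
  else if p == q then 1%R
  else if s == p then Posz (q \in region U D A s.+1)
  else if s == q then Posz (p \in region U D A s)
  else jump (U s) (D s) (p \in region U D A s) (q \in region U D A s.+1).

Lemma mem_natU A s (m : nat) : m != s -> mem_nat (s |: A) m = mem_nat A m.
Proof.
move=> ms; apply: eq_existsb => i; case: eqP => //= im; rewrite !inE.
by rewrite -(inj_eq val_inj) /= im (negbTE ms).
Qed.

Lemma pot_stepE A p q s : s \notin A -> p <= q ->
  (pot (s |: A) p q - pot A p q)%R = pot_step A p q s.
Proof.
move=> sA pq; rewrite /pot /pot_step.
have inU k : k != s -> (k \in s |: A) = (k \in A) by move=> ks; rewrite !inE (negbTE ks).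
have inUs : s \in s |: A by rewrite !inE eqxx.
have [out|] := boolP ((s < p) || (q < s)).
  have pU := inU p; have qU := inU q.
  rewrite pU; last by rewrite -(inj_eq val_inj) /=; lia.
  rewrite qU; last by rewrite -(inj_eq val_inj) /=; lia.
  rewrite (@eq_runs _ _ (mem_nat (s |: A)) (mem_nat A)) ?subrr //.
  by move=> m; rewrite mem_iota => hm; apply: mem_natU; lia.
rewrite negb_or -!leqNgt => /andP[ps sq].
have [epq|npq] := eqVneq p q.
  have -> : p = s by apply: val_inj; move: ps sq; rewrite epq /=; lia.
  by rewrite inUs (negbTE sA).
have {}pq : p < q by rewrite ltn_neqAle pq andbT (inj_eq val_inj).
have [esp|nsp] := eqVneq s p.
  rewrite -esp inUs (negbTE sA) inU; last by rewrite esp eq_sym.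
  rewrite (@eq_runs _ _ (mem_nat (s |: A)) (mem_nat A)); last first.
    by move=> m; rewrite mem_iota => hm; apply: mem_natU; lia.
  by rewrite runs_colour next_colourE; [rewrite addrC addKr|rewrite esp].
have [esq|nsq] := eqVneq s q.
  have esq' : (s : nat) = q by rewrite esq.
  rewrite -esq inUs (negbTE sA) inU; last by rewrite esq.
  rewrite (@eq_runs _ _ (mem_nat (s |: A)) (mem_nat A)); last first.
    by move=> m; rewrite mem_iota => hm; apply: mem_natU; clear -hm pq esq'; lia.
  by rewrite runs_end last_colourE // ?esq // ltnW.
have {}ps : p < s by rewrite ltn_neqAle ps andbT (inj_eq val_inj) eq_sym.
have {}sq : s < q by rewrite ltn_neqAle sq andbT (inj_eq val_inj).
have -> : q - p.+1 = (s - p.+1) + (q - s.+1).+1 by lia.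
rewrite iotaD /= (_ : p.+1 + (s - p.+1) = s); last by lia.
rewrite !inU 1?eq_sym //.
rewrite runs_jump ?nat_pred_ofE ?(negbTE sA) //.
- by rewrite last_colourE ?next_colourE // ltnW.
- by move=> m; rewrite mem_iota => hm; rewrite mem_natU //; lia.
- by move=> m; rewrite mem_iota => hm; rewrite mem_natU //; lia.
Qed.

(** This is supermodularity: the increment depends on [A] only through regions, which are monotone,
    and is increasing in them. *)
Lemma pot_stepS A B p q s : A \subset B -> (pot_step A p q s <= pot_step B p q s)%R.
Proof.
move=> AB; rewrite /pot_step.
have hs g k : k \in region U D A g -> k \in region U D B g by apply/subsetP/regionS.
case: ((s < p) || (q < s)); first exact: lexx.
case: (p == q); first exact: lexx.
case: (s == p).
  by case: (boolP (q \in region U D A s.+1)) => [/hs ->|_]; rewrite ?lez_nat.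
case: (s == q).
  by case: (boolP (p \in region U D A s)) => [/hs ->|_]; rewrite ?lez_nat.
rewrite /jump; have := hs s p; have := hs s.+1 q.
case: (p \in region U D A s) (p \in region U D B s) => [] [];
case: (q \in region U D A s.+1) (q \in region U D B s.+1) => [] [] h1 h2;
by [have := h1 isT|have := h2 isT|case: (U s); case: (D s)].
Qed.

Lemma pot_adm J p q : adm U D J -> p <= q -> pot J p q = Posz ((p \in J) && (q \in J)).
Proof.
move=> /admP ad pq; rewrite /pot; have [->|npq] := eqVneq p q; first by rewrite andbb.
have {}pq : p < q by rewrite ltn_neqAle pq andbT (inj_eq val_inj).
set l := iota _ _.
have lP l1 (m : nat) l2 : l = l1 ++ m :: l2 -> exists t : 'I_n,
    [/\ m = t, p < t < q & forall x, x \in l2 -> exists2 k : 'I_n, x = k & t < k < q].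
  move=> lE; have hm : m \in l by rewrite lE mem_cat inE eqxx orbT.
  move: hm; rewrite mem_iota => /andP[pm mq].
  have mn : m < n by apply: leq_trans (ltnW (ltn_ord q)); lia.
  exists (Ordinal mn); split=> //; first by rewrite /=; lia.
  move=> x xl; have hx : x \in l by rewrite lE mem_cat inE xl !orbT.
  move: hx; rewrite mem_iota => /andP[px xq].
  have xn : x < n by apply: leq_trans (ltnW (ltn_ord q)); lia.
  exists (Ordinal xn) => //=.
  have : sorted ltn l by apply: iota_ltn_sorted.
  rewrite lE => /(subseq_sorted ltn_trans (suffix_subseq _ _)) /=.
  rewrite path_sortedE; last exact: ltn_trans.
  by move=> /andP[/allP/(_ x xl) /= ->]; lia.
case: (boolP (p \in J)) => pJ /=.
  apply: runs_true => l1 m l2 /lP[t [-> /andP[pt tq] h]]; rewrite !nat_pred_ofE => tJ dt.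
  have out k : t < k -> k \notin J.
    move=> tk; have := ad t p k; rewrite /btw pt tk => /(_ isT).
    by rewrite /wall (negbTE tJ) pJ dt => /(_ isT)[] // ->.
  split; last exact: out.
  by apply/allP => x /h[k -> /andP[tk _]]; rewrite nat_pred_ofE out.
apply: runs_false => l1 m l2 /lP[t [-> /andP[pt tq] h]]; rewrite !nat_pred_ofE => tJ ut.
have out k : t < k -> k \in J.
  move=> tk; have := ad t p k; rewrite /btw pt tk => /(_ isT).
  by rewrite /wall tJ (negbTE pJ) ut => /(_ isT)[] // ->.
split; last exact: out.
by apply/allP => x /h[k -> /andP[tk _]]; rewrite nat_pred_ofE out.
Qed.

Variable R : realDomainType.

Definition total_pot A : R :=
  (\sum_(e : 'I_n * 'I_n | (e.1 <= e.2)%N) (pot A e.1 e.2)%:~R)%R.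

Definition total_step A s : R :=
  (\sum_(e : 'I_n * 'I_n | (e.1 <= e.2)%N) (pot_step A e.1 e.2 s)%:~R)%R.

Lemma total_stepE A s : s \notin A -> total_pot (s |: A) = (total_pot A + total_step A s)%R.
Proof.
move=> sA; rewrite /total_pot /total_step -big_split /=; apply: eq_bigr => -[p q] /= pq.
by rewrite -pot_stepE // rmorphB /= addrC subrK.
Qed.

(** The square of [J] is the union of two triangles of equal size that meet in the diagonal. *)
Lemma card_pairs J : #|[set e : 'I_n * 'I_n | [&& e.1 <= e.2, e.1 \in J & e.2 \in J]]| =
  'C(#|J|.+1, 2).
Proof.
set P := [set e : 'I_n * 'I_n | _].
pose P' := [set e : 'I_n * 'I_n | [&& e.2 <= e.1, e.1 \in J & e.2 \in J]].
have PP' : #|P| = #|P'|.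
  have sw : injective (fun e : 'I_n * 'I_n => (e.2, e.1)) by move=> [? ?] [? ?] [-> ->].
  rewrite -(card_imset (mem P) sw); apply: eq_card => -[p q].
  apply/imsetP/idP => [[[x y]]|]; rewrite !inE /=.
    by move=> /and3P[h1 h2 h3] [-> ->]; rewrite h1 h2 h3.
  by move=> /and3P[h1 h2 h3]; exists (q, p); rewrite // !inE h1 h2 h3.
have eU : P :|: P' = setX J J.
  by apply/setP => -[p q]; rewrite !inE /=; case: (leqP p q) => h /=;
     case: (p \in J); case: (q \in J); rewrite ?andbF ?orbF ?andbT ?(ltnW h).
have eI : #|P :&: P'| = #|J|.
  have dg : injective (fun i : 'I_n => (i, i)) by move=> ? ? [].
  rewrite -(card_imset (mem J) dg); apply: eq_card => -[p q].
  apply/idP/imsetP => [|[i iJ [-> ->]]]; rewrite !inE /= ?leqnn ?iJ //.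
  move=> /andP[/and3P[h1 h2 h3] /and3P[h4 _ _]]; exists p => //.
  by congr (_, _); apply: val_inj; apply/eqP; rewrite eqn_leq h1 h4.
have := cardsUI P P'; rewrite eU eI cardsX -PP' addnn => e.
by rewrite bin2 /= mulSn addnC e doubleK.
Qed.

Lemma total_pot_adm J : adm U D J -> total_pot J = ('C(#|J|.+1, 2)%:R)%R.
Proof.
move=> ad; rewrite -card_pairs /total_pot; set P := [set e : 'I_n * 'I_n | _].
have -> : #|P| = (\sum_(e : 'I_n * 'I_n | (e.1 <= e.2)%N) ((e.1 \in J) && (e.2 \in J)))%N.
  rewrite -sum1_card (eq_bigl (fun e : 'I_n * 'I_n =>
    (e.1 <= e.2)%N && ((e.1 \in J) && (e.2 \in J)))); last by move=> e; rewrite inE.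
  by rewrite big_mkcondr /=; apply: eq_bigr => e _; case: ifP.
rewrite natr_sum.
by apply: eq_bigr => -[p q] /= pq; rewrite pot_adm.
Qed.

(** * Greedy points of injective weights *)

Section Coordinates.
Variable a : 'I_n -> R.
Hypothesis inj_a : injective a.

Definition before i : {set 'I_n} := [set k | (a k < a i)%R].

(** The greedy point of a supermodular function: labels are added in the order of [a], and each
    coordinate is the increment of [total_pot]. *)
Definition coordinate i : R := total_step (before i) i.

Lemma total_pot_sum J :
  total_pot J = (total_pot set0 + \sum_(i in J) total_step (J :&: before i) i)%R.
Proof.
have [m hm] := ubnP #|J|; elim: m => // m IH in J hm *.
have [->|/set0Pn[i0 i0J]] := eqVneq J set0; first by rewrite big_set0 addr0.
have [i iJ imax] := @arg_maxP _ R _ i0 (mem J) a i0J.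
have {}iJ : i \in J by [].
have {}imax k : k \in J -> (a k <= a i)%R by exact: imax.
pose J' := J :\ i.
have JE : J = i |: J' by rewrite setD1K.
have iJ' : i \notin J' by rewrite !inE eqxx.
have cJ : #|J'| < m by rewrite -ltnS; apply: leq_trans hm; rewrite ltnS [X in _ < X](cardsD1 i J) iJ.
have eJ' : J :&: before i = J'.
  apply/setP => k; rewrite !inE; have [->|ki] := eqVneq k i; first by rewrite ltxx andbF.
  by case: (boolP (k \in J)) => // /imax; rewrite lt_neqAle (inj_eq inj_a) ki.
have eJ j : j \in J' -> J' :&: before j = J :&: before j.
  rewrite !inE => /andP[ji jJ]; apply/setP => k; rewrite !inE.
  have [->|//] := eqVneq k i.
  by rewrite iJ /= ltNge (imax j jJ).
have eL : total_pot J = (total_pot J' + total_step J' i)%R by rewrite -total_stepE // -JE.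
have eS : (\sum_(j in J') total_step (J' :&: before j) j =
          \sum_(j in J') total_step (J :&: before j) j)%R.
  by apply: eq_bigr => j /eJ ->.
have eR := big_setD1 (F := fun j => total_step (J :&: before j) j) i iJ.
rewrite eL (IH _ cJ) [X in (_ + X + _)%R]eS [X in (_ = _ + X)%R]eR eJ' -addrA.
by rewrite [X in (_ + X)%R]addrC.
Qed.

Lemma adm0 : adm U D set0.
Proof. by apply/admP => b x y _ _; left; rewrite !inE. Qed.

Lemma total_stepS A B s : A \subset B -> (total_step A s <= total_step B s)%R.
Proof. move=> AB; rewrite /total_step; apply: ler_sum => e _; rewrite ler_int.
exact: pot_stepS. Qed.

Lemma adm_sum J : adm U D J ->
  (\sum_(i in J) total_step (J :&: before i) i = 'C(#|J|.+1, 2)%:R)%R.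
Proof.
move=> ad; have := total_pot_sum J; rewrite !total_pot_adm ?adm0 // cards0 => ->.
by rewrite bin_small // add0r.
Qed.

Lemma coordinate_ge J : adm U D J ->
  ('C(#|J|.+1, 2)%:R <= \sum_(i in J) coordinate i)%R.
Proof.
move=> ad; rewrite -(adm_sum ad); apply: ler_sum => i _.
exact/total_stepS/subsetIr.
Qed.

(** The last hypothesis says that [g] is the gap next to [s] on the side of [k]. If a witness
    nearest to [s], or a label it consults, were outside [I], then [seg_vis] would give visible
    [i'], [j'] with [a i' < a j' < a s]; so [i'] is not [s], satisfies [U], and is a nearer
    witness. *)
Lemma cut_region I s g k : I \in cuts U D a -> s \in I ->
  (forall t i, t = k \/ nearer g t k -> nearer g i t = btw s i t) ->
  (k \in region U D (I :&: before s) g) = (k \in region U D (before s) g).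
Proof.
move=> /in_cuts[_ _ _ hI] sI hg; apply/idP/idP.
  by apply/subsetP/regionS/subsetIr.
set A := before s => /regionP[t0 W0].
pose W := [pred t : 'I_n | [&& t \in A, (t == k) || (nearer g t k && U t) &
  [forall i : 'I_n, nearer g i t ==> (D i ==> (i \in A))]]].
have WP t : reflect [/\ t \in A, t = k \/ nearer g t k /\ U t &
    forall i, nearer g i t -> D i -> i \in A] (W t).
  apply: (iffP and3P) => -[h1 h2 h3]; split=> //.
  - by case/orP: h2 => [/eqP|/andP[]]; [left|right].
  - by move=> i hi di; move/forallP/(_ i): h3; rewrite hi di.
  - by case: h2 => [->|[-> ->]]; rewrite ?eqxx ?orbT.
  - by apply/forallP => i; apply/implyP => hi; apply/implyP => di; apply: h3.
have {W0} W0 : W t0 by apply/WP.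
case: (arg_minnP (fun t : 'I_n => (t - s) + (s - t)) W0) => t /WP[tA ht f] tmin.
have tk : t = k \/ nearer g t k by case: ht => [|[]]; [left|right].
suff H z : z \in A -> z = t \/ nearer g z t -> z \in I.
  apply/regionP; exists t; split=> //; first by rewrite inE tA H //; left.
  by move=> i hi di; have iA := f i hi di; rewrite inE iA H //; right.
move=> zA hz; apply: contraT => zI.
have [i' [j' [iI jI v hi hj]]] := seg_vis U D sI zI.
have lt := hI _ _ iI jI v.
have tr i : btw s i z -> nearer g i t.
  move=> hb; rewrite hg //; case: hz => [<- //|]; rewrite hg // => hz.
  exact: btw_trr hz hb.
have js : (a j' < a s)%R.
  case: hj => [->|[hb dj]]; first by move: zA; rewrite inE.
  by have := f _ (tr _ hb) dj; rewrite inE.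
have is_ := lt_trans lt js.
case: hi => [e|[hb ui]]; first by rewrite e ltxx in is_.
have it := tr _ hb.
have nk : nearer g i' k.
  by case: tk => [<- //|tk]; move: it tk; rewrite /nearer; clear; lia.
have Wi : W i'.
  apply/WP; split; [by rewrite inE|by right|].
  by move=> x hx; apply: f; move: hx it; rewrite /nearer; clear; lia.
have := tmin _ Wi; rewrite hg // in it.
by move: it; rewrite /btw; clear; lia.
Qed.

Lemma pot_step_cut I s p q : I \in cuts U D a -> s \in I -> p <= q ->
  pot_step (I :&: before s) p q s = pot_step (before s) p q s.
Proof.
move=> hI sI pq; rewrite /pot_step; have [//|] := boolP ((s < p) || (q < s)).
rewrite negb_or -!leqNgt => /andP[ps sq]; have [//|npq] := eqVneq p q.
have right : s < q -> (q \in region U D (I :&: before s) s.+1) =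
    (q \in region U D (before s) s.+1).
  move=> lt; apply: cut_region => // t i [->|];
  by move: lt; rewrite /nearer /btw; clear; lia.
have left : p < s -> (p \in region U D (I :&: before s) s) =
    (p \in region U D (before s) s).
  move=> lt; apply: cut_region => // t i [->|];
  by move: lt; rewrite /nearer /btw; clear; lia.
have [sp|sp] := eqVneq s p.
  by rewrite right // sp ltn_neqAle (inj_eq val_inj) npq.
have [eq|nq] := eqVneq s q.
  by rewrite left // eq ltn_neqAle (inj_eq val_inj) npq.
rewrite left; last by rewrite ltn_neqAle ps andbT (inj_eq val_inj) eq_sym.
by rewrite right // ltn_neqAle sq andbT (inj_eq val_inj).
Qed.

Lemma coordinate_cut I : I \in cuts U D a ->
  (\sum_(i in I) coordinate i = 'C(#|I|.+1, 2)%:R)%R.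
Proof.
move=> hI; have /in_cuts[_ _ ad _] := hI.
rewrite -(adm_sum ad); apply: eq_bigr => s sI; rewrite /coordinate /total_step.
by apply: eq_bigr => e pq; rewrite (pot_step_cut hI sI pq).
Qed.

Lemma coordinate_setT : (\sum_i coordinate i = 'C(n.+1, 2)%:R)%R.
Proof.
have ad : adm U D setT by apply/admP => b x y _ _; left; rewrite !inE.
have := adm_sum ad; rewrite cardsT card_ord => <-.
apply: eq_big => [i|i _]; first by rewrite inE.
by rewrite setTI.
Qed.

(** Since [J] is not a cut, some visible pair [i], [j] is in the wrong order. At minimal distance,
    every nonmember-blocking label between them is lighter than [i], so [j] is in the region of
    [before i] but not in that of [J :&: before i]. *)
Lemma coordinate_gt J : adm U D J -> J != set0 -> J != setT -> J \notin cuts U D a ->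
  ('C(#|J|.+1, 2)%:R + 1 <= \sum_(i in J) coordinate i)%R.
Proof.
move=> ad J0 JT nJ.
pose Q := [pred e : 'I_n * 'I_n |
  [&& e.1 \in J, e.2 \notin J, vis U D J e.1 e.2 & (a e.2 <= a e.1)%R]].
have [e0 Q0] : exists e, Q e.
  apply/existsP; apply: contraR nJ => /existsPn h; apply/in_cuts; split=> // i j iJ jJ v.
  by have := h (i, j); rewrite /Q /= iJ jJ v /= -ltNge.
case: (arg_minnP (fun e : 'I_n * 'I_n => (e.1 - e.2) + (e.2 - e.1)) Q0).
move=> [i j] /and4P[/= iJ jJ v le] emin.
have ij : i != j by apply: contraNneq jJ => <-.
have lt : (a j < a i)%R by rewrite lt_neqAle le (inj_eq inj_a) eq_sym ij.
(* The summand for this pair alone gains 1; all others change in the same direction by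
   monotonicity. *)
pose e := if i < j then (i, j) else (j, i).
have e12 : e.1 <= e.2 by rewrite /e; case: ltnP => //=; apply: ltnW.
have strict g : (forall x, nearer g x j = btw i x j) ->
   (j \in region U D (J :&: before i) g) = false /\ j \in region U D (before i) g.
  move=> hg; split.
    apply/negP => /regionP[t]; rewrite inE => -[/andP[tJ _]] [tj|[tj ut]] _.
      by rewrite -tj tJ in jJ.
    by rewrite hg in tj; have /visP/(_ _ tj) := v; rewrite /wall tJ ut.
  apply/regionP; exists j; split; [by rewrite inE|by left|].
  move=> x; rewrite hg => hx dx; rewrite inE ltNge; apply/negP => ix.
  have xJ : x \in J.
    by apply: contraT => xJ; have /visP/(_ _ hx) := v; rewrite /wall (negbTE xJ) dx.
  have : Q (x, j).
    rewrite /Q /= xJ jJ (le_trans le ix) andbT /=.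
    by apply/visP => y hy; move/visP: v; apply; apply: btw_trl hx hy.
  by move/emin => /=; move: hx; rewrite /btw; clear; lia.
have step1 : (pot_step (J :&: before i) e.1 e.2 i + 1 <= pot_step (before i) e.1 e.2 i)%R.
  rewrite /pot_step /e; case: (ltnP i j) => ij' /=.
    rewrite ltnn /= ltnNge (ltnW ij') /= (negbTE ij) eqxx.
    by have [|-> ->] := strict i.+1; first by move=> x; move: ij'; rewrite /nearer /btw; clear; lia.
  have {}ij' : j < i by rewrite ltn_neqAle ij' andbT (inj_eq val_inj) eq_sym.
  rewrite ltnn orbF ltnNge (ltnW ij') /= eq_sym (negbTE ij) eqxx.
  by have [|-> ->] := strict i; first by move=> x; move: ij'; rewrite /nearer /btw; clear; lia.
move: e e12 step1 => {strict} e e12 step1.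
have step2 : (total_step (J :&: before i) i + 1 <= coordinate i)%R.
  rewrite /coordinate /total_step [X in (X + 1 <= _)%R](bigD1 e e12).
  rewrite [X in (_ <= X)%R](bigD1 e e12).
  rewrite addrAC; apply: lerD; first by rewrite -[1%R]/(1%:~R)%R -rmorphD ler_int.
  by apply: ler_sum => f _; rewrite ler_int; apply/pot_stepS/subsetIr.
have e1 := bigD1 (F := fun k => total_step (J :&: before k) k) i iJ.
have e2 := bigD1 (F := coordinate) i iJ.
rewrite -(adm_sum ad) [X in (X + 1 <= _)%R]e1 [X in (_ <= X)%R]e2 addrAC.
apply: lerD step2 _.
by apply: ler_sum => k _; apply/total_stepS/subsetIr.
Qed.

End Coordinates.

End Potential.

(** * Faces of the polytope *)

Section CutSums.
Variables (R : realFieldType) (n : nat) (U D : 'I_n -> bool).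
Implicit Types (i j k s t : 'I_n) (A B I : {set 'I_n}) (a z : 'I_n -> R).

(* [1_A] is, up to a constant, the sum of the indicators of the regions of [A]. *)
Lemma region_count A i :
  (\sum_(t | wall U D A t) ((i \in region U D A t.+1)%:R - (t \in A)%:R) +
   (i \in region U D A 0)%:R = (i \in A)%:R :> R)%R.
Proof.
pose phi (g : nat) : R := ((i \in region U D A g)%:R)%R.
pose psi (g : nat) : R := (if (g < i)%N then phi g.+1 - phi g else 0)%R.
have psiE t : (if wall U D A t then (i \in region U D A t.+1)%:R - (t \in A)%:R else 0)%R = psi t.
  rewrite /psi /phi; have [ti|it|/val_inj e] := ltngtP t i.
  - have [wt|wt] := boolP (wall U D A t); last by rewrite (region_shift wt) subrr.
    rewrite (@region_wall _ U D A t t i) //; last by rewrite /nearer leqnn ti.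
    by move=> s; rewrite /nearer; clear; lia.
  - case: ifP => // wt; rewrite (@region_wall _ U D A t.+1 t i) ?subrr //.
      by move=> s; rewrite /nearer; clear; lia.
    by rewrite /nearer it leqnn orbT.
  - by rewrite e mem_region_start subrr if_same.
rewrite big_mkcond /= (eq_bigr (fun t : 'I_n => psi t)) => [|t _]; last exact: psiE.
rewrite -(big_mkord xpredT psi) (big_cat_nat _ (n := i)) //=; last exact: ltnW.
rewrite [X in (_ + X + _)%R]big1_seq ?addr0; last first.
  by move=> g /andP[_]; rewrite mem_index_iota /psi => /andP[ig _]; rewrite ltnNge ig.
rewrite (eq_big_nat _ _ (F2 := fun g => (phi g.+1 - phi g)%R)); last first.
  by move=> g /andP[_ gi]; rewrite /psi gi.
rewrite telescope_sumr // subrK /phi region_in // => s.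
by rewrite /nearer; clear; lia.
Qed.

Definition set_sum z I : R := (\sum_(i in I) z i)%R.

Lemma set_sum0 z : set_sum z set0 = 0%R.
Proof. by rewrite /set_sum big_set0. Qed.

Lemma set_sumT z : set_sum z setT = (\sum_i z i)%R.
Proof. by apply: eq_bigl => i; rewrite inE. Qed.

Lemma set_sumE z I : set_sum z I = (\sum_i (i \in I)%:R * z i)%R.
Proof.
rewrite /set_sum big_mkcond; apply: eq_bigr => i _.
by case: ifP => _; rewrite ?mul1r ?mul0r.
Qed.

Lemma set_sumC z I : set_sum z setT = 0%R -> set_sum z (~: I) = (- set_sum z I)%R.
Proof.
rewrite !set_sumE => h; apply/eqP; rewrite -addr_eq0 -big_split /= -[X in _ == X]h; apply/eqP.
apply: eq_bigr => i _; rewrite -mulrDl !inE -natrD; congr (_%:R * _)%R.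
by case: (i \in I).
Qed.

Lemma region_sum z A : set_sum z setT = 0%R ->
  set_sum z A = (\sum_(t | wall U D A t) set_sum z (region U D A t.+1) +
                 set_sum z (region U D A 0))%R.
Proof.
move=> z0; rewrite set_sumE.
under eq_bigr do rewrite -region_count mulrDl mulr_suml.
rewrite big_split /= exchange_big /= -set_sumE; congr (_ + _)%R.
apply: eq_bigr => t _; rewrite set_sumE.
under eq_bigr do rewrite mulrBl.
by rewrite sumrB -mulr_sumr -(set_sumT z) z0 mulr0 subr0.
Qed.

Lemma region_normal A (g : nat) : g <= n -> region U D A g = region U D A 0 \/
  exists2 t, wall U D A t & region U D A g = region U D A t.+1.
Proof.
elim: g => [|g IH] gn; first by left.
pose t := Ordinal gn; have [wt|wt] := boolP (wall U D A t).
  by right; exists t.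
by rewrite -[g.+1]/(t.+1) -(region_shift wt); apply: IH; apply: ltnW.
Qed.

Section Weighted.
Variables (a z : 'I_n -> R).
Hypothesis z0 : set_sum z setT = 0%R.

Lemma region_sum_ge0 A (g : nat) : (forall I, I \in cuts U D a -> (0 <= set_sum z I)%R) ->
  lower a A -> (0 <= set_sum z (region U D A g))%R.
Proof.
move=> h lA; have [->|n0] := eqVneq (region U D A g) set0; first by rewrite set_sum0.
have [->|nT] := eqVneq (region U D A g) setT; first by rewrite z0.
by apply: h; apply: region_cuts.
Qed.

Lemma lower_sum_ge0 A : (forall I, I \in cuts U D a -> (0 <= set_sum z I)%R) ->
  lower a A -> (0 <= set_sum z A)%R.
Proof.
move=> h lA; rewrite region_sum //; apply: addr_ge0; last exact: region_sum_ge0.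
by apply: sumr_ge0 => t _; apply: region_sum_ge0.
Qed.

Lemma lower_sum_eq0 A : (forall I, I \in cuts U D a -> set_sum z I = 0%R) ->
  lower a A -> set_sum z A = 0%R.
Proof.
move=> h lA; have H g : set_sum z (region U D A g) = 0%R.
  have [->|n0] := eqVneq (region U D A g) set0; first by rewrite set_sum0.
  have [->|nT] := eqVneq (region U D A g) setT; first by rewrite z0.
  by apply: h; apply: region_cuts.
by rewrite region_sum // H addr0 big1.
Qed.

(** A cut is a region of some lower set, and by [region_normal] its sum occurs among the nonnegative
    terms of [region_sum], whose total is zero. *)
Lemma cut_sum_eq0 I : (forall J, J \in cuts U D a -> (0 <= set_sum z J)%R) ->
  (forall A, lower a A -> set_sum z A = 0%R) -> I \in cuts U D a -> set_sum z I = 0%R.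
Proof.
move=> h h0 hI; have [A [g [lA _ gn ->]]] := cuts_region hI.
have ge g' : (0 <= set_sum z (region U D A g'))%R by apply: region_sum_ge0.
have /eqP := region_sum A z0; rewrite h0 // eq_sym paddr_eq0 //; last by apply: sumr_ge0.
rewrite psumr_eq0 // => /andP[/allP e1 /eqP e2].
have [->//|[t wt ->]] := region_normal A (ltnW gn).
by have := e1 t; rewrite mem_index_enum wt => /(_ isT)/eqP.
Qed.

(** For an injective weight two lower sets differ by [i] alone, and both have sum zero. Thus the
    cuts determine a point. *)
Lemma cuts_kill : injective a -> (forall I, I \in cuts U D a -> set_sum z I = 0%R) ->
  forall i, z i = 0%R.
Proof.
move=> ia h i.
have e1 := lower_sum_eq0 h (@lower_lt _ _ a (a i)).
have := lower_sum_eq0 h (@lower_le _ _ a (a i)).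
have -> : [set k | (a k <= a i)%R] = i |: [set k | (a k < a i)%R].
  by apply/setP => k; rewrite !inE le_eqVlt (inj_eq ia).
by rewrite /set_sum big_setU1 ?inE ?ltxx //= -/(set_sum _ _) e1 addr0.
Qed.

End Weighted.

(* Abel summation, by collapsing the largest value of [a] onto the next one. *)
Lemma abel_sum a z : set_sum z setT = 0%R ->
  (forall A, lower a A -> (0 <= set_sum z A)%R) ->
  (\sum_i a i * z i <= 0)%R /\
  ((\sum_i a i * z i = 0)%R -> forall A, lower a A -> set_sum z A = 0%R).
Proof.
move=> z0; have [m hm] := ubnP #|[set i | [exists k, (a i < a k)%R]]|.
elim: m => // m IH in a hm * => ge.
have [/eqP e|/set0Pn[i0]] := boolP ([set i | [exists k, (a i < a k)%R]] == set0).
  have ac i k : (a i <= a k)%R.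
    rewrite leNgt; apply/negP => h; have : k \in [set i | [exists k, (a i < a k)%R]].
      by rewrite inE; apply/existsP; exists i.
    by rewrite e inE.
  have [n0|n0] := posnP n.
    have E (B : {set 'I_n}) : set_sum z B = 0%R.
      by rewrite /set_sum big1 // => i; have := ltn_ord i; rewrite {2}n0.
    by split=> //; rewrite big1 // => i; have := ltn_ord i; rewrite {2}n0.
  pose o := Ordinal n0.
  have -> : (\sum_i a i * z i = 0)%R.
    rewrite (eq_bigr (fun i => a o * z i)%R) => [|i _].
      by rewrite -mulr_sumr -(set_sumT z) z0 mulr0.
    by congr (_ * _)%R; apply/le_anti; rewrite !ac.
  split=> // _ A lA; have [->|/set0Pn[j jA]] := eqVneq A set0; first exact: set_sum0.
  by rewrite (_ : A = setT) //; apply/setP => i; rewrite inE (lA i j).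
rewrite inE => /existsP[k0 ik0].
have [kM _ maxM] := @arg_maxP _ R _ i0 xpredT a isT.
have {}maxM i : (a i <= a kM)%R by apply: maxM.
pose B := [set i | (a i < a kM)%R].
have BE : [set i | [exists k, (a i < a k)%R]] = B.
  apply/setP => i; rewrite !inE; apply/existsP/idP => [[k ik]|ik]; last by exists kM.
  exact: lt_le_trans ik (maxM k).
have i0B : i0 \in B by rewrite inE; apply: lt_le_trans ik0 (maxM _).
have [jM jB maxB] := @arg_maxP _ R _ i0 (mem B) a i0B.
have {}jB : jM \in B by [].
have {}maxB i : i \in B -> (a i <= a jM)%R by exact: maxB.
have jlt : (a jM < a kM)%R by rewrite inE in jB.
pose a' i := if i \in B then a i else a jM.
have a'le i : (a' i <= a jM)%R by rewrite /a'; case: ifP => // /maxB.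
have mono i j : (a i <= a j)%R -> (a' i <= a' j)%R.
  rewrite /a' => ij; case: (boolP (j \in B)) => jB'; last by case: ifP => // /maxB.
  suff -> : i \in B by []; move: jB'; rewrite !inE; exact: le_lt_trans.
have low' A : lower a' A -> lower a A by move=> h i j jA ij; apply: h jA (mono _ _ ij).
have lB : lower a B by apply: lower_lt.
have sumE : (\sum_i a i * z i = \sum_i a' i * z i - (a kM - a jM) * set_sum z B)%R.
  rewrite -mulrN -set_sumC // set_sumE mulr_sumr -big_split /=; apply: eq_bigr => i _.
  rewrite !inE -leNgt /a'; have [iB|iB] := boolP (i \in B).
    by move: (iB); rewrite inE ltNge => /negbTE ->; rewrite mul0r mulr0 addr0.
  have -> : a i = a kM by apply/le_anti; rewrite maxM /= leNgt; move: iB; rewrite inE.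
  by rewrite lexx mul1r -mulrDl addrCA subrr addr0.
have cB : #|[set i | [exists k, (a' i < a' k)%R]]| < m.
  rewrite -ltnS; apply: leq_trans hm; rewrite ltnS BE; apply: proper_card.
  apply/properP; split.
    apply/subsetP => i; rewrite inE => /existsP[k]; apply: contraTT => iB.
    by rewrite {1}/a' (negbTE iB) -leNgt; apply: a'le.
  exists jM => //; rewrite inE; apply/negP => /existsP[k].
  by rewrite {1}/a' jB ltNge a'le.
have [s1 s2] := IH a' cB (fun A lA => ge A (low' A lA)).
have geB := ge B lB; have d : (0 < a kM - a jM)%R by rewrite subr_gt0.
have geM : (0 <= (a kM - a jM) * set_sum z B)%R by apply: mulr_ge0 => //; apply: ltW.
rewrite sumE; split; first by rewrite subr_le0 (le_trans s1).
move=> e; have e1 : (\sum_i a' i * z i = 0)%R.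
  by apply/le_anti; rewrite s1 /= -(subr0 (\sum_i _)%R) -[in X in (X <= _)%R]e lerD2l lerN2.
have eB : set_sum z B = 0%R.
  by move/eqP: e; rewrite e1 sub0r oppr_eq0 mulf_eq0 gt_eqF //= => /eqP.
move=> A lA; have [sAB|/subsetPn[k kA kB]] := boolP (A \subset B); last first.
  rewrite (_ : A = setT) //; apply/setP => i; rewrite inE (lA i k) //.
  by apply: le_trans (maxM i) _; rewrite leNgt; move: kB; rewrite inE.
have [/eqP ->//|] := boolP (A == B).
rewrite eqEsubset sAB /= => /subsetPn[k kB kA].
apply: s2 => // i j jA ij; apply: (lA _ _ jA).
have jB' := subsetP sAB j jA; move: ij; rewrite /a' jB'.
case: ifP => // iB lt; case/negP: kA; apply: (lA _ _ jA).
exact: le_trans (maxB k kB) lt.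
Qed.

Lemma abel_sum_eq0 a z : set_sum z setT = 0%R ->
  (forall A, lower a A -> set_sum z A = 0%R) -> (\sum_i a i * z i = 0)%R.
Proof.
move=> z0 h.
have [h1 _] : (\sum_i a i * z i <= 0)%R /\ True.
  by split=> //; apply: (proj1 (abel_sum z0 _)) => A /h ->.
have oppE I : set_sum (fun i => - z i)%R I = (- set_sum z I)%R by rewrite /set_sum sumrN.
have [h2 _] : (\sum_i a i * - z i <= 0)%R /\ True.
  split=> //; apply: (proj1 (abel_sum _ _)); first by rewrite oppE z0 oppr0.
  by move=> A /h e; rewrite oppE e oppr0.
have e : (\sum_i a i * - z i = - \sum_i a i * z i)%R.
  by rewrite -sumrN; apply: eq_bigr => i _; rewrite mulrN.
by apply/le_anti; rewrite h1 /=; move: h2; rewrite e oppr_le0.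
Qed.

End CutSums.

Section CornerCuts.
Variables (R : realFieldType) (n : nat) (U D : 'I_n -> bool).
Implicit Types (i j : 'I_n) (I : {set 'I_n}) (a : 'I_n -> R).

Lemma cuts_corner a e : cuts U D a \subset cuts U D (corner a e).
Proof. by apply: cuts_refine => i j; apply: corner_refines. Qed.

(** If a visible pair had [a j <= a i], some way of breaking ties would put [j] strictly below
    [i]. *)
Lemma in_cuts_corners a I :
  (forall e, I \in cuts U D (corner a e)) -> I \in cuts U D a.
Proof.
move=> h; have /in_cuts[I0 IT ad _] := h xpredT; apply/in_cuts; split=> // i j iI jI v.
rewrite ltNge; apply/negP => ji.
have H e : (corner a e i < corner a e j)%R by have /in_cuts[_ _ _] := h e; apply.
(* With a constant [e], all ties are broken in favour of the larger label if [i < j], and of the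
   smaller one otherwise; in both cases [j] comes below [i]. *)
have := H (fun=> i < j); have ne : i != j by apply: contraNneq jI => <-.
have [ij|ji'|/val_inj e] := ltngtP i j; last by rewrite e eqxx in ne.
  by rewrite ltNge ltW // corner_lt // ij.
by rewrite corner_lt //= ltNge ji.
Qed.

Lemma adm_in_cuts I : adm U D I -> I != set0 -> I != setT ->
  exists2 a : 'I_n -> R, injective a & I \in cuts U D a.
Proof.
move=> ad I0 IT; pose a i : R := ((i \notin I)%:R)%R.
exists (corner a xpredT); first exact: corner_inj.
apply: (subsetP (cuts_corner a _)); apply/in_cuts; split=> // i j iI jI _.
by rewrite /a iI jI ltr01.
Qed.

End CornerCuts.

(** * Faces as sets of maximizers of weights *)

Section PolytopeFunctions.
Variables (R : realFieldType) (n : nat) (delta : 'I_n -> decoration).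
Implicit Types (i j k u w : 'I_n) (A B I J K : {set 'I_n}) (a b x z : 'I_n -> R).
Implicit Types (T S : {set 'I_n * 'I_n}).

Local Notation U := (ups delta).
Local Notation D := (downs delta).
Local Notation cuts := (cuts U D).

Definition nontrivial_adm I : bool := [&& I != set0, I != setT & adm U D I].

Definition cut_bound I : R := ('C(#|I|.+1, 2)%:R)%R.

Lemma in_cuts_adm a I : I \in cuts a -> nontrivial_adm I.
Proof. by case/in_cuts => h1 h2 h3 _; apply/and3P. Qed.

Definition tree_weight T : 'I_n -> R := extension_weight R T.

Lemma tree_weight_inj T : is_permutree delta T -> injective (tree_weight T).
Proof. by move=> pT; have [] := extension_weightP R pT. Qed.

Lemma tree_weight_cuts T : is_permutree delta T -> edge_cuts T = cuts (tree_weight T).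
Proof. by move=> pT; apply: (linear_extension_cuts pT); apply: extension_weightP pT. Qed.

Lemma weight_tree_weight_cuts a : injective a ->
  cuts (tree_weight (weight_tree delta a)) = cuts a.
Proof.
move=> ia; rewrite -tree_weight_cuts; last exact: weight_tree_permutree.
exact: weight_tree_cuts.
Qed.

Lemma permutree_eq T S : is_permutree delta T -> is_permutree delta S ->
  edge_cuts T = edge_cuts S -> T = S.
Proof. by move=> /andP[tT _] /andP[tS _]; apply: edge_cuts_inj. Qed.

Lemma cubic_lo_set T i : is_permutree delta T ->
  [set j | (i, j) \in cubic_set delta T] = lo_set U D (tree_weight T) i.
Proof.
move=> pT; have la := extension_weightP R pT.
rewrite {1}(linear_extension_tree pT la); apply/setP => j.
by rewrite in_set weight_tree_cubic; [rewrite /lo_set in_set andbC|exact: la.1].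
Qed.

Lemma cut_setsE I : (I \in cut_sets delta) = nontrivial_adm I.
Proof.
rewrite inE; apply/andP/and3P => [[/properP[_ [x _ xI]] /existsP[T /andP[pT]]]|[h1 h2 h3]].
  by rewrite tree_weight_cuts // => /in_cuts[].
split; first by rewrite properT.
have [a ia hI] := adm_in_cuts R h3 h1 h2.
apply/existsP; exists (weight_tree delta a).
by rewrite weight_tree_permutree // weight_tree_cuts.
Qed.

Definition in_polytope x : Prop :=
  set_sum x setT = ('C(n.+1, 2)%:R)%R /\
  forall I, nontrivial_adm I -> (cut_bound I <= set_sum x I)%R.

Definition tight x I : Prop := set_sum x I = cut_bound I.

Definition on_face a x : Prop := in_polytope x /\ forall I, I \in cuts a -> tight x I.

Definition vertex a : 'I_n -> R := coordinate U D a.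

Lemma vertex_in_polytope a : injective a -> in_polytope (vertex a).
Proof.
move=> ia; split; first by rewrite set_sumT; apply: coordinate_setT.
by move=> I /and3P[_ _ ad]; apply: coordinate_ge.
Qed.

Lemma vertex_tight a I : injective a -> I \in cuts a -> tight (vertex a) I.
Proof. by move=> ia; apply: coordinate_cut. Qed.

Lemma vertex_slack a I : injective a -> nontrivial_adm I -> I \notin cuts a ->
  (cut_bound I + 1 <= set_sum (vertex a) I)%R.
Proof. by move=> ia /and3P[h1 h2 h3] hI; apply: coordinate_gt. Qed.

Lemma vertex_tightP a I : injective a -> nontrivial_adm I ->
  tight (vertex a) I <-> I \in cuts a.
Proof.
move=> ia hI; split; last exact: vertex_tight.
move=> t; apply: contraT => /(vertex_slack ia hI).
by rewrite t -subr_ge0 opprD addNKr oppr_ge0 ler10.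
Qed.

Lemma vertex_on_face a b : injective b -> cuts a \subset cuts b -> on_face a (vertex b).
Proof.
move=> ib /subsetP sab; split; first exact: vertex_in_polytope.
by move=> I /sab; apply: vertex_tight.
Qed.

Lemma set_sumB x z I : set_sum (fun i => x i - z i)%R I = (set_sum x I - set_sum z I)%R.
Proof. by rewrite /set_sum sumrB. Qed.

Lemma on_face_vertex a x : injective a -> on_face a x -> x =1 vertex a.
Proof.
move=> ia [[xT _] xt] i; apply/eqP; rewrite -subr_eq0; apply/eqP.
apply: (cuts_kill (U := U) (D := D) (z := fun i => x i - vertex a i)%R _ ia).
  by rewrite set_sumB xT (proj1 (vertex_in_polytope ia)) subrr.
by move=> I hI; rewrite set_sumB (vertex_tight ia hI) xt // subrr.
Qed.

(** The difference of [x] and the corner vertex has total zero and nonnegative sums on the cuts of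
    [a], where the vertex is tight. [region_sum] passes this to lower sets, and Abel summation to
    the functional. *)
Lemma polytope_max a e x : in_polytope x ->
  (\sum_i a i * x i <= \sum_i a i * vertex (corner a e) i)%R /\
  ((\sum_i a i * x i = \sum_i a i * vertex (corner a e) i)%R <-> on_face a x).
Proof.
move=> px; pose y := vertex (corner a e); pose z i := (x i - y i)%R.
have iy : injective (corner a e) by apply: corner_inj.
have zT : set_sum z setT = 0%R.
  by rewrite set_sumB (proj1 px) (proj1 (vertex_in_polytope iy)) subrr.
have yt I : I \in cuts a -> set_sum y I = cut_bound I.
  by move=> /(subsetP (cuts_corner _ _ _ e)); apply: vertex_tight.
have zge I : I \in cuts a -> (0 <= set_sum z I)%R.
  move=> hI; rewrite set_sumB yt // subr_ge0; apply: (proj2 px).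
  exact: in_cuts_adm hI.
have zlow A : lower a A -> (0 <= set_sum z A)%R by apply: lower_sum_ge0 zT A zge.
have sumz : (\sum_i a i * z i = \sum_i a i * x i - \sum_i a i * y i)%R.
  by rewrite -sumrB; apply: eq_bigr => i _; rewrite mulrBr.
have [h1 h2] := abel_sum zT zlow.
rewrite -/y; split; first by rewrite -subr_le0 -sumz.
split=> [eq|[_ xt]].
  split=> // I hI; apply/eqP; rewrite /tight -(yt I hI) -subr_eq0 -set_sumB; apply/eqP.
  by apply: (cut_sum_eq0 zT zge) => //; apply: h2; rewrite sumz eq subrr.
apply/eqP; rewrite -subr_eq0 -sumz; apply/eqP/abel_sum_eq0 => // A lA.
apply: (lower_sum_eq0 (U := U) (D := D) zT _ lA) => I hI.
by rewrite set_sumB yt // xt // subrr.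
Qed.

(** The corner vertices of the face of [a] are tight only on their own cuts, so a set tight at all
    of them is a cut of every corner, hence of [a]. *)
Lemma on_face_sub a b : (forall x, on_face a x -> on_face b x) <-> cuts b \subset cuts a.
Proof.
split=> [h|/subsetP sba x [px xt]]; last by split=> // I /sba; apply: xt.
apply/subsetP => I hI; apply: in_cuts_corners => e.
have [|_ t] := h (vertex (corner a e)).
  by apply: vertex_on_face (cuts_corner _ _ _ _); apply: corner_inj.
by apply/vertex_tightP; [exact: corner_inj|exact: in_cuts_adm hI|exact: t].
Qed.

Definition arc_direction u w i : R := ((i == u)%:R - (i == w)%:R)%R.

Lemma set_sum_direction u w I :
  set_sum (arc_direction u w) I = ((u \in I)%:R - (w \in I)%:R)%R.
Proof.
have H v : (\sum_(i in I) (i == v)%:R = (v \in I)%:R :> R)%R.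
  have [vI|vI] := boolP (v \in I).
    by rewrite (bigD1 v) //= eqxx big1 ?addr0 // => i /andP[_ /negbTE ->].
  by rewrite big1 // => i iI; case: eqP => // e; rewrite -e iI in vI.
by rewrite /set_sum sumrB !H.
Qed.

Section TreeVertex.
Variables (T : {set 'I_n * 'I_n}) (pT : is_permutree delta T).

Definition tree_vertex : 'I_n -> R := vertex (tree_weight T).

Let tT : is_tree T. Proof. by case/andP: pT. Qed.
Let iT : injective (tree_weight T). Proof. exact: tree_weight_inj. Qed.

Lemma direction_cut u w K : (u, w) \in T -> K \in edge_cuts T ->
  set_sum (arc_direction u w) K = ((K == edge_cut T (u, w))%:R)%R.
Proof.
move=> uw /imsetP[[p q] pq ->]; rewrite set_sum_direction.
have [h1 h2 _ _] := tree_cutP tT uw; have [_ _ _ h4] := tree_cutP tT pq.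
case: eqP => [->|ne]; first by rewrite h1 (negbTE h2) subr0.
have : ~~ crosses (edge_cut T (p, q)) (u, w).
  by apply/negP => /(h4 _ uw) e; rewrite e in ne.
by rewrite /crosses /= negbK => /eqP ->; rewrite subrr.
Qed.

(** A unit step lowers a sum by at most 1, which the integral slack off the cuts absorbs; among the
    cuts only that of [u -> w] changes. *)
Lemma step_in_polytope u w : (u, w) \in T ->
  let x i := (tree_vertex i + arc_direction u w i)%R in
  in_polytope x /\ (forall K, K \in edge_cuts T -> K != edge_cut T (u, w) -> tight x K).
Proof.
move=> uw x; have [yT yP] := vertex_in_polytope iT.
have xE I : set_sum x I = (set_sum tree_vertex I + set_sum (arc_direction u w) I)%R.
  by rewrite /set_sum big_split.
split; last first.
  move=> K hK ne; rewrite /tight xE direction_cut // (negbTE ne) addr0.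
  by apply: vertex_tight => //; rewrite -tree_weight_cuts.
split; first by rewrite xE yT set_sum_direction !inE subrr addr0.
move=> I hI; rewrite xE; have [hc|hc] := boolP (I \in cuts (tree_weight T)).
  rewrite direction_cut ?tree_weight_cuts //.
  by apply: ler_wpDr => //; apply: yP.
have := vertex_slack iT hI hc; rewrite -/tree_vertex => le.
rewrite set_sum_direction; apply: le_trans (_ : set_sum tree_vertex I - 1 <= _)%R.
  by rewrite lerBrDr.
rewrite lerD2l; case: (u \in I); case: (w \in I); rewrite ?subrr ?subr0 ?sub0r //.
- by rewrite lerN10.
- by apply: le_trans ler01; rewrite lerN10.
- by rewrite lerN10.
Qed.

(** Subtracting the multiple of the direction prescribed by the remaining cut leaves a vector that
    vanishes on all cuts, hence is zero by [cuts_kill]. *)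
Lemma line_through u w x : (u, w) \in T -> set_sum x setT = ('C(n.+1, 2)%:R)%R ->
  (forall K, K \in edge_cuts T -> K != edge_cut T (u, w) -> tight x K) ->
  let s := (set_sum x (edge_cut T (u, w)) - cut_bound (edge_cut T (u, w)))%R in
  forall i, x i = (tree_vertex i + s * arc_direction u w i)%R.
Proof.
move=> uw xT xt s i; have [yT yP] := vertex_in_polytope iT.
apply/eqP; rewrite -subr_eq0 opprD addrA; apply/eqP.
pose z i := (x i - tree_vertex i - s * arc_direction u w i)%R.
have zE I : set_sum z I = (set_sum x I - set_sum tree_vertex I - s * set_sum (arc_direction u w) I)%R.
  by rewrite /set_sum mulr_sumr -!sumrB.
apply: (cuts_kill (U := U) (D := D) (z := z) _ iT).
  by rewrite zE xT yT set_sum_direction !inE !subrr mulr0 subrr.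
move=> I hI; rewrite zE [set_sum tree_vertex I](vertex_tight iT hI).
rewrite -tree_weight_cuts // in hI; rewrite direction_cut //.
have [->|ne] := eqVneq I (edge_cut T (u, w)); first by rewrite mulr1 /s subrr.
by rewrite mulr0 subr0 xt // subrr.
Qed.

End TreeVertex.

End PolytopeFunctions.

(** * Rotations *)

Section Rotations.
Variables (R : realFieldType) (n : nat) (delta : 'I_n -> decoration).
Implicit Types (i j k u w : 'I_n) (A B I J K : {set 'I_n}) (a b x z : 'I_n -> R).
Implicit Types (T S : {set 'I_n * 'I_n}) (X : {set {set 'I_n}}).

Local Notation U := (ups delta).
Local Notation D := (downs delta).
Local Notation cuts := (cuts U D).
Local Notation permutree := (is_permutree delta).
Local Notation vert := (tree_vertex R delta).
Local Notation tw := (tree_weight R).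

Lemma card_edge_cuts_eq T S : permutree T -> permutree S -> #|edge_cuts T| = #|edge_cuts S|.
Proof. by move=> /andP[tT _] /andP[tS _]; rewrite !card_edge_cuts. Qed.

Lemma edge_cuts_subset T S : permutree T -> permutree S ->
  edge_cuts T \subset edge_cuts S -> T = S.
Proof.
move=> pT pS sub; apply: (permutree_eq pT pS); apply/eqP.
by rewrite eqEcard sub (card_edge_cuts_eq pT pS) leqnn.
Qed.

Lemma tree_vertex_in_polytope T : permutree T -> in_polytope delta (vert T).
Proof. by move=> pT; apply/vertex_in_polytope/tree_weight_inj/pT. Qed.

Lemma tree_vertex_tight T K : permutree T -> nontrivial_adm delta K ->
  tight (vert T) K <-> K \in edge_cuts T.
Proof.
move=> pT hK; rewrite (tree_weight_cuts R pT).
exact: vertex_tightP (tree_weight_inj pT) hK.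
Qed.

Lemma edge_cut_nontrivial T K : permutree T -> K \in edge_cuts T -> nontrivial_adm delta K.
Proof. by move=> pT; rewrite (tree_weight_cuts R pT) => /in_cuts_adm. Qed.

Lemma tree_on_face a T : permutree T ->
  on_face delta a (vert T) <-> cuts a \subset edge_cuts T.
Proof.
move=> pT; split=> [[_ t]|sub].
  apply/subsetP => K hK; apply/(tree_vertex_tight pT (in_cuts_adm hK)).
  exact: t.
apply: vertex_on_face; first exact: tree_weight_inj pT.
by rewrite -tree_weight_cuts.
Qed.

Definition adjacent_cuts T S (e f : 'I_n * 'I_n) : Prop :=
  [/\ T != S, e \in T, f \in S &
      edge_cuts T :\ edge_cut T e = edge_cuts S :\ edge_cut S f].

Lemma adjacent_cuts_sym T S e f : adjacent_cuts T S e f -> adjacent_cuts S T f e.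
Proof. by case=> h1 h2 h3 h4; split=> //; rewrite eq_sym. Qed.

Lemma tight_edge T u w x : permutree T -> (u, w) \in T -> in_polytope delta x ->
  (forall K, K \in edge_cuts T :\ edge_cut T (u, w) -> tight x K) ->
  exists2 s : R, (0 <= s)%R & forall i, x i = (vert T i + s * arc_direction R u w i)%R.
Proof.
move=> pT uw [xT xP] xt.
exists (set_sum x (edge_cut T (u, w)) - cut_bound R (edge_cut T (u, w)))%R.
  rewrite subr_ge0; apply: xP; apply: (edge_cut_nontrivial pT).
  exact: mem_edge_cuts.
apply: (line_through pT uw xT) => K hK ne.
by apply: xt; rewrite in_setD1 ne.
Qed.

Lemma adjacent_vertex T S u w f : permutree T -> permutree S ->
  adjacent_cuts T S (u, w) f -> exists2 s : R, (0 < s)%R &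
    forall i, vert S i = (vert T i + s * arc_direction R u w i)%R.
Proof.
move=> pT pS [ne uw fS e].
have [||s s0 E] := @tight_edge T u w (vert S) pT uw.
- exact: tree_vertex_in_polytope.
- move=> K; rewrite e in_setD1 => /andP[_ hK].
  by apply/(tree_vertex_tight pS) => //; apply: edge_cut_nontrivial hK.
exists s => //; rewrite lt_neqAle s0 andbT; apply: contra ne => /eqP s0E.
apply/eqP/esym/(edge_cuts_subset pS pT)/subsetP => K hK.
have adK := edge_cut_nontrivial pS hK.
apply/(tree_vertex_tight pT adK); move/(tree_vertex_tight pS adK): hK.
rewrite /tight => <-; apply: eq_bigr => i _.
by rewrite E -s0E mul0r addr0.
Qed.

Lemma arc_directionE u w i : (arc_direction R u w i = (i == u)%:R - (i == w)%:R)%R.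
Proof. by []. Qed.

(** Going from one vertex to the other and back adds two arc directions with positive coefficients;
    they cancel only if the arcs are opposite. *)
Lemma adjacent_reverse T S u w f : permutree T -> permutree S ->
  adjacent_cuts T S (u, w) f -> f = (w, u).
Proof.
case: f => u' w' pT pS adj; have [s s0 E] := adjacent_vertex pT pS adj.
have [s' s0' E'] := adjacent_vertex pS pT (adjacent_cuts_sym adj).
case: adj => _ uw u'w' _; have /andP[tT _] := pT; have /andP[tS _] := pS.
have uwn : u != w by have := tree_arc_neq tT uw.
have Z i : (s * arc_direction R u w i + s' * arc_direction R u' w' i = 0)%R.
  have := E' i; rewrite E -addrA => /eqP.
  by rewrite -subr_eq0 opprD addNKr oppr_eq0 => /eqP.
have := Z u; have := Z w; rewrite !arc_directionE !eqxx (negbTE uwn).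
rewrite [w == u]eq_sym (negbTE uwn) subr0 sub0r mulr1 mulrN1.
have [->|wu'] := eqVneq w u'; last first.
  rewrite sub0r mulrN => /eqP; rewrite -opprD oppr_eq0 paddr_eq0 ?(ltW s0) //.
    by rewrite gt_eqF.
  by rewrite mulr_ge0 // ltW.
have [-> //|uw'] := eqVneq u w'.
move=> _ /eqP; rewrite subr0 paddr_eq0 ?(ltW s0) //; first by rewrite gt_eqF.
by rewrite mulr_ge0 // ltW.
Qed.

Lemma adjacent_segment T S u w f x : permutree T -> permutree S ->
  adjacent_cuts T S (u, w) f -> in_polytope delta x ->
  (forall K, K \in edge_cuts T :\ edge_cut T (u, w) -> tight x K) ->
  exists2 t : R, (0 <= t <= 1)%R & forall i, x i = (vert T i + t * (vert S i - vert T i))%R.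
Proof.
move=> pT pS adj px xt; have fE := adjacent_reverse pT pS adj.
have [s s0 E] := adjacent_vertex pT pS adj.
case: (adj) => ne uw fS e; have /andP[tT _] := pT.
have [r r0 Er] := tight_edge pT uw px xt.
have wu : (w, u) \in S by rewrite -fE.
have [r' r0' Er'] : exists2 r' : R, (0 <= r')%R &
    forall i, x i = (vert S i + r' * arc_direction R w u i)%R.
  apply: tight_edge => // K hK; apply: xt; move: hK.
  by rewrite -fE -e.
have rs : (r + r' = s)%R.
  have uwn : u != w by have := tree_arc_neq tT uw.
  have := Er u; rewrite Er' E !arc_directionE eqxx (negbTE uwn) /= subr0 sub0r !mulr1 mulrN1.
  by move=> h; lra.
exists (r / s)%R.
  rewrite divr_ge0 ?(ltW s0) //= ler_pdivrMr // mul1r -rs.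
  by rewrite lerDl.
by move=> i; rewrite Er E addrAC subrr add0r mulrA divfK // gt_eqF.
Qed.

(** By [step_in_polytope], each arc of [T] whose cut is not kept gives a direction inside the face.
    A line has room for only one of these directions. *)
Lemma segment_adjacent a T S : permutree T -> permutree S -> T != S ->
  on_face delta a (vert T) -> on_face delta a (vert S) ->
  (forall x, on_face delta a x -> exists t : R,
     forall i, x i = (vert T i + t * (vert S i - vert T i))%R) ->
  exists2 e, e \in T & cuts a = edge_cuts T :\ edge_cut T e.
Proof.
move=> pT pS ne /(tree_on_face a pT) aT /(tree_on_face a pS) aS seg.
have [K KT Ka] : exists2 K, K \in edge_cuts T & K \notin cuts a.
  apply/subsetPn; apply: contra ne => sub; apply/eqP.
  by apply: (edge_cuts_subset pT pS); apply: subset_trans sub aS.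
have /imsetP[[u w] uw KE] := KT; exists (u, w) => //.
have step p q : (p, q) \in T -> edge_cut T (p, q) \notin cuts a ->
    exists t : R, forall i, (arc_direction R p q i = t * (vert S i - vert T i))%R.
  move=> pq hpq; have [h1 h2] := step_in_polytope R pT pq.
  have [|t Et] := seg (fun i => vert T i + arc_direction R p q i)%R.
    split=> // L La; apply: h2; first exact: (subsetP aT).
    by apply: contraNneq hpq => <-.
  by exists t => i; have /addrI := Et i.
apply/eqP; rewrite eqEsubset; apply/andP; split.
  apply/subsetP => L La; rewrite in_setD1 (subsetP aT) // andbT.
  by apply: contraTneq La => ->; rewrite -KE.
apply/subsetP => L; rewrite in_setD1 => /andP[LK LT]; apply: contraT => La.
have /imsetP[[p q] pq LE] := LT; rewrite LE in La LK.
have [t Et] := step p q pq La.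
have [r Er] : exists t : R, forall i,
    (arc_direction R u w i = t * (vert S i - vert T i))%R by apply: step; rewrite -?KE.
pose c := set_sum (fun i => vert S i - vert T i)%R K.
have sc v (x y : 'I_n -> R) I : (forall i, x i = v * y i)%R -> set_sum x I = (v * set_sum y I)%R.
  by move=> h; rewrite /set_sum mulr_sumr; apply: eq_bigr.
have e1 : (r * c = 1)%R by rewrite -(sc _ _ _ K Er) (direction_cut R pT uw KT) KE eqxx.
have e2 : (t * c = 0)%R.
  rewrite -(sc _ _ _ K Et) (direction_cut R pT pq KT) eq_sym.
  by move: LK; rewrite KE => /negbTE ->.
have c0 : c != 0%R by apply: contra_eq_neq e1 => ->; rewrite mulr0 eq_sym oner_eq0.
have t0 : t = 0%R by move/eqP: e2; rewrite mulf_eq0 (negbTE c0) orbF => /eqP.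
have := sc _ _ _ (edge_cut T (p, q)) Et.
rewrite (direction_cut R pT pq (mem_edge_cuts pq)) eqxx t0 mul0r.
by move/eqP; rewrite oner_eq0.
Qed.

(* Exposes the face on which the cuts in [X] are tight. *)
Definition family_weight X i : R := (- \sum_(K in X) (i \in K)%:R)%R.

Lemma family_on_face T X x : permutree T -> X \subset edge_cuts T -> in_polytope delta x ->
  on_face delta (family_weight X) x <-> (forall K, K \in X -> tight x K).
Proof.
move=> pT XT px; set a := family_weight X.
pose f := (- \sum_(K in X) cut_bound R K)%R.
have val y : (\sum_i a i * y i = - \sum_(K in X) set_sum y K)%R.
  rewrite -sumrN; under eq_bigr do rewrite /a /family_weight mulNr mulr_suml -sumrN.
  rewrite exchange_big /=; apply: eq_bigr => K _.
  by rewrite set_sumE sumrN.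
have adX K : K \in X -> nontrivial_adm delta K.
  by move=> /(subsetP XT); apply: edge_cut_nontrivial.
have le y : in_polytope delta y -> (\sum_i a i * y i <= f)%R.
  by move=> [_ yP]; rewrite val lerN2; apply: ler_sum => K /adX /yP.
have iy : injective (corner a xpredT) by apply: corner_inj.
have top : (\sum_i a i * vertex delta (corner a xpredT) i = f)%R.
  apply/le_anti; rewrite le; last exact: vertex_in_polytope.
  have [h _] := polytope_max a xpredT (tree_vertex_in_polytope pT).
  apply: le_trans h; rewrite val lerN2; apply: ler_sum => K KX.
  by rewrite (proj2 (tree_vertex_tight pT (adX K KX)) (subsetP XT K KX)).
have [_ h] := polytope_max a xpredT px; rewrite -/a -h top val.
split=> [/oppr_inj/eqP|t]; last first.
  by congr (- _)%R; apply: eq_bigr => K /t.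
rewrite -subr_eq0 -sumrB psumr_eq0; last first.
  by move=> K /adX hK; rewrite subr_ge0; apply: (proj2 px).
move=> /allP e K KX; have := e K; rewrite mem_index_enum KX => /(_ isT).
by rewrite subr_eq0 => /eqP.
Qed.

Lemma family_cuts T S X : permutree T -> X \subset edge_cuts T -> permutree S ->
  cuts (family_weight X) \subset edge_cuts S <-> X \subset edge_cuts S.
Proof.
move=> pT XT pS; have pv := tree_vertex_in_polytope pS.
have adX K : K \in X -> nontrivial_adm delta K.
  by move=> /(subsetP XT); apply: edge_cut_nontrivial.
split=> [/(tree_on_face _ pS)/(family_on_face pT XT pv) h|/subsetP h].
  by apply/subsetP => K KX; apply/(tree_vertex_tight pS (adX K KX))/h.
apply/(tree_on_face _ pS)/(family_on_face pT XT pv) => K KX.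
by apply/(tree_vertex_tight pS (adX K KX))/h.
Qed.

Lemma rotationP T S : reflect
  [/\ permutree T, permutree S & exists i j, i < j /\ adjacent_cuts T S (i, j) (j, i)]
  (rotation delta T S).
Proof.
apply: (iffP and3P) => -[pT pS h]; split=> //.
  move: h => /existsP[i /existsP[j /and4P[ij ijT jiS /eqP e]]].
  exists i, j; split=> //; split=> //.
  apply: contraTneq jiS => <-; have /andP[tT _] := pT.
  have [h1 h2 _ h4] := tree_cutP tT ijT.
  apply/negP => jiT; have := h4 _ jiT (crosses_out h1 h2).
  by case=> e'; rewrite e' ltnn in ij.
move: h => [i [j [ij [ne h1 h2 h3]]]]; apply/existsP; exists i; apply/existsP; exists j.
by rewrite ij h1 h2 h3 eqxx.
Qed.

Lemma adjacent_rotation T S e f : permutree T -> permutree S -> adjacent_cuts T S e f ->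
  rotation delta T S \/ rotation delta S T.
Proof.
case: e => u w pT pS adj; have fE := adjacent_reverse pT pS adj.
rewrite fE in adj; have [_ uw _ _] := adj; have /andP[tT _] := pT.
have := tree_arc_neq tT uw; rewrite neq_ltn => /orP[lt|lt]; [left|right].
  by apply/rotationP; split=> //; exists u, w.
by apply/rotationP; split=> //; exists w, u; split=> //; apply: adjacent_cuts_sym.
Qed.

(** A third tree would be adjacent to both, and its exchanged arc would be [w -> u] seen from [T]
    and [u -> w] seen from [T']. *)
Lemma adjacent_third T T' S u w : permutree T -> permutree T' -> permutree S ->
  adjacent_cuts T T' (u, w) (w, u) ->
  edge_cuts T :\ edge_cut T (u, w) \subset edge_cuts S -> S = T \/ S = T'.
Proof.
move=> pT pT' pS adj; set X := edge_cuts T :\ _ => XS.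
have [->|ST] := eqVneq S T; first by left.
have [->|ST'] := eqVneq S T'; first by right.
exfalso; have [_ uw wu e] := adj.
have cX : #|edge_cuts S| = #|X|.+1.
  by rewrite -(card_edge_cuts_eq pT pS) (cardsD1 (edge_cut T (u, w))) mem_edge_cuts.
have [L LS LX] : exists2 L, L \in edge_cuts S & L \notin X.
  by apply/subsetPn/negP => /subset_leq_card; rewrite cX ltnn.
have eS : edge_cuts S :\ L = X.
  apply/esym/eqP; rewrite eqEcard; apply/andP; split.
    by apply/subsetP => K KX; rewrite in_setD1 (subsetP XS) // andbT; apply: contraNneq LX => <-.
  by move: cX; rewrite (cardsD1 L) LS add1n => -[->]; rewrite leqnn.
have /imsetP[g gS LE] := LS.
have a1 : adjacent_cuts T S (u, w) g by split; rewrite -?LE ?eS // eq_sym.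
have a2 : adjacent_cuts T' S (w, u) g by split; rewrite -?LE ?eS -?e // eq_sym.
have := adjacent_reverse pT pS a1; rewrite (adjacent_reverse pT' pS a2) => -[uwE _].
have /andP[tT _] := pT; have := tree_arc_neq tT uw; by rewrite uwE eqxx.
Qed.

Definition cubic T i : {set 'I_n} := lo_set U D (tw T) i.

Lemma cubic_hi T i : permutree T -> hi_set U D (tw T) i = cubic T i.
Proof. by move=> pT; rewrite /cubic injective_lo_hi //; apply: tree_weight_inj pT. Qed.

Lemma cubic_cuts a T i : permutree T -> cuts a \subset edge_cuts T ->
  lo_set U D a i \subset cubic T i /\ cubic T i \subset hi_set U D a i.
Proof.
move=> pT; rewrite (tree_weight_cuts R pT) => sub.
by split; [apply: lo_set_cuts|rewrite -(cubic_hi i pT); apply: hi_set_cuts].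
Qed.

Lemma cubic_weight_tree a i : injective a ->
  cubic (weight_tree delta a) i = lo_set U D a i.
Proof.
move=> ia; apply/eqP; rewrite eqEsubset /cubic.
by rewrite !lo_set_cuts ?weight_tree_weight_cuts.
Qed.

Lemma cubic_corner a e i : cubic (weight_tree delta (corner a e)) i =
  if e i then hi_set U D a i else lo_set U D a i.
Proof. by rewrite cubic_weight_tree ?corner_lo_set //; apply: corner_inj. Qed.

Lemma in_open_box_tree T : permutree T ->
  in_open_box U D (tw T) (fun i => (#|cubic T i|%:R)%R).
Proof. by move=> pT i; left; rewrite /lo /hi cubic_hi. Qed.

Lemma cubic_inj T S : permutree T -> permutree S ->
  (forall i, #|cubic T i| = #|cubic S i|) -> T = S.
Proof.
move=> pT pS h; apply: (permutree_eq pT pS).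
rewrite (tree_weight_cuts R pT) (tree_weight_cuts R pS).
apply: open_box_inj (in_open_box_tree pT) _ => i; rewrite h.
exact: in_open_box_tree.
Qed.

(** All corner trees keep the common cuts, so each is [T] or [T']. Since [w] is in the cubic set of
    [T'] at [u] but not in that of [T], the choice at [u] decides which; the choice at any other
    label changes nothing, so the box is a segment. *)
Lemma rotation_box T T' u w : permutree T -> permutree T' -> u < w ->
  adjacent_cuts T T' (u, w) (w, u) ->
  let a := family_weight (edge_cuts T :\ edge_cut T (u, w)) in
  (forall i, cubic T i = lo_set U D a i /\ cubic T' i = hi_set U D a i) /\
  (forall i, i != u -> lo_set U D a i = hi_set U D a i).
Proof.
move=> pT pT' uw adj; set X := edge_cuts T :\ edge_cut T (u, w); move=> a.
have [ne uwT wuT' e] := adj; rewrite -/X in e.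
have XT : X \subset edge_cuts T by apply: subD1set.
have aT : cuts a \subset edge_cuts T by apply/(family_cuts pT XT pT).
have aT' : cuts a \subset edge_cuts T'.
  by apply/(family_cuts pT XT pT'); rewrite e subD1set.
have pC c : permutree (weight_tree delta (corner a c)).
  by apply/weight_tree_permutree/corner_inj.
have corners c : weight_tree delta (corner a c) = T \/ weight_tree delta (corner a c) = T'.
  apply: adjacent_third adj _ => //; apply/(family_cuts pT XT (pC c)).
  by rewrite weight_tree_cuts; [apply: cuts_corner|apply: corner_inj].
have /andP[tT _] := pT; have /andP[tT' _] := pT'.
have wT' : w \in cubic T' u.
  rewrite /cubic -(cubic_lo_set _ _ pT') in_set in_set /= uw /=.
  have wc : w \in component T' u w by rewrite inE connect0.
  by case: ifP => _; apply/bigcupP; exists w; rewrite // inE ?wuT'.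
have wT : w \notin cubic T u.
  rewrite /cubic -(cubic_lo_set _ _ pT) in_set in_set /= uw /=.
  have H (P : pred 'I_n) : w \notin \bigcup_(c in children T u | P c) component T u c.
    apply/bigcupP => -[c /andP[]]; rewrite inE => cu _ wc.
    have {}wc : w \in edge_cut T (c, u) by [].
    have [h1 h2 _ h4] := tree_cutP tT cu.
    have [cw _] := h4 _ uwT (crosses_out wc h2).
    have := tree_arc_neq tT cu; by rewrite -cw eqxx.
  case: ifP => _; first exact: H.
  by have := H predT; rewrite /descendants; under eq_bigl do rewrite andbT.
have [_ hiT'] := cubic_cuts u pT' aT'; have [loT _] := cubic_cuts u pT aT.
have wlo : w \notin lo_set U D a u by apply: contra wT; apply: subsetP.
have whi := subsetP hiT' _ wT'.
have cT c : c u = false -> weight_tree delta (corner a c) = T.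
  move=> cu; case: (corners c) => // E; move: wT'.
  by rewrite -E cubic_corner cu (negbTE wlo).
have cT' (c : 'I_n -> bool) : c u -> weight_tree delta (corner a c) = T'.
  move=> cu; case: (corners c) => // E; move: wT.
  by rewrite -E cubic_corner cu whi.
split=> [i|i iu].
  rewrite -{1}(cT (fun=> false)) // -{1}(cT' (fun=> true)) //.
  by rewrite !cubic_corner.
have := cubic_corner a (fun k => k == i) i; rewrite eqxx cT; last first.
  by rewrite eq_sym (negbTE iu).
by rewrite -(cT (fun=> false)) // cubic_corner.
Qed.

Lemma rotation_neq T S : rotation delta T S -> T != S.
Proof. by case/rotationP => _ _ [i [j [_ []]]]. Qed.

Lemma rotation_cubic T S i : rotation delta T S -> cubic T i \subset cubic S i.
Proof.
case/rotationP => pT pS [u [w [uw adj]]].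
by have [/(_ i)[-> ->] _] := rotation_box pT pS uw adj; apply: lo_hi_set.
Qed.

Lemma connect_rotation T S : connect (rotation delta) T S -> T != S ->
  [/\ permutree T, permutree S & forall i, cubic T i \subset cubic S i].
Proof.
move=> /connectP[p]; elim: p T => [T _ ->|S' p IH T /= /andP[TS' pp] lS ne].
  by rewrite eqxx.
have /rotationP[pT pS' _] := TS'.
have [SE|ne'] := eqVneq S' S.
  by rewrite -SE; split; [exact: pT|exact: pS'|move=> i; apply: rotation_cubic].
have [_ pS h] := IH _ pp lS ne'; split; [exact: pT|exact: pS|move=> i].
exact: subset_trans (rotation_cubic i TS') (h i).
Qed.

(** A tree strictly between would have its cubic vector in the open segment of the rotation and also
    in its own open box. By [open_box_inj] it would then have only cuts of [T], so it would be
    [T]. *)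
Lemma rotation_coverE T S : rotation_cover delta T S = rotation delta T S.
Proof.
apply/idP/idP.
  move=> /andP[/andP[ne /connectP[[|T' p] /= h lS]] nex]; first by rewrite lS eqxx in ne.
  case/andP: h => TT' pp; have [<- //|ne'] := eqVneq T' S.
  case/negP: nex; apply/existsP; exists T'; apply/andP; split.
    by rewrite /rotation_lt (rotation_neq TT') connect1.
  by rewrite /rotation_lt ne'; apply/connectP; exists p.
move=> TS; rewrite /rotation_cover /rotation_lt (rotation_neq TS) connect1 //=.
apply/negP => /existsP[Q /andP[/andP[ne1 c1] /andP[ne2 c2]]].
have /rotationP[pT pS [u [w [uw adj]]]] := TS.
have [h1 h2] := rotation_box pT pS uw adj; move: h1 h2.
set X := edge_cuts T :\ _; set a := family_weight _ => h1 h2.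
have [_ pQ s1] := connect_rotation c1 ne1.
have [_ _ s2] := connect_rotation c2 ne2.
have XT : X \subset edge_cuts T by apply: subD1set.
have aT : cuts a \subset edge_cuts T by apply/(family_cuts pT XT pT).
have same i : i != u -> cubic Q i = cubic T i.
  move=> iu; apply/eqP; rewrite eqEsubset; apply/andP; split; last exact: s1.
  apply: subset_trans (s2 i) _.
  by have [-> ->] := h1 i; rewrite h2.
have same' i : i != u -> cubic Q i = cubic S i.
  move=> iu; apply/eqP; rewrite eqEsubset; apply/andP; split; first exact: s2.
  apply: subset_trans (s1 i).
  by have [-> ->] := h1 i; rewrite h2.
have neq1 : #|cubic T u| < #|cubic Q u|.
  rewrite ltn_neqAle subset_leq_card // andbT; apply: contra ne1 => /eqP e.
  apply/eqP/(cubic_inj pT pQ) => i; have [-> //|iu] := eqVneq i u.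
  by rewrite same.
have neq2 : #|cubic Q u| < #|cubic S u|.
  rewrite ltn_neqAle subset_leq_card // andbT; apply: contra ne2 => /eqP e.
  apply/eqP/(cubic_inj pQ pS) => i; have [-> //|iu] := eqVneq i u.
  by rewrite same'.
have op : in_open_box U D a (fun i => (#|cubic Q i|%:R)%R).
  move=> i; have [eT eS] := h1 i; rewrite /lo /hi -eT -eS.
  have [->|iu] := eqVneq i u.
    right; apply/andP; split; rewrite ltr_nat; [exact: neq1|exact: neq2].
  by left; rewrite -(same i iu) -(same' i iu); split.
have e := open_box_inj op (in_open_box_tree pQ).
case/eqP: ne1; apply/esym/(edge_cuts_subset pQ pT).
by rewrite (tree_weight_cuts R pQ) -e.
Qed.

End Rotations.

(** * The embedding *)

(* Not imported earlier, since [set0], [setT], ... of [finset] would be shadowed. *)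
From mathcomp Require Import all_classical all_reals all_analysis.

(** * Segments, boxes and their relative interiors *)

Section ConvexSets.
Local Open Scope ring_scope.
Local Open Scope classical_set_scope.
Variables (R : realType) (m : nat).
Implicit Types (A B : set 'rV[R]_m) (x y u v : 'rV[R]_m) (t : R).

Lemma convexP A : @convex_set R 'rV[R]_m A <->
  forall x y t, 0 <= t <= 1 -> A x -> A y -> A (t *: x + (1 - t) *: y).
Proof.
split=> [cA x y t /andP[t0 t1] Ax Ay|cA x y l].
  by have := cA x y (Itv01 t0 t1); rewrite !inE => /(_ Ax Ay).
by rewrite !inE => Ax Ay; apply: (cA _ _ l%:num) => //; apply/andP; split.
Qed.

Lemma conv_hull_convex A x y t : 0 <= t <= 1 -> conv_hull A x -> conv_hull A y ->
  conv_hull A (t *: x + (1 - t) *: y).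
Proof.
move=> t01 hx hy B hB; have [/convexP cB _] := hB.
exact: cB t01 (hx B hB) (hy B hB).
Qed.

Lemma conv_hull_segment u v :
  conv_hull [set u; v] = [set x | exists2 t, 0 <= t <= 1 & x = u + t *: (v - u)].
Proof.
apply/seteqP; split.
  apply: smallest_sub.
    apply/convexP => x y t /andP[t0 t1] [p /andP[p0 p1] ->] [q /andP[q0 q1] ->].
    exists (t * p + (1 - t) * q).
      have t1' : 0 <= 1 - t by rewrite subr_ge0.
      rewrite addr_ge0 ?mulr_ge0 //=.
      have h1 : t * p <= t by rewrite ler_piMr.
      have h2 : (1 - t) * q <= 1 - t by rewrite ler_piMr.
      by apply: le_trans (lerD h1 h2) _; rewrite addrC subrK.
    by apply/rowP => i; rewrite !mxE; ring.
  move=> x [->|->]; first by exists 0; rewrite ?lexx ?ler01 // scale0r addr0.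
  by exists 1; rewrite ?lexx ?ler01 // scale1r addrC subrK.
move=> x [t /andP[t0 t1] ->].
have -> : u + t *: (v - u) = t *: v + (1 - t) *: u.
  by apply/rowP => i; rewrite !mxE; ring.
by apply: conv_hull_convex; rewrite ?t0 //; apply: sub_gen_smallest; [right|left].
Qed.

Definition box (l h : 'I_m -> R) : set 'rV[R]_m := [set x | forall i, l i <= x 0 i <= h i].

Lemma box_convex l h : @convex_set R 'rV[R]_m (box l h).
Proof.
apply/convexP => x y t /andP[t0 t1] bx by_ i; rewrite !mxE.
have t1' : 0 <= 1 - t by rewrite subr_ge0.
have /andP[x1 x2] := bx i; have /andP[y1 y2] := by_ i.
have E (c : R) : c = t * c + (1 - t) * c by rewrite -mulrDl addrC subrK mul1r.
by rewrite [X in X <= _]E [X in _ && (_ <= X)]E !lerD ?ler_wpM2l.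
Qed.

Lemma box_corners l h B : @convex_set R 'rV[R]_m B ->
  (forall x, (forall i, x 0 i = l i \/ x 0 i = h i) -> B x) -> box l h `<=` B.
Proof.
move=> /convexP cB hB.
(* [k] counts the leading coordinates that may still be interior; each is resolved by a convex
   combination of points at its two ends. *)
suff H (k : nat) x : (k <= m)%N -> box l h x ->
    (forall i : 'I_m, (k <= i)%N -> x 0 i = l i \/ x 0 i = h i) -> B x.
  by move=> x bx; apply: (H m) => // i; rewrite leqNgt ltn_ord.
elim: k x => [|k IH] x km bx hx; first by apply: hB => i; apply: hx.
pose j := Ordinal km.
pose xs (c : R) : 'rV[R]_m := \row_i (if i == j then c else x 0 i).
have /andP[lx xh] := bx j.
have bB c : l j <= c <= h j -> (c = l j \/ c = h j) -> B (xs c).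
  move=> lch cE; apply: IH; first exact: ltnW.
    by move=> i; rewrite mxE; case: eqP => [->//|_]; apply: bx.
  move=> i; rewrite leq_eqVlt => /orP[/eqP ki|ki]; rewrite mxE.
    have -> : i = j by apply: val_inj.
    by rewrite eqxx.
  by rewrite -(inj_eq val_inj) gtn_eqF //; apply: hx.
have lh := le_trans lx xh.
have [e|ne] := eqVneq (l j) (h j).
  apply: IH; [exact: ltnW|exact: bx|move=> i].
  rewrite leq_eqVlt => /orP[/eqP ki|]; last exact: hx.
  have -> : i = j by apply: val_inj.
  by left; apply/le_anti; rewrite lx andbT e.
have d : 0 < h j - l j by rewrite subr_gt0 lt_neqAle ne.
pose t := (x 0 j - l j) / (h j - l j).
have -> : x = t *: xs (h j) + (1 - t) *: xs (l j).
  apply/rowP => i; rewrite !mxE; case: eqP => [->|_].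
    by rewrite mulrBl mul1r addrCA -mulrBr /t divfK ?gt_eqF // addrC subrK.
  by rewrite -mulrDl addrC subrK mul1r.
apply: cB.
- rewrite /t divr_ge0 ?subr_ge0 ?(ltW d) //= ler_pdivrMr // mul1r.
  by rewrite lerD2r.
- by apply: bB; [rewrite lh lexx|right].
- by apply: bB; [rewrite lexx lh|left].
Qed.

Lemma finite_eps (P : 'I_m -> R -> Prop) :
  (forall i, exists2 e : R, 0 < e & forall e', 0 < e' <= e -> P i e') ->
  exists2 e : R, 0 < e & forall i, P i e.
Proof.
move=> h; have /choice[f fP] : forall i, exists e : R, 0 < e /\
    forall e', 0 < e' <= e -> P i e' by move=> i; have [e e0 he] := h i; exists e.
(* The default 1 keeps the minimum positive also for [m = 0]. *)
have e0 : 0 < \big[Order.min/1]_i f i.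
  by apply: lt_bigmin => // i _; have [] := fP i.
exists (\big[Order.min/1]_i f i) => // i; have [_] := fP i; apply.
by rewrite e0 bigmin_le.
Qed.

Lemma relint_box l h x : relint (box l h) x <->
  forall i, l i = x 0 i /\ h i = x 0 i \/ l i < x 0 i < h i.
Proof.
split=> [[bx hx] i|hx].
  have /andP[lx xh] := bx i.
  have upd c : l i <= c <= h i -> exists2 e : R, 0 < e & l i <= x 0 i + e * (x 0 i - c) <= h i.
    move=> lch; pose y : 'rV[R]_m := \row_k (if k == i then c else x 0 k).
    have [|e e0 /(_ i)] := hx y.
      by move=> k; rewrite mxE; case: eqP => [->//|_]; apply: bx.
    by rewrite !mxE eqxx => H; exists e.
  have lh := le_trans lx xh.
  have [e|ne] := eqVneq (l i) (h i).
    by left; split; apply/le_anti; rewrite ?lx -?e ?lx // ?andbT e ?xh.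
  right; rewrite !lt_neqAle lx xh !andbT; apply/andP; split.
    apply/eqP => e; have [|e' e0 /andP[+ _]] := upd (h i); first by rewrite lh lexx.
    rewrite -e lerDl pmulr_rge0 // subr_ge0 => hl.
    by case/eqP: ne; apply/le_anti; rewrite lh hl.
  apply/eqP => e; have [|e' e0 /andP[_]] := upd (l i); first by rewrite lexx lh.
  rewrite e gerDl pmulr_rle0 // subr_le0 => hl.
  by case/eqP: ne; apply/le_anti; rewrite lh hl.
have bx : box l h x.
  by move=> i; case: (hx i) => [[-> ->]|/andP[/ltW -> /ltW ->]]; rewrite ?lexx.
split=> // y by_; suff [e e0 he] : exists2 e : R, 0 < e &
    forall i, l i <= x 0 i + e * (x 0 i - y 0 i) <= h i.
  by exists e => // i; rewrite !mxE.
apply: (finite_eps (P := fun i e => l i <= x 0 i + e * (x 0 i - y 0 i) <= h i)) => i.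
have /andP[ly yh] := by_ i.
case: (hx i) => [[lE hE]|/andP[lx xh]].
  have -> : y 0 i = x 0 i by apply/le_anti; rewrite -{1}hE yh -lE ly.
  by exists 1 => // e' _; rewrite subrr mulr0 addr0 lE hE lexx.
pose s := Order.min (x 0 i - l i) (h i - x 0 i).
have s0 : 0 < s by rewrite lt_min !subr_gt0 lx.
pose d := h i - l i; have d0 : 0 < d by rewrite subr_gt0 (lt_trans lx).
exists (s / d); first by rewrite divr_gt0.
move=> e /andP[e0 es]; have ed : e * d <= s by rewrite -ler_pdivlMr.
have [s1 s2] : s <= x 0 i - l i /\ s <= h i - x 0 i by split; rewrite ge_min lexx ?orbT.
have b1 : e * (x 0 i - y 0 i) <= e * d.
  by rewrite ler_wpM2l ?(ltW e0) // lerB // ltW.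
have b2 : - (e * d) <= e * (x 0 i - y 0 i).
  rewrite -mulrN ler_wpM2l ?(ltW e0) // /d opprB lerB // ltW //.
by apply/andP; split; lra.
Qed.

End ConvexSets.

(** * Faces, cells and the correspondence between them *)

Section Embedding.
Local Open Scope ring_scope.
Local Open Scope classical_set_scope.
Variables (R : realType) (n : nat) (delta : 'I_n -> decoration).
Implicit Types (i j : 'I_n) (k : 'I_n.-1) (a b : 'I_n -> R).
Implicit Types (T S : {set 'I_n * 'I_n}) (F G : set 'rV[R]_n) (x y : 'rV[R]_n).
Implicit Types (c : 'rV[R]_n.-1) (X : {set {set 'I_n}}).

Local Notation U := (ups delta).
Local Notation D := (downs delta).
Local Notation cuts := (cuts U D).
Local Notation permutree := (is_permutree delta).
Local Notation P := (@permutreehedron R n delta).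
Local Notation widen := (widen_ord (leq_pred n)).

Definition embedded_vertex T : 'rV[R]_n := \row_i tree_vertex R delta T i.

Local Notation v := embedded_vertex.

Lemma embedded_vertexE T : (fun i => v T 0 i) = tree_vertex R delta T.
Proof. by apply/funext => i; rewrite mxE. Qed.

Lemma permutreehedronE x : P x <-> in_polytope delta (fun i => x 0 i).
Proof.
split=> -[xT xI]; split.
- by rewrite set_sumT.
- by move=> I hI; apply: xI; rewrite (cut_setsE R).
- by rewrite -xT set_sumT.
- by move=> I; rewrite (cut_setsE R) => hI; apply: xI.
Qed.

Definition weight_face a : set 'rV[R]_n := [set x | on_face delta a (fun i => x 0 i)].

Lemma weight_face_vertex a T : weight_face a (v T) = on_face delta a (tree_vertex R delta T).
Proof. by rewrite /weight_face /= embedded_vertexE. Qed.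

Lemma tree_weight_face a T : permutree T -> weight_face a (v T) <-> cuts a \subset edge_cuts T.
Proof. by move=> pT; rewrite weight_face_vertex; apply: tree_on_face. Qed.

Definition corner_tree a e : {set 'I_n * 'I_n} := weight_tree delta (corner a e).

Lemma corner_tree_permutree a e : permutree (corner_tree a e).
Proof. exact/weight_tree_permutree/corner_inj. Qed.

Lemma corner_tree_cuts a e : edge_cuts (corner_tree a e) = cuts (corner a e).
Proof. exact/weight_tree_cuts/corner_inj. Qed.

Lemma corner_tree_face a e : weight_face a (v (corner_tree a e)).
Proof.
apply/(tree_weight_face _ (corner_tree_permutree a e)); rewrite corner_tree_cuts.
exact: cuts_corner.
Qed.

(** The functional exposing a face is itself the weight. As the face is nonempty, its bound is the
    maximum, which a corner vertex attains. *)
Lemma facesP F : faces P F <-> exists a, F = weight_face a.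
Proof.
split=> [[[x0 Fx0] [a [b [le FE]]]]|[a ->]].
  exists (fun i => a 0 i); rewrite FE.
  pose w i := a 0 i; pose y := vertex delta (corner w xpredT).
  have Py : in_polytope delta y by apply/vertex_in_polytope/corner_inj.
  have yb : \sum_i w i * y i = b.
    move: Fx0; rewrite FE => -[/permutreehedronE Px0 x0b].
    have [h _] := polytope_max w xpredT Px0.
    apply/le_anti; apply/andP; split; last by rewrite -x0b.
    have := le (\row_i y i); under eq_bigr do rewrite mxE; apply.
    apply/permutreehedronE; suff -> : (fun i => (\row_i y i) 0 i) = y by [].
    by apply/funext => i; rewrite mxE.
  apply/seteqP; split=> x /=.
    move=> [/permutreehedronE Px xb]; have [_ h] := polytope_max w xpredT Px.
    by apply/h; rewrite -/y yb.
  move=> fx; have Px := proj1 fx; split; first exact/permutreehedronE.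
  by have [_ h] := polytope_max w xpredT Px; move/h: fx; rewrite -/y yb.
split.
  by exists (v (corner_tree a xpredT)); apply: corner_tree_face.
exists (\row_i a i), (\sum_i a i * vertex delta (corner a xpredT) i).
have E x : \sum_i (\row_i a i) 0 i * x 0 i = \sum_i a i * x 0 i.
  by apply: eq_bigr => i _; rewrite mxE.
split=> [x /permutreehedronE Px|].
  by rewrite E; have [] := polytope_max a xpredT Px.
apply/seteqP; split=> x /= => [fx|[/permutreehedronE Px]].
  have Px := proj1 fx; split; first exact/permutreehedronE.
  by rewrite E; have [_ h] := polytope_max a xpredT Px; apply/h.
by rewrite E => e; have [_ h] := polytope_max a xpredT Px; apply/h.
Qed.

Lemma weight_face_sub a b : weight_face a `<=` weight_face b <-> cuts b \subset cuts a.
Proof.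
split=> [h|/on_face_sub h]; last by move=> x; apply: h.
apply/on_face_sub => x fx; pose y : 'rV[R]_n := \row_i x i.
have yE : (fun i => y 0 i) = x by apply/funext => i; rewrite mxE.
by have := h y; rewrite /weight_face /= yE; apply.
Qed.

Lemma permutreehedron_face : exists a, P = weight_face a.
Proof.
exists (fun=> 0); apply/seteqP; split=> x /=.
  move=> /permutreehedronE Px; have [_ h] := polytope_max (fun=> 0) xpredT Px.
  by apply/h; rewrite !big1 // => i _; rewrite mul0r.
by case=> Px _; apply/permutreehedronE.
Qed.

(** Cubic vectors omit the last label; it has no labels to its right, so its coordinate and both its
    bounds are 0. *)
Definition pad c i : R := if insub (i : nat) is Some k then c 0 k else 0.

Lemma pad_widen c k : pad c (widen k) = c 0 k.
Proof. by rewrite /pad /= valK. Qed.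

Lemma padP (Q : 'I_n -> Prop) : (forall k, Q (widen k)) ->
  (forall i, (n.-1 <= i)%N -> Q i) -> forall i, Q i.
Proof.
move=> h1 h2 i; have [lt|] := ltnP i n.-1; last exact: h2.
by have := h1 (Ordinal lt); congr (Q _); apply: val_inj.
Qed.

Lemma lo_last a i : (n.-1 <= i)%N -> lo U D a i = 0 /\ hi U D a i = 0.
Proof.
move=> ni; have E (A : {set 'I_n}) : right_set U D A i = finset.set0.
  apply/setP => k; rewrite !inE; apply/negbTE; rewrite negb_and -leqNgt; apply/orP; right.
  by apply: leq_trans ni; rewrite -ltnS (ltn_predK (ltn_ord k)).
by rewrite /lo /hi /lo_set /hi_set !E cards0.
Qed.

Lemma pad_last c i : (n.-1 <= i)%N -> pad c i = 0.
Proof. by move=> ni; rewrite /pad insubF // ltnNge ni. Qed.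

Definition cell a : set 'rV[R]_n.-1 :=
  box (fun k => lo U D a (widen k)) (fun k => hi U D a (widen k)).

Lemma cellP a c : cell a c <-> in_box U D a (pad c).
Proof.
split=> [h|h k]; last by rewrite -pad_widen; apply: h.
apply: padP => [k|i ni]; first by rewrite pad_widen; apply: h.
by have [-> ->] := lo_last a ni; rewrite pad_last // lexx.
Qed.

Lemma relint_cell a c : relint (cell a) c <-> in_open_box U D a (pad c).
Proof.
split=> [/relint_box h|h]; last by apply/relint_box => k; rewrite -pad_widen; apply: h.
apply: padP => [k|i ni]; first by rewrite pad_widen; apply: h.
by have [-> ->] := lo_last a ni; rewrite pad_last //; left.
Qed.

Lemma cubic_vectorE T k : permutree T ->
  cubic_vector R delta T 0 k = (#|cubic R delta T (widen k)|%:R)%R.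
Proof. by move=> pT; rewrite mxE (cubic_lo_set R _ pT). Qed.

Lemma pad_cubic_vector T : permutree T ->
  pad (cubic_vector R delta T) = fun i => (#|cubic R delta T i|%:R)%R.
Proof.
move=> pT; apply/funext; apply: padP => [k|i ni]; first by rewrite pad_widen cubic_vectorE.
by rewrite pad_last //; have [] := lo_last (tree_weight R T) ni.
Qed.

Lemma cubic_vector_inj T S : permutree T -> permutree S ->
  cubic_vector R delta T = cubic_vector R delta S -> T = S.
Proof.
move=> pT pS e; apply: (cubic_inj (R := R) pT pS) => i.
have := congr1 (@^~ i) (pad_cubic_vector pT); rewrite e.
rewrite (congr1 (@^~ i) (pad_cubic_vector pS)) => /eqP.
by rewrite /= eqr_nat => /eqP/esym.
Qed.

Lemma cell_hull a :
  conv_hull (cubic_vector R delta @` [set S | permutree S /\ cuts a \subset edge_cuts S]) =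
  cell a.
Proof.
apply/seteqP; split.
  apply: smallest_sub; first exact: box_convex.
  move=> _ [S [pS sub] <-] k; rewrite cubic_vectorE //.
  by have [h1 h2] := cubic_cuts (widen k) pS sub; rewrite !ler_nat !subset_leq_card.
apply: box_corners; first by apply/convexP => x y t; apply: conv_hull_convex.
move=> c hc; apply: sub_gen_smallest.
(* The corner [c] itself tells at which labels ties have to be broken towards the upper bound. *)
pose e i := pad c i == hi U D a i.
exists (corner_tree a e).
  by split; [exact: corner_tree_permutree|rewrite corner_tree_cuts; apply: cuts_corner].
apply/rowP => k; rewrite cubic_vectorE; last exact: corner_tree_permutree.
rewrite /corner_tree cubic_corner /e pad_widen; case: eqP => [->//|ne].
by case: (hc k) => [->//|/ne].
Qed.

Lemma face_image_cell a : face_image delta v (weight_face a) = cell a.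
Proof.
rewrite -cell_hull /face_image; congr (conv_hull (_ @` _)).
apply/seteqP; split=> T [pT h]; split=> //.
  exact/(tree_weight_face a pT).
exact/(tree_weight_face a pT).
Qed.

(** For the direct implication, the centre of the box of [a] lies in the open box of some [d]
    refining [b], by [box_cover]. Then [a] and [d] have the same cuts, which include those of
    [b]. *)
Lemma cell_sub a b : cell a `<=` cell b <-> cuts b \subset cuts a.
Proof.
split=> [h|sub]; last first.
  rewrite -!cell_hull; apply: sub_smallest2r.
    by apply/convexP => x y t; apply: conv_hull_convex.
  by apply: image_subset => T [pT sT]; split=> //; exact: fintype.subset_trans sub sT.
have [c hc] : exists c, relint (cell a) c.
  pose c : 'rV[R]_n.-1 := \row_k ((lo U D a (widen k) + hi U D a (widen k)) / 2).
  exists c; apply/relint_box => k; rewrite mxE.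
  have : lo U D a (widen k) <= hi U D a (widen k) by rewrite ler_nat subset_leq_card ?lo_hi_set.
  rewrite le_eqVlt => /orP[/eqP ->|lt]; [left|right; apply/andP].
    by split; lra.
  by split; lra.
have /cellP/box_cover[d [ref hd]] : cell b c by apply: h; case: hc.
rewrite (open_box_inj (proj1 (relint_cell _ _) hc) hd).
exact: cuts_refine.
Qed.

Lemma cubical_cellsP Q : cubical_cells delta Q <-> exists a, Q = cell a.
Proof.
split=> [[T [X [pT XT ->]]]|[a ->]].
  exists (family_weight R X); rewrite -cell_hull; congr (conv_hull (_ @` _)).
  apply/seteqP; split=> S [pS h]; split=> //.
    exact/(family_cuts R pT XT pS).
  exact/(family_cuts R pT XT pS).
exists (corner_tree a xpredT), (cuts a); split; first exact: corner_tree_permutree.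
  by rewrite corner_tree_cuts; apply: cuts_corner.
by rewrite cell_hull.
Qed.

Lemma cell_face_sub a b : cell a `<=` cell b <-> weight_face a `<=` weight_face b.
Proof. by rewrite cell_sub weight_face_sub. Qed.

Lemma cell_face_eq a b : cell a = cell b <-> weight_face a = weight_face b.
Proof.
split=> e; apply/seteqP; split.
- by apply/cell_face_sub; rewrite e.
- by apply/cell_face_sub; rewrite e.
- by apply/cell_face_sub; rewrite e.
- by apply/cell_face_sub; rewrite e.
Qed.

Lemma vertex_face T : permutree T -> weight_face (tree_weight R T) = [set v T].
Proof.
move=> pT; apply/seteqP; split=> x /=.
  move=> fx; apply/rowP => i; rewrite mxE.
  exact: (on_face_vertex (tree_weight_inj pT) fx).
by move=> ->; apply/(tree_weight_face _ pT); rewrite -tree_weight_cuts.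
Qed.

Lemma embedded_vertex_inj T S : permutree T -> permutree S -> v T = v S -> T = S.
Proof.
move=> pT pS e; apply: (edge_cuts_subset pT pS).
rewrite (tree_weight_cuts R pT); apply/(tree_weight_face _ pS).
by rewrite (vertex_face pT); exact: esym e.
Qed.

Lemma weight_face_convex a : @convex_set R 'rV[R]_n (weight_face a).
Proof.
apply/convexP => x y t /andP[t0 t1] [[xT xP] xa] [[yT yP] ya].
have t1' : 0 <= 1 - t by rewrite subr_ge0.
have E (I : {set 'I_n}) : set_sum (fun i => (t *: x + (1 - t) *: y) 0 i) I =
    t * set_sum (fun i => x 0 i) I + (1 - t) * set_sum (fun i => y 0 i) I.
  by rewrite /set_sum !mulr_sumr -big_split; apply: eq_bigr => i _; rewrite !mxE.
have C (r : R) : r = t * r + (1 - t) * r by rewrite -mulrDl addrC subrK mul1r.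
split; [split=> [|I hI]|move=> I hI].
- by rewrite E xT yT -C.
- by rewrite E [X in X <= _]C; apply: lerD; apply: ler_wpM2l => //; [apply: xP|apply: yP].
- by rewrite /tight E xa // ya // -C.
Qed.

Lemma rotation_edge T S : rotation delta T S -> is_edge P (v T) (v S).
Proof.
move=> TS; have ne := rotation_neq TS.
have /rotationP[pT pS [i [j [ij adj]]]] := TS.
split; first by move=> e; case/eqP: ne; apply: embedded_vertex_inj.
set X := edge_cuts T :\ edge_cut T (i, j).
have XT : X \subset edge_cuts T by apply: subD1set.
have XS : X \subset edge_cuts S by have [_ _ _ e] := adj; rewrite /X e subD1set.
apply/facesP; exists (family_weight R X); apply/seteqP; split.
  apply: smallest_sub; first exact: weight_face_convex.
  move=> x [->|->].
    by apply/(tree_weight_face _ pT)/(family_cuts R pT XT pT).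
  by apply/(tree_weight_face _ pS)/(family_cuts R pT XT pS).
move=> x fx; rewrite conv_hull_segment.
have [t t01 Et] := adjacent_segment pT pS adj (proj1 fx)
  (proj1 (family_on_face pT XT (proj1 fx)) fx).
exists t => //; apply/rowP => k; rewrite [LHS](Et k).
by rewrite /embedded_vertex !mxE.
Qed.

Lemma is_edgeC x y : is_edge P x y -> is_edge P y x.
Proof. by move=> [ne h]; split; [move/esym|rewrite setUC]. Qed.

Lemma edge_rotation T S : permutree T -> permutree S -> is_edge P (v T) (v S) ->
  rotation delta T S \/ rotation delta S T.
Proof.
move=> pT pS [ne /facesP[a Ea]].
have TS : T != S by apply: contra_not_neq ne => ->.
have inT : weight_face a (v T) by rewrite -Ea; apply: sub_gen_smallest; left.
have inS : weight_face a (v S) by rewrite -Ea; apply: sub_gen_smallest; right.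
have seg (x : 'I_n -> R) : on_face delta a x -> exists t : R, forall i,
    x i = tree_vertex R delta T i + t * (tree_vertex R delta S i - tree_vertex R delta T i).
  move=> fx; have : weight_face a (\row_i x i).
    by rewrite /weight_face /=; under eq_fun do rewrite mxE.
  rewrite -Ea conv_hull_segment => -[t _ /rowP e]; exists t => i.
  by have := e i; rewrite !mxE.
rewrite weight_face_vertex in inT; rewrite weight_face_vertex in inS.
have [e eT e1] := segment_adjacent pT pS TS inT inS seg.
have seg' (x : 'I_n -> R) : on_face delta a x -> exists t : R, forall i,
    x i = tree_vertex R delta S i + t * (tree_vertex R delta T i - tree_vertex R delta S i).
  have swap (p q r : R) : p + r * (q - p) = q + (1 - r) * (p - q) by ring.
  move=> h; have [t Et] := seg x h; exists (1 - t) => i.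
  exact: (etrans (Et i) (swap _ _ _)).
have ST : S != T by rewrite eq_sym.
have [f fS e2] := segment_adjacent pS pT ST inS inT seg'.
have adj : adjacent_cuts T S e f.
  by split; [exact: TS|exact: eT|exact: fS|exact: etrans (esym e1) e2].
exact: (adjacent_rotation R pT pS adj).
Qed.

Lemma cubical_edgeP T S : permutree T -> permutree S ->
  cubical_edge delta (cubic_vector R delta T) (cubic_vector R delta S) <->
  rotation delta T S \/ rotation delta S T.
Proof.
(* [cubical_edge] only speaks of points, so the trees it provides have to be identified through the
   injectivity of cubic vectors. *)
move=> pT pS; split=> [[T' [S' [eT eS h]]]|h]; last first.
  exists T, S; split=> //.
  by rewrite (rotation_coverE R delta T) (rotation_coverE R delta S).
rewrite (rotation_coverE R delta T') (rotation_coverE R delta S') in h.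
have [pT' pS'] : permutree T' /\ permutree S'.
  by case: h => /rotationP[].
by rewrite (cubic_vector_inj pT pT' eT) (cubic_vector_inj pS pS' eS).
Qed.

Lemma face_image_top : face_image delta v P = @cubical_hull R n delta.
Proof.
rewrite /face_image /cubical_hull; congr (conv_hull (_ @` _)).
apply/seteqP; split=> T; first by case.
move=> pT; split=> //; apply/permutreehedronE; rewrite embedded_vertexE.
exact: tree_vertex_in_polytope.
Qed.

Lemma permutreehedron_embedding : cubical_embedding delta v.
Proof.
split.
- split.
  + move=> T pT; apply/facesP; exists (tree_weight R T).
    by rewrite vertex_face.
  + by move=> T S /[!inE] pT pS; apply: embedded_vertex_inj.
  + move=> u /facesP[a ua]; exists (corner_tree a xpredT).
      exact: corner_tree_permutree.
    by have := corner_tree_face a xpredT; rewrite -ua.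
- by move=> T S /[!inE] pT pS; apply: cubic_vector_inj.
- move=> T S pT pS; split.
    by move=> e; apply/(cubical_edgeP pT pS)/edge_rotation.
  move=> /(cubical_edgeP pT pS)[|] h; first exact: rotation_edge.
  exact/is_edgeC/rotation_edge.
- exact: face_image_top.
- split.
  + move=> F /facesP[a ->]; apply/cubical_cellsP; exists a.
    exact: face_image_cell.
  + move=> F G /[!inE] /facesP[a ->] /facesP[b ->].
    by rewrite !face_image_cell => /cell_face_eq.
  + move=> Q /cubical_cellsP[a ->]; exists (weight_face a).
      by apply/facesP; exists a.
    exact: face_image_cell.
- by move=> F G /facesP[a ->] /facesP[b ->]; rewrite !face_image_cell cell_face_sub.
- move=> G c /facesP[a ->]; rewrite face_image_cell => /cellP/box_cover[b [ref op]].
  exists (weight_face b); split; first by apply/facesP; exists b.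
    by apply/weight_face_sub/cuts_refine.
  by rewrite face_image_cell; apply/relint_cell.
- move=> F G c /facesP[a ->] /facesP[b ->]; rewrite !face_image_cell.
  move=> /relint_cell ha /relint_cell hb; have e := open_box_inj ha hb.
  by apply/seteqP; split; apply/weight_face_sub; rewrite e.
Qed.

(** [face_image] is an isomorphism of the inclusion orders that sends the polytope to the hull, so
    maximal proper elements correspond. *)
Lemma facets_maximal_cells :
  set_bij (facets P) (maximal_cells delta) (face_image delta v).
Proof.
have [p Pp] := permutreehedron_face.
have top : @cubical_hull R n delta = cell p by rewrite -face_image_top Pp face_image_cell.
split.
- move=> F [/facesP[a ->] ne mx]; rewrite face_image_cell; split.
  + by apply/cubical_cellsP; exists a.
  + by rewrite top => /cell_face_eq; rewrite -Pp.
  + move=> Q /cubical_cellsP[b ->]; rewrite top => neb /cell_face_sub sub.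
    apply/cell_face_eq/mx => //; first by apply/facesP; exists b.
    by rewrite Pp => /cell_face_eq.
- move=> F G /[!inE] -[/facesP[a ->] _ _] [/facesP[b ->] _ _].
  by rewrite !face_image_cell => /cell_face_eq.
- move=> Q [/cubical_cellsP[a ->]]; rewrite top => ne mx.
  exists (weight_face a); last exact: face_image_cell.
  split; first by apply/facesP; exists a.
    by rewrite Pp => /cell_face_eq.
  move=> F /facesP[b ->]; rewrite Pp => neb /cell_face_sub sub.
  apply/cell_face_eq/mx => //; first by apply/cubical_cellsP; exists b.
  by move=> /cell_face_eq.
Qed.

End Embedding.

Theorem theorem3p10 (R : realType) (n : nat) (hn : (0 < n)%N)
  (delta : 'I_n -> decoration)
  (hdelta : forall i : 'I_n, (i : nat) = 0%N \/ i.+1 = n -> delta i = none) :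
  exists v : {set 'I_n * 'I_n} -> 'rV[R]_n,
    cubical_embedding delta v /\
    set_bij (facets (permutreehedron delta)) (maximal_cells delta)
      (face_image delta v).
Proof.
exists (embedded_vertex R delta); split; first exact: permutreehedron_embedding.
exact: facets_maximal_cells.
Qed.
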